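(* Let $\mathcal A$ be a regular multiplier Hopf algebroid with base weight $\mu$ and antipode $S$, let $\phi$ be a full and faithful left integral and $\psi$ a full and faithful right integral on $\mathcal A$ adapted to $\mu$. Then $\phi$ and $\psi$ possess modular automorphisms $\sigma^\phi$ and $\sigma^\psi$, respectively, whose extensions to $M(A)$ satisfy $$\sigma^\phi(y)=\sigma^\mu_C(y)=S^2(y)\ \text{ for all }y\in C,\qquad \sigma^\psi(x)=\sigma^\mu_B(x)=S^{-2}(x)\ \text{ for all }x\in B.$$ Furthermore, $$\Delta_B\circ\sigma^\phi=(S^2\otimes\sigma^\phi)\circ\Delta_B,\quad \Delta_C\circ\sigma^\phi=(S^2\otimes\sigma^\phi)\circ\Delta_C,\quad \Delta_B\circ\sigma^\psi=(\sigma^\psi\otimes S^{-2})\circ\Delta_B,\quad \Delta_C\circ\sigma^\psi=(\sigma^\psi\otimes S^{-2})\circ\Delta_C .$$ If $\mathcal A$ is flat, then $\sigma^\phi(M(B))=M(B)$ and $\sigma^\psi(M(C))=M(C)$.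
   Context: Conventions. Algebras are over $\mathbb C$ and need not be unital; products $XY$ of subspaces denote linear spans. An algebra $A$ is non-degenerate if $aA\neq 0\neq Aa$ for $a\ne 0$; $M(A)$ is its multiplier algebra. A functional $\omega$ on $D$ is faithful if $\omega(dD)\ne0\ne\omega(Dd)$ for all $d\neq 0$. A modular automorphism of a functional $\omega$ on $D$ is an algebra automorphism $\sigma$ of $D$ with $\omega(ab)=\omega(b\sigma(a))$ for all $a,b\in D$. Regular multiplier Hopf algebroids. Compatible left and right quantum graphs consist of a non-degenerate algebra $A$, commuting subalgebras $B,C\subseteq M(A)$ and anti-isomorphisms $S_B:B\to C$, $S_C:C\to B$ with $BA=AB=CA=AC=A$, such that (i) either every finite $F\subseteq A$ admits $e\in A$ with $ae=a$ for $a\in F$, or the left modules ${}_BA,{}_CA$ are flat; (ii) either every finite $F\subseteq A$ admits $e\in A$ with $ea=a$ for $a\in F$, or the right modules $A_B,A_C$ are flat. Since $BA=A=AB$ and $CA=A=AC$, $M(B)$ and $M(C)$ are regarded as subalgebras of $M(A)$. Quotients of $A\otimes A$ are defined by the relations (for $x\in B$, $y\in C$): $A\otimes_BA$: $ax\otimes b=a\otimes xb$; $A\otimes_CA$: $ay\otimes b=a\otimes yb$; $A\otimes^BA$: $xa\otimes b=a\otimes bx$; $A\otimes^CA$: $ya\otimes b=a\otimes by$; $A\otimes_lA$: $xa\otimes b=a\otimes S_B(x)b$; $A\otimes_rA$: $aS_C(y)\otimes b=a\otimes by$. A left comultiplication is a homomorphism $\Delta_B:A\to\mathrm{End}(A\otimes_lA)$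 such that for each $a$ there are elements $\Delta_B(a)(1\otimes b)$, $\Delta_B(a)(b\otimes1)$ of $A\otimes_lA$ with $\Delta_B(a)(b\otimes c)=(\Delta_B(a)(1\otimes c))(b\otimes1)=(\Delta_B(a)(b\otimes1))(1\otimes c)$, and $\Delta_B(xyax'y')=(y\otimes x)\Delta_B(a)(y'\otimes x')$ for $x,x'\in B$, $y,y'\in C$, and $((\Delta_B\otimes\mathrm{id})(\Delta_B(b)(1\otimes c)))(a\otimes1\otimes1)=((\mathrm{id}\otimes\Delta_B)(\Delta_B(b)(a\otimes1)))(1\otimes1\otimes c)$. A right comultiplication is a homomorphism $\Delta_C:A\to\mathrm{End}(A\otimes_rA)^{op}$ (acting from the right) such that there are elements $(a\otimes1)\Delta_C(c),(1\otimes b)\Delta_C(c)\in A\otimes_rA$ with $(a\otimes b)\Delta_C(c)=(1\otimes b)((a\otimes1)\Delta_C(c))=(a\otimes1)((1\otimes b)\Delta_C(c))$, and $\Delta_C(xyax'y')=(y\otimes x)\Delta_C(a)(y'\otimes x')$, $(a\otimes1\otimes1)((\Delta_C\otimes\mathrm{id})((1\otimes c)\Delta_C(b)))=(1\otimes1\otimes c)((\mathrm{id}\otimes\Delta_C)((a\otimes1)\Delta_C(b)))$. These data form a multiplier bialgebroid $\mathcal A$ if also $((\Delta_B\otimes\mathrm{id})((1\otimes c)\Delta_C(b)))(a\otimes1\otimes1)=(1\otimes1\otimes c)((\mathrm{id}\otimes\Delta_C)(\Delta_B(b)(a\otimes1)))$ and $(a\otimes1\otimes1)((\Delta_C\otimes\mathrm{id})(\Delta_B(b)(1\otimes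 c)))=((\mathrm{id}\otimes\Delta_B)((a\otimes1)\Delta_C(b)))(1\otimes1\otimes c)$. It is a regular multiplier Hopf algebroid if the canonical maps $T_\lambda:A\otimes^CA\to A\otimes_lA$, $a\otimes b\mapsto\Delta_B(b)(a\otimes1)$; $T_\rho:A\otimes_BA\to A\otimes_lA$, $a\otimes b\mapsto\Delta_B(a)(1\otimes b)$; ${}_\lambda T:A\otimes_CA\to A\otimes_rA$, $a\otimes b\mapsto(a\otimes1)\Delta_C(b)$; ${}_\rho T:A\otimes^BA\to A\otimes_rA$, $a\otimes b\mapsto(1\otimes b)\Delta_C(a)$ are bijective. It is flat if the modules ${}_BA,A_B,{}_CA,A_C$ are all flat. Sweedler notation: $\Delta_B(a)(1\otimes b)=\sum a_{(1)}\otimes a_{(2)}b$, $\Delta_B(b)(a\otimes 1)=\sum b_{(1)}a\otimes b_{(2)}$, $(a\otimes1)\Delta_C(b)=\sum ab_{(1)}\otimes b_{(2)}$, $(1\otimes b)\Delta_C(a)=\sum a_{(1)}\otimes ba_{(2)}$. There are then a unique left counit ${}_B\varepsilon:A\to B$ and right counit $\varepsilon_C:A\to C$ with ${}_B\varepsilon(xa)=x\,{}_B\varepsilon(a)$, ${}_B\varepsilon(S_B(x)a)={}_B\varepsilon(a)x$, $\sum S_B({}_B\varepsilon(a_{(1)}))a_{(2)}b=ab$, $\sum{}_B\varepsilon(b_{(2)})b_{(1)}a=ba$, ${}_B\varepsilon(ab)={}_B\varepsilon(a\,{}_B\varepsilon(b))={}_B\varepsilon(aS_B({}_B\varepsilon(b)))$,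 and $\varepsilon_C(ay)=\varepsilon_C(a)y$, $\varepsilon_C(aS_C(y))=y\varepsilon_C(a)$, $\sum ba_{(2)}\varepsilon_C(a_{(1)})=ba$, $\sum ab_{(1)}S_C(\varepsilon_C(b_{(2)}))=ab$, $\varepsilon_C(ab)=\varepsilon_C(\varepsilon_C(a)b)=\varepsilon_C(S_C(\varepsilon_C(a))b)$; and there is a unique antipode, a bijective anti-homomorphism $S:A\to A$ with $S(xyax'y')=S_C(y')S_B(x')S(a)S_C(y)S_B(x)$, $\sum S(a_{(1)})a_{(2)}b=S_C(\varepsilon_C(a))b$, $\sum ab_{(1)}S(b_{(2)})=aS_B({}_B\varepsilon(b))$. It extends to $M(A)$ and restricts to $S_B$ on $B$ and $S_C$ on $C$. Base weights and integrals. A base weight is a pair $\mu=(\mu_B,\mu_C)$ of faithful functionals on $B$ and $C$ with $\mu_B\circ S_C=\mu_C$, $\mu_C\circ S_B=\mu_B$, $\mu_B\circ{}_B\varepsilon=\mu_C\circ\varepsilon_C$. A functional $\omega\in A^\vee$ (dual vector space) is adapted to $\mu$ if there are (necessarily unique) maps ${}_B\omega,\omega_B:A\to B$, ${}_C\omega,\omega_C:A\to C$ with $\omega(xa)=\mu_B(x\,{}_B\omega(a))$, $\omega(ax)=\mu_B(\omega_B(a)x)$, $\omega(ya)=\mu_C(y\,{}_C\omega(a))$, $\omega(ay)=\mu_C(\omega_C(a)y)$ for all $x\in B,y\in C,a\in A$. A left integral is an adapted $\phi$ with $\sum S_B^{-1}({}_C\phi(b_{(2)}))b_{(1)}a={}_C\phi(b)a$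 for all $a,b$, equivalently $\sum ab_{(1)}S_C(\phi_C(b_{(2)}))=a\phi_C(b)$ for all $a,b$ (then ${}_C\phi=\phi_C$). A right integral is an adapted $\psi$ with $\sum S_B({}_B\psi(a_{(1)}))a_{(2)}b={}_B\psi(a)b$ for all $a,b$, equivalently $\sum ba_{(2)}S_C^{-1}(\psi_B(a_{(1)}))=b\psi_B(a)$ for all $a,b$ (then ${}_B\psi=\psi_B$). A left integral $\phi$ is full if ${}_B\phi,\phi_B:A\to B$ are surjective; a right integral $\psi$ is full if ${}_C\psi,\psi_C:A\to C$ are surjective. Notation in the claim. $\sigma^\mu_B:=S_B^{-1}\circ S_C^{-1}$ and $\sigma^\mu_C:=S_B\circ S_C$ (modular automorphisms of $\mu_B$, $\mu_C$). For automorphisms $\alpha,\beta$ of $A$ for which $\alpha\otimes\beta$ descends to $A\otimes_lA$ and $A\otimes_rA$, the equation $\Delta_B\circ\gamma=(\alpha\otimes\beta)\circ\Delta_B$ means $\Delta_B(\gamma(a))(\alpha(b)\otimes\beta(c))=(\alpha\otimes\beta)(\Delta_B(a)(b\otimes c))$ for all $a,b,c\in A$, and $\Delta_C\circ\gamma=(\alpha\otimes\beta)\circ\Delta_C$ means $(\alpha(b)\otimes\beta(c))\Delta_C(\gamma(a))=(\alpha\otimes\beta)((b\otimes c)\Delta_C(a))$. *)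

(* Defs.v *)
From HB Require Import structures.
From mathcomp Require Import all_boot all_order all_algebra.
From mathcomp Require Import boolp classical_sets reals.
From mathcomp.real_closed Require Export complex.

Set Implicit Arguments.
Unset Strict Implicit.
Unset Printing Implicit Defensive.

Import GRing.Theory.
Local Open Scope ring_scope.
Local Open Scope quotient_scope.

Reserved Notation "a ** b" (at level 40, left associativity).
Reserved Notation "m *> a" (at level 40, no associativity).
Reserved Notation "a <* m" (at level 40, no associativity).
Reserved Notation "a ⊗ b" (at level 45, no associativity).

HB.mixin Record Lmodule_isNUAlgebra (K : fieldType) A
    of GRing.Lmodule K A := {
  nmul : A -> A -> A;
  nmulA : associative nmul;
  nmulDl : forall a b c, nmul (a + b) c = nmul a c + nmul b c;
  nmulDr : forall a b c, nmul a (b + c) = nmul a b + nmul a c;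
  nmulZl : forall (k : K) a b, nmul (k *: a) b = k *: nmul a b;
  nmulZr : forall (k : K) a b, nmul a (k *: b) = k *: nmul a b
}.

#[short(type="nualgType")]
HB.structure Definition NUAlgebra (K : fieldType) :=
  {A of Lmodule_isNUAlgebra K A & GRing.Lmodule K A}.

Notation "a ** b" := (nmul a b) : ring_scope.

Definition nondegenerate (K : fieldType) (A : nualgType K) : Prop :=
  forall a : A, a <> 0 ->
    (exists b : A, a ** b <> 0) /\ (exists b : A, b ** a <> 0).

Record nu_hom (K : fieldType) (A B : nualgType K) := NuHom {
  hom_fun :> {linear A -> B};
  hom_mul : forall a b : A, hom_fun (a ** b) = hom_fun a ** hom_fun b
}.

Record nu_iso (K : fieldType) (A B : nualgType K) := NuIso {
  iso_fun :> {linear A -> B};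
  iso_mul : forall a b : A, iso_fun (a ** b) = iso_fun a ** iso_fun b;
  iso_inv : B -> A;
  isoK : cancel iso_fun iso_inv;
  isoVK : cancel iso_inv iso_fun
}.

Record anti_iso (K : fieldType) (A B : nualgType K) := AntiIso {
  anti_fun :> {linear A -> B};
  anti_mul : forall a b : A, anti_fun (a ** b) = anti_fun b ** anti_fun a;
  anti_inv : B -> A;
  antiK : cancel anti_fun anti_inv;
  antiVK : cancel anti_inv anti_fun
}.

Section AntiInverse.
Variables (K : fieldType) (A B : nualgType K) (S : anti_iso A B).

Lemma anti_inv_linear : linear (anti_inv S).
Proof.
by move=> k x y; apply: (can_inj (antiK S)); rewrite linearP !antiVK.
Qed.

HB.instance Definition _ :=
  GRing.isLinear.Build K B A *:%R (anti_inv S) anti_inv_linear.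

Lemma anti_inv_mul (x y : B) :
  anti_inv S (x ** y) = anti_inv S y ** anti_inv S x.
Proof. by apply: (can_inj (antiK S)); rewrite anti_mul !antiVK. Qed.

Definition inverse_anti_iso : anti_iso B A :=
  @AntiIso K B A (anti_inv S) anti_inv_mul (anti_fun S) (antiVK S) (antiK S).

End AntiInverse.

(* For non-degenerate [A] the compatibility condition [mult_compat] already
   forces [L (a ** b) = L a ** b] and [R (a ** b) = a ** R b]. *)
Record mult (K : fieldType) (A : nualgType K) := Mult {
  mL : A -> A;
  mR : A -> A;
  mL_linear : linear mL;
  mR_linear : linear mR;
  mult_compat : forall a b : A, a ** mL b = mR a ** b
}.

Notation "m *> a" := (mL m a) : ring_scope.
Notation "a <* m" := (mR m a) : ring_scope.

Section MultiplierAlgebra.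
Variables (K : fieldType) (A : nualgType K).
Implicit Types (m n p : mult A).

HB.instance Definition _ m :=
  GRing.isLinear.Build K A A *:%R (mL m) (mL_linear m).
HB.instance Definition _ m :=
  GRing.isLinear.Build K A A *:%R (mR m) (mR_linear m).

Lemma mult_eq m n : mL m =1 mL n -> mR m =1 mR n -> m = n.
Proof.
case: m n => [l r ll rl c] [l' r' ll' rl' c'] /= /funext el /funext er.
by subst l' r'; congr Mult; apply: Prop_irrelevance.
Qed.

HB.instance Definition _ := gen_eqMixin (mult A).
HB.instance Definition _ := gen_choiceMixin (mult A).

Program Definition mult_zero : mult A := @Mult K A (fun=> 0) (fun=> 0) _ _ _.
Next Obligation. by move=> k x y; rewrite scaler0 addr0. Qed.
Next Obligation. by move=> k x y; rewrite scaler0 addr0. Qed.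
Next Obligation. by rewrite -(scale0r 0) nmulZl nmulZr !scale0r. Qed.

Program Definition mult_scale (k : K) m : mult A :=
  @Mult K A (fun a => k *: (m *> a)) (fun a => k *: (a <* m)) _ _ _.
Next Obligation. by move=> l x y; rewrite linearP scalerDr !scalerA mulrC. Qed.
Next Obligation. by move=> l x y; rewrite linearP scalerDr !scalerA mulrC. Qed.
Next Obligation. by rewrite nmulZr nmulZl mult_compat. Qed.

Program Definition mult_add m n : mult A :=
  @Mult K A (fun a => m *> a + n *> a) (fun a => a <* m + a <* n) _ _ _.
Next Obligation. by move=> k x y; rewrite !linearP scalerDr addrACA. Qed.
Next Obligation. by move=> k x y; rewrite !linearP scalerDr addrACA. Qed.
Next Obligation. by rewrite nmulDr nmulDl !mult_compat. Qed.

Program Definition mult_mul m n : mult A :=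
  @Mult K A (fun a => m *> (n *> a)) (fun a => (a <* m) <* n) _ _ _.
Next Obligation. by move=> k x y; rewrite !linearP. Qed.
Next Obligation. by move=> k x y; rewrite !linearP. Qed.
Next Obligation. by rewrite !mult_compat. Qed.

Lemma mult_addA : associative mult_add.
Proof. by move=> m n p; apply: mult_eq => a /=; rewrite addrA. Qed.
Lemma mult_addC : commutative mult_add.
Proof. by move=> m n; apply: mult_eq => a /=; rewrite addrC. Qed.
Lemma mult_add0 : left_id mult_zero mult_add.
Proof. by move=> m; apply: mult_eq => a /=; rewrite add0r. Qed.
Lemma mult_addN : left_inverse mult_zero (mult_scale (-1)) mult_add.
Proof. by move=> m; apply: mult_eq => a /=; rewrite scaleN1r addNr. Qed.

HB.instance Definition _ :=
  GRing.isZmodule.Build (mult A) mult_addA mult_addC mult_add0 mult_addN.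

Lemma mult_scaleA (k l : K) m :
  mult_scale k (mult_scale l m) = mult_scale (k * l) m.
Proof. by apply: mult_eq => a /=; rewrite scalerA. Qed.
Lemma mult_scale1 : left_id 1 mult_scale.
Proof. by move=> m; apply: mult_eq => a /=; rewrite scale1r. Qed.
Lemma mult_scaleDr : right_distributive mult_scale +%R.
Proof. by move=> k m n; apply: mult_eq => a /=; rewrite scalerDr. Qed.
Lemma mult_scaleDl m : {morph mult_scale^~ m : k l / k + l}.
Proof. by move=> k l; apply: mult_eq => a /=; rewrite scalerDl. Qed.

HB.instance Definition _ := GRing.Zmodule_isLmodule.Build K (mult A)
  mult_scaleA mult_scale1 mult_scaleDr mult_scaleDl.

Lemma mult_mulA : associative mult_mul.
Proof. by move=> m n p; apply: mult_eq. Qed.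
Lemma mult_mulDl m n p : mult_mul (m + n) p = mult_mul m p + mult_mul n p.
Proof. by apply: mult_eq => a //=; rewrite linearD. Qed.
Lemma mult_mulDr m n p : mult_mul m (n + p) = mult_mul m n + mult_mul m p.
Proof. by apply: mult_eq => a //=; rewrite linearD. Qed.
Lemma mult_mulZl (k : K) m n : mult_mul (k *: m) n = k *: mult_mul m n.
Proof. by apply: mult_eq => a //=; rewrite linearZ. Qed.
Lemma mult_mulZr (k : K) m n : mult_mul m (k *: n) = k *: mult_mul m n.
Proof. by apply: mult_eq => a //=; rewrite linearZ. Qed.

HB.instance Definition _ := Lmodule_isNUAlgebra.Build K (mult A)
  mult_mulA mult_mulDl mult_mulDr mult_mulZl mult_mulZr.

Lemma iso_inv_linear (s : nu_iso A A) : linear (iso_inv s).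
Proof. by move=> k x y; apply: (can_inj (isoK s)); rewrite linearP !isoVK. Qed.

(* The unique extension of an automorphism is conjugation of multipliers. *)
Program Definition mult_ext (s : nu_iso A A) m : mult A :=
  @Mult K A (fun a => s (m *> iso_inv s a)) (fun a => s (iso_inv s a <* m))
    _ _ _.
Next Obligation. by move=> k x y; rewrite iso_inv_linear !linearP. Qed.
Next Obligation. by move=> k x y; rewrite iso_inv_linear !linearP. Qed.
Next Obligation.
by rewrite -{1}(isoVK s a) -iso_mul mult_compat iso_mul isoVK.
Qed.

(* The extension of an anti-automorphism exchanges left and right actions. *)
Program Definition mult_anti_ext (S : anti_iso A A) m : mult A :=
  @Mult K A (fun a => S (anti_inv S a <* m)) (fun a => S (m *> anti_inv S a))
    _ _ _.
Next Obligation. by move=> k x y; rewrite !linearP. Qed.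
Next Obligation. by move=> k x y; rewrite !linearP. Qed.
Next Obligation.
by rewrite -{1}(antiVK S a) -anti_mul -mult_compat anti_mul antiVK.
Qed.

End MultiplierAlgebra.

(* For a subalgebra [i : B -> M(A)] with BA = A = AB, the set of those
   multipliers of [A] that are the image of a multiplier [T] of [B] under the
   inclusion of M(B) into M(A). *)
Definition mult_of_sub (K : fieldType) (A B : nualgType K)
    (i : nu_hom B (mult A)) : set (mult A) :=
  [set m | exists T : mult B,
     forall x : B, m ** i x = i (T *> x) /\ i x ** m = i (x <* T)]%classic.

(* [tens f g] is the quotient of the tensor product of [M] and [N] over [K]
   by the relations  f x m ⊗ n = m ⊗ g x n  (x : X).  Its elements are classes
   of finite sequences of pairs, read as sums of elementary tensors. *)
Section Tensor.
Variables (K : fieldType) (X : Type) (M N : lmodType K).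
Variables (f : X -> M -> M) (g : X -> N -> N).

Inductive tens_rel : seq (M * N) -> seq (M * N) -> Prop :=
| tens_refl s : tens_rel s s
| tens_sym s t : tens_rel s t -> tens_rel t s
| tens_trans s t u : tens_rel s t -> tens_rel t u -> tens_rel s u
| tens_cat s s' t t' :
    tens_rel s s' -> tens_rel t t' -> tens_rel (s ++ t) (s' ++ t')
| tens_catC s t : tens_rel (s ++ t) (t ++ s)
| tens_0 n : tens_rel [:: (0, n)] [::]
| tens_Dl m m' n : tens_rel [:: (m + m', n)] [:: (m, n); (m', n)]
| tens_Dr m n n' : tens_rel [:: (m, n + n')] [:: (m, n); (m, n')]
| tens_Z (k : K) m n : tens_rel [:: (k *: m, n)] [:: (m, k *: n)]
| tens_bal (k : K) x m n : tens_rel [:: (k *: f x m, n)] [:: (k *: m, g x n)].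

Definition tens_relb (s t : seq (M * N)) : bool := `[< tens_rel s t >].

Lemma tens_relb_refl : reflexive tens_relb.
Proof. by move=> s; apply/asboolP; apply: tens_refl. Qed.
Lemma tens_relb_sym : symmetric tens_relb.
Proof.
by move=> s t; apply/asboolP/asboolP => h; apply: tens_sym.
Qed.
Lemma tens_relb_trans : transitive tens_relb.
Proof.
move=> t s u /asboolP h /asboolP h'; apply/asboolP.
exact: tens_trans h h'.
Qed.

Canonical tens_equiv :=
  EquivRel tens_relb tens_relb_refl tens_relb_sym tens_relb_trans.

Definition tens := {eq_quot tens_equiv}.
HB.instance Definition _ : EqQuotient _ tens_equiv tens := EqQuotient.on tens.
HB.instance Definition _ := Choice.on tens.

Definition tclass (s : seq (M * N)) : tens := \pi_tens s.
Definition trepr (t : tens) : seq (M * N) := repr t.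
Definition tpair (m : M) (n : N) : tens := tclass [:: (m, n)].

Lemma treprK t : tclass (trepr t) = t.
Proof. exact: reprK. Qed.

Lemma tclassP s t : tclass s = tclass t <-> tens_rel s t.
Proof.
split; first by move=> /eqquotP /asboolP.
by move=> h; apply/eqquotP; apply/asboolP.
Qed.

Lemma tclass_repr s : tens_rel (trepr (tclass s)) s.
Proof. by apply/tclassP; rewrite treprK. Qed.

Definition tzero : tens := tclass [::].
Definition tadd (s t : tens) : tens := tclass (trepr s ++ trepr t).
Definition tscale (k : K) (t : tens) : tens :=
  tclass [seq (k *: p.1, p.2) | p <- trepr t].

Lemma tadd_class s t : tadd (tclass s) (tclass t) = tclass (s ++ t).
Proof. by apply/tclassP; apply: tens_cat; apply: tclass_repr. Qed.

Lemma tens_rel_scale k s t : tens_rel s t ->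
  tens_rel [seq (k *: p.1, p.2) | p <- s] [seq (k *: p.1, p.2) | p <- t].
Proof.
elim => {s t} /=.
- by move=> s; apply: tens_refl.
- by move=> s t _ h; apply: tens_sym.
- by move=> s t u _ h _ h'; apply: tens_trans h h'.
- by move=> s s' t t' _ h _ h'; rewrite !map_cat; apply: tens_cat.
- by move=> s t; rewrite !map_cat; apply: tens_catC.
- by move=> n; rewrite scaler0; apply: tens_0.
- by move=> m m' n; rewrite scalerDr; apply: tens_Dl.
- by move=> m n n'; apply: tens_Dr.
- by move=> l m n; rewrite scalerA mulrC -scalerA; apply: tens_Z.
- by move=> l x m n; rewrite !scalerA; apply: tens_bal.
Qed.

Lemma tscale_class k s :
  tscale k (tclass s) = tclass [seq (k *: p.1, p.2) | p <- s].
Proof. by apply/tclassP; apply: tens_rel_scale; apply: tclass_repr. Qed.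

Lemma taddA : associative tadd.
Proof.
move=> s t u; rewrite -(treprK s) -(treprK t) -(treprK u).
by rewrite !tadd_class catA.
Qed.

Lemma taddC : commutative tadd.
Proof.
move=> s t; rewrite -(treprK s) -(treprK t) !tadd_class.
by apply/tclassP; apply: tens_catC.
Qed.

Lemma tadd0 : left_id tzero tadd.
Proof. by move=> s; rewrite -(treprK s) tadd_class. Qed.

Lemma tscaleDl t : {morph tscale^~ t : k l / k + l >-> tadd k l}.
Proof.
move=> k l; rewrite -(treprK t) !tscale_class tadd_class; apply/tclassP.
elim: (trepr t) => [|[m n] s IH] /=; first exact: tens_refl.
rewrite scalerDl.
apply: (tens_trans (t := [:: (k *: m, n); (l *: m, n)] ++
    ([seq (k *: p.1, p.2) | p <- s] ++ [seq (l *: p.1, p.2) | p <- s]))).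
  exact: (tens_cat (s := [:: _]) (tens_Dl _ _ _) IH).
apply: (tens_cat (s := [:: _]) (s' := [:: _]) (tens_refl _)) => /=.
rewrite -cat_cons -[X in tens_rel _ (_ ++ X)]cat1s catA.
apply: tens_cat (tens_refl _).
exact: (tens_catC [:: _]).
Qed.

Lemma tscale_zero t : tscale 0 t = tzero.
Proof.
rewrite -(treprK t) tscale_class; apply/tclassP.
elim: (trepr t) => [|[m n] s IH] /=; first exact: tens_refl.
rewrite scale0r.
exact: (tens_cat (s := [:: _]) (s' := [::]) (tens_0 _) IH).
Qed.

Lemma tscale1 : left_id 1 tscale.
Proof.
move=> t; rewrite -(treprK t) tscale_class; congr tclass.
by rewrite -[RHS]map_id; apply: eq_map => -[m n]; rewrite scale1r.
Qed.

Lemma taddN : left_inverse tzero (tscale (-1)) tadd.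
Proof.
by move=> t; rewrite -{2}(tscale1 t) -tscaleDl addNr tscale_zero.
Qed.

HB.instance Definition _ := GRing.isZmodule.Build tens taddA taddC tadd0 taddN.

Lemma tscaleA k l t : tscale k (tscale l t) = tscale (k * l) t.
Proof.
rewrite -(treprK t) !tscale_class -map_comp; congr tclass.
by apply: eq_map => p /=; rewrite scalerA.
Qed.

Lemma tscaleDr : right_distributive tscale +%R.
Proof.
move=> k s t; rewrite -(treprK s) -(treprK t) [_ + _]tadd_class !tscale_class.
by rewrite [RHS]tadd_class map_cat.
Qed.

HB.instance Definition _ := GRing.Zmodule_isLmodule.Build K tens
  tscaleA tscale1 tscaleDr tscaleDl.

Definition balanced (V : lmodType K) (b : M -> N -> V) : Prop :=
  [/\ forall n, linear (b^~ n), forall m, linear (b m)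
    & forall x m n, b (f x m) n = b m (g x n)].

(* The map induced on the quotient by a balanced bilinear map [b], computed on
   a chosen representative; independence of the choice is [tliftE], so the
   value is only meaningful when [b] is balanced bilinear. *)
Definition tlift (V : lmodType K) (b : M -> N -> V) (t : tens) : V :=
  \sum_(p <- trepr t) b p.1 p.2.

Lemma tlift_class (V : lmodType K) (b : M -> N -> V) s : balanced b ->
  tlift b (tclass s) = \sum_(p <- s) b p.1 p.2.
Proof.
case=> bl br bb.
have b0 n : b 0 n = 0.
  by have := bl n (-1) 0 0; rewrite scaler0 addr0 scaleN1r addNr.
have bD m m' n : b (m + m') n = b m n + b m' n.
  by have := bl n 1 m m'; rewrite !scale1r.
have bZ k m n : b (k *: m) n = k *: b m n.
  by have := bl n k m 0; rewrite !addr0 b0 addr0.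
have b0' m : b m 0 = 0.
  by have := br m (-1) 0 0; rewrite scaler0 addr0 scaleN1r addNr.
have bD' m n n' : b m (n + n') = b m n + b m n'.
  by have := br m 1 n n'; rewrite !scale1r.
have bZ' k m n : b m (k *: n) = k *: b m n.
  by have := br m k n 0; rewrite !addr0 b0' addr0.
suff H u v : tens_rel u v ->
    \sum_(p <- u) b p.1 p.2 = \sum_(p <- v) b p.1 p.2.
  exact: H (tclass_repr s).
move=> h; elim: h => {s u v} //=.
- by move=> s t u _ -> _ ->.
- by move=> s s' t t' _ h _ h'; rewrite !big_cat /= h h'.
- by move=> s t; rewrite !big_cat /= addrC.
- by move=> n; rewrite big_seq1 big_nil b0.
- by move=> m m' n; rewrite big_seq1 big_cons big_seq1 bD.
- by move=> m n n'; rewrite big_seq1 big_cons big_seq1 bD'.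
- by move=> k m n; rewrite !big_seq1 bZ bZ'.
- by move=> k x m n; rewrite !big_seq1 !bZ bb.
Qed.

Lemma tliftE (V : lmodType K) (b : M -> N -> V) m n : balanced b ->
  tlift b (tpair m n) = b m n.
Proof. by move=> hb; rewrite tlift_class // big_seq1. Qed.

Lemma tlift_linear (V : lmodType K) (b : M -> N -> V) : balanced b ->
  linear (tlift b).
Proof.
move=> hb k s t; have [bl _ _] := hb.
rewrite -(treprK s) -(treprK t) [_ *: tclass _]tscale_class.
rewrite [tclass _ + _]tadd_class !tlift_class // big_cat big_map /=.
congr (_ + _); rewrite scaler_sumr; apply: eq_bigr => p _.
have b0 n : b 0 n = 0.
  by have := bl n (-1) 0 0; rewrite scaler0 addr0 scaleN1r addNr.
by have := bl p.2 k p.1 0; rewrite !addr0 b0 addr0.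
Qed.

Lemma tens_sum (t : tens) : t = \sum_(p <- trepr t) tpair p.1 p.2.
Proof.
rewrite -{1}(treprK t); elim: (trepr t) => [|[m n] s IH]; first by rewrite big_nil.
by rewrite big_cons -IH [RHS]tadd_class.
Qed.

Lemma tpair_balanced : balanced tpair.
Proof.
split=> [n k m m'|m k n n'|x m n].
- rewrite [k *: tpair _ _]tscale_class [RHS]tadd_class; apply/tclassP; exact: tens_Dl.
- rewrite [k *: tpair _ _]tscale_class [RHS]tadd_class; apply/tclassP => /=.
  apply: tens_trans (tens_Dr _ _ _) _.
  apply: (tens_cat (s := [:: _]) (s' := [:: _])) (tens_refl _).
  by apply: tens_sym; apply: tens_Z.
- by apply/tclassP; have := tens_bal 1 x m n; rewrite !scale1r.
Qed.

End Tensor.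

Arguments tpair {K X M N f g} m n.
Notation "a ⊗ b" := (tpair a b) : ring_scope.

(* Meaningful when [u] and [v] descend to the quotients, see [tlift]. *)
Definition tmap (K : fieldType) (X Y : Type) (M N M' N' : lmodType K)
    (f : X -> M -> M) (g : X -> N -> N)
    (f' : Y -> M' -> M') (g' : Y -> N' -> N')
    (u : M -> M') (v : N -> N') : tens f g -> tens f' g' :=
  tlift (fun m n => u m ⊗ v n).
Arguments tmap {K X Y M N M' N' f g f' g'} u v t.

(* A threefold balanced tensor product, with relations
   f1 x m ⊗ n ⊗ p = m ⊗ g1 x n ⊗ p  and  m ⊗ f2 y n ⊗ p = m ⊗ n ⊗ g2 y p. *)
Definition tens3 (K : fieldType) (X Y : Type) (M N P : lmodType K)
    (f1 : X -> M -> M) (g1 : X -> N -> N)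
    (f2 : Y -> N -> N) (g2 : Y -> P -> P) : lmodType K :=
  @tens K Y (@tens K X M N f1 g1) P
    (fun y => @tmap K X X M N M N f1 g1 f1 g1 idfun (f2 y)) g2.

(* [m ⊗ t] for [t] in a tensor product of [N] and [P]. *)
Definition tcons (K : fieldType) (X Y : Type) (M N P : lmodType K)
    (f1 : X -> M -> M) (g1 : X -> N -> N)
    (f2 : Y -> N -> N) (g2 : Y -> P -> P)
    (m : M) (t : @tens K Y N P f2 g2) : tens3 f1 g1 f2 g2 :=
  tlift (fun n p => (m ⊗ n) ⊗ p) t.
Arguments tcons {K X Y M N P f1 g1 f2 g2} m t.

Definition left_action (K : fieldType) (B : nualgType K) (M : lmodType K)
    (l : B -> M -> M) : Prop :=
  [/\ forall x, linear (l x), forall m, linear (l^~ m)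
    & forall x y m, l (x ** y) m = l x (l y m)].

Definition right_action (K : fieldType) (B : nualgType K) (M : lmodType K)
    (r : B -> M -> M) : Prop :=
  [/\ forall x, linear (r x), forall m, linear (r^~ m)
    & forall x y m, r (x ** y) m = r y (r x m)].

(* A left [B]-module [M] is flat if tensoring over [B] with [M] preserves
   injectivity of homomorphisms of right [B]-modules; no unitality of the
   modules is required. Actions of [B] are written as maps [B -> M -> M] on
   either side. *)
Definition flat_left (K : fieldType) (B : nualgType K) (M : lmodType K)
    (l : B -> M -> M) : Prop :=
  forall (N N' : lmodType K) (r : B -> N -> N) (r' : B -> N' -> N'),
    right_action r -> right_action r' ->
  forall h : {linear N -> N'}, (forall x n, h (r x n) = r' x (h n)) ->
    injective h ->
    injective (tmap h idfun : tens r l -> tens r' l).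

Definition flat_right (K : fieldType) (B : nualgType K) (M : lmodType K)
    (r : B -> M -> M) : Prop :=
  forall (N N' : lmodType K) (l : B -> N -> N) (l' : B -> N' -> N'),
    left_action l -> left_action l' ->
  forall h : {linear N -> N'}, (forall x n, h (l x n) = l' x (h n)) ->
    injective h ->
    injective (tmap idfun h : tens r l -> tens r l').

Record quantum_graphs (K : fieldType) (A B C : nualgType K) := QuantumGraphs {
  qg_nondeg : nondegenerate A;
  iB : nu_hom B (mult A);
  iC : nu_hom C (mult A);
  iB_inj : injective iB;
  iC_inj : injective iC;
  iBC_comm : forall (x : B) (y : C), iB x ** iC y = iC y ** iB x;
  SB : anti_iso B C;
  SC : anti_iso C B;
  BA_full : forall a : A,
    exists s : seq (B * A), a = \sum_(p <- s) iB p.1 *> p.2;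
  AB_full : forall a : A,
    exists s : seq (A * B), a = \sum_(p <- s) p.1 <* iB p.2;
  CA_full : forall a : A,
    exists s : seq (C * A), a = \sum_(p <- s) iC p.1 *> p.2;
  AC_full : forall a : A,
    exists s : seq (A * C), a = \sum_(p <- s) p.1 <* iC p.2;
  qg_left_regular :
    (forall F : seq A, exists e : A, forall a, a \in F -> a ** e = a) \/
    (flat_left (fun x a => iB x *> a) /\ flat_left (fun y a => iC y *> a));
  qg_right_regular :
    (forall F : seq A, exists e : A, forall a, a \in F -> e ** a = a) \/
    (flat_right (fun x a => a <* iB x) /\ flat_right (fun y a => a <* iC y))
}.

Section QuantumGraph.
Variables (K : fieldType) (A B C : nualgType K) (G : quantum_graphs A B C).

Definition lB (x : B) (a : A) : A := iB G x *> a.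
Definition rB (x : B) (a : A) : A := a <* iB G x.
Definition lC (y : C) (a : A) : A := iC G y *> a.
Definition rC (y : C) (a : A) : A := a <* iC G y.
Definition lSB (x : B) (a : A) : A := lC (SB G x) a.
Definition rSC (y : C) (a : A) : A := rB (SC G y) a.

Definition tensB : lmodType K := tens rB lB.
Definition tensC : lmodType K := tens rC lC.
Definition tens_upB : lmodType K := tens lB rB.
Definition tens_upC : lmodType K := tens lC rC.
Definition tens_l : lmodType K := tens lB lSB.
Definition tens_r : lmodType K := tens rSC rC.

Definition tens_ll : lmodType K := tens3 lB lSB lB lSB.
Definition tens_rr : lmodType K := tens3 rSC rC rSC rC.
Definition tens_lr : lmodType K := tens3 lB lSB rSC rC.
Definition tens_rl : lmodType K := tens3 rSC rC lB lSB.

Definition tmap_l (u v : A -> A) (t : tens_l) : tens_l := tmap u v t.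
Definition tmap_r (u v : A -> A) (t : tens_r) : tens_r := tmap u v t.

(* x y a x' y' for x, x' in B and y, y' in C *)
Definition bimul (x : B) (y : C) (a : A) (x' : B) (y' : C) : A :=
  iB G x *> (iC G y *> ((a <* iB G x') <* iC G y')).

End QuantumGraph.

(* [DBr a c] stands for Delta_B(a)(1 ⊗ c) and [DBl a b] for
   Delta_B(a)(b ⊗ 1).  These notations presuppose that the elements are
   determined by their defining property; [DBr_uniq] and [DBl_uniq] say so. *)
Record left_comult (K : fieldType) (A B C : nualgType K)
    (G : quantum_graphs A B C) := LeftComult {
  DB : A -> tens_l G -> tens_l G;
  DB_linear : forall a, linear (DB a);
  DB_linear_arg : forall t, linear (DB^~ t);
  DB_mul : forall a b t, DB (a ** b) t = DB a (DB b t);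
  DBr : A -> A -> tens_l G;
  DBl : A -> A -> tens_l G;
  DBrE : forall a b c, DB a (b ⊗ c) = tmap_l (fun u => u ** b) idfun (DBr a c);
  DBlE : forall a b c, DB a (b ⊗ c) = tmap_l idfun (fun v => v ** c) (DBl a b);
  DBr_uniq : forall a c w,
    (forall b, DB a (b ⊗ c) = tmap_l (fun u => u ** b) idfun w) -> w = DBr a c;
  DBl_uniq : forall a b w,
    (forall c, DB a (b ⊗ c) = tmap_l idfun (fun v => v ** c) w) -> w = DBl a b;
  DB_bimul : forall (x : B) (y : C) a (x' : B) (y' : C) t,
    DB (bimul G x y a x' y') t =
      tmap_l (lC G y) (lB G x) (DB a (tmap_l (lC G y') (lB G x') t));
  DB_coassoc : forall a b c,
    tlift (fun d e => DBl d a ⊗ e) (DBr b c) =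
    tlift (fun d e => tcons d (DBr e c)) (DBl b a) :> tens_ll G
}.

(* [DC c] acts from the right: [DC c t] stands for t Delta_C(c), while
   [DCl c a] stands for (a ⊗ 1)Delta_C(c) and [DCr c b] for
   (1 ⊗ b)Delta_C(c). *)
Record right_comult (K : fieldType) (A B C : nualgType K)
    (G : quantum_graphs A B C) := RightComult {
  DC : A -> tens_r G -> tens_r G;
  DC_linear : forall a, linear (DC a);
  DC_linear_arg : forall t, linear (DC^~ t);
  DC_mul : forall a b t, DC (a ** b) t = DC b (DC a t);
  DCl : A -> A -> tens_r G;
  DCr : A -> A -> tens_r G;
  DClE : forall a b c, DC c (a ⊗ b) = tmap_r idfun (fun v => b ** v) (DCl c a);
  DCrE : forall a b c, DC c (a ⊗ b) = tmap_r (fun u => a ** u) idfun (DCr c b);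
  DCl_uniq : forall a c w,
    (forall b, DC c (a ⊗ b) = tmap_r idfun (fun v => b ** v) w) -> w = DCl c a;
  DCr_uniq : forall b c w,
    (forall a, DC c (a ⊗ b) = tmap_r (fun u => a ** u) idfun w) -> w = DCr c b;
  DC_bimul : forall (x : B) (y : C) a (x' : B) (y' : C) t,
    DC (bimul G x y a x' y') t =
      tmap_r (rC G y') (rB G x') (DC a (tmap_r (rC G y) (rB G x) t));
  DC_coassoc : forall a b c,
    tlift (fun d e => DCl d a ⊗ e) (DCr b c) =
    tlift (fun d e => tcons d (DCr e c)) (DCl b a) :> tens_rr G
}.

Record multiplier_bialgebroid (K : fieldType) (A B C : nualgType K) :=
  MultiplierBialgebroid {
  mb_graph :> quantum_graphs A B C;
  mb_left : left_comult mb_graph;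
  mb_right : right_comult mb_graph;
  mb_mixed_lr : forall a b c,
    tlift (fun d e => DBl mb_left d a ⊗ e) (DCr mb_right b c) =
    tlift (fun d e => tcons d (DCr mb_right e c)) (DBl mb_left b a)
      :> tens_lr mb_graph;
  mb_mixed_rl : forall a b c,
    tlift (fun d e => DCl mb_right d a ⊗ e) (DBr mb_left b c) =
    tlift (fun d e => tcons d (DBr mb_left e c)) (DCl mb_right b a)
      :> tens_rl mb_graph
}.

Section CanonicalMaps.
Variables (K : fieldType) (A B C : nualgType K).
Variable (H : multiplier_bialgebroid A B C).

Definition T_lambda : tens_upC H -> tens_l H :=
  tlift (fun a b => DBl (mb_left H) b a).
Definition T_rho : tensB H -> tens_l H :=
  tlift (fun a b => DBr (mb_left H) a b).
Definition lambda_T : tensC H -> tens_r H :=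
  tlift (fun a b => DCl (mb_right H) b a).
Definition rho_T : tens_upB H -> tens_r H :=
  tlift (fun a b => DCr (mb_right H) a b).

End CanonicalMaps.

Record regular_mha (K : fieldType) (A B C : nualgType K) := RegularMHA {
  rh_bialgebroid :> multiplier_bialgebroid A B C;
  T_lambda_bij : bijective (@T_lambda K A B C rh_bialgebroid);
  T_rho_bij : bijective (@T_rho K A B C rh_bialgebroid);
  lambda_T_bij : bijective (@lambda_T K A B C rh_bialgebroid);
  rho_T_bij : bijective (@rho_T K A B C rh_bialgebroid)
}.

Section HopfAlgebroid.
Variables (K : fieldType) (A B C : nualgType K) (H : regular_mha A B C).

Local Notation iB := (iB H).
Local Notation iC := (iC H).
Local Notation SB := (SB H).
Local Notation SC := (SC H).
Local Notation DBl := (DBl (mb_left H)).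
Local Notation DBr := (DBr (mb_left H)).
Local Notation DCl := (DCl (mb_right H)).
Local Notation DCr := (DCr (mb_right H)).

Definition flat_mha : Prop :=
  [/\ flat_left (lB H), flat_right (rB H), flat_left (lC H)
    & flat_right (rC H)].

Record left_counit := LeftCounit {
  eB :> {linear A -> B};
  eB_lmul : forall (x : B) a, eB (iB x *> a) = x ** eB a;
  eB_SB : forall (x : B) a, eB (iC (SB x) *> a) = eB a ** x;
  eB_DBr : forall a b,
    tlift (fun u v => iC (SB (eB u)) *> v) (DBr a b) = a ** b;
  eB_DBl : forall a b,
    tlift (fun u v => iB (eB v) *> u) (DBl b a) = b ** a;
  eB_mulB : forall a b, eB (a ** b) = eB (a <* iB (eB b));
  eB_mulC : forall a b, eB (a ** b) = eB (a <* iC (SB (eB b)))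
}.

Record right_counit := RightCounit {
  eC :> {linear A -> C};
  eC_rmul : forall (y : C) a, eC (a <* iC y) = eC a ** y;
  eC_SC : forall (y : C) a, eC (a <* iB (SC y)) = y ** eC a;
  eC_DCr : forall a b,
    tlift (fun u v => v <* iC (eC u)) (DCr a b) = b ** a;
  eC_DCl : forall a b,
    tlift (fun u v => u <* iB (SC (eC v))) (DCl b a) = a ** b;
  eC_mulC : forall a b, eC (a ** b) = eC (iC (eC a) *> b);
  eC_mulB : forall a b, eC (a ** b) = eC (iB (SC (eC a)) *> b)
}.

Variables (e : left_counit) (e' : right_counit).

Record antipode := Antipode {
  antipode_map :> anti_iso A A;
  antipode_bimul : forall (x : B) (y : C) a (x' : B) (y' : C),
    antipode_map (bimul H x y a x' y') =
      iB (SC y') *> (iC (SB x') *>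
        ((antipode_map a <* iB (SC y)) <* iC (SB x)));
  antipode_left : forall a b,
    tlift (fun u v => antipode_map u ** v) (DBr a b) =
      iB (SC (e' a)) *> b;
  antipode_right : forall a b,
    tlift (fun u v => u ** antipode_map v) (DCl b a) =
      a <* iC (SB (e b))
}.

Definition faithful (D : nualgType K) (w : D -> K) : Prop :=
  forall d : D, d <> 0 ->
    (exists c : D, w (d ** c) <> 0) /\ (exists c : D, w (c ** d) <> 0).

Record base_weight := BaseWeight {
  muB : {scalar B};
  muC : {scalar C};
  muB_faithful : faithful muB;
  muC_faithful : faithful muC;
  muB_SC : forall y : C, muB (SC y) = muC y;
  muC_SB : forall x : B, muC (SB x) = muB x;
  mu_counit : forall a : A, muB (e a) = muC (e' a)
}.

Variable mu : base_weight.

(* The four maps are uniquely determined by the functional, since the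
   functionals forming [mu] are faithful. *)
Record adapted := Adapted {
  ad_fun :> {scalar A};
  adBl : A -> B;
  adBr : A -> B;
  adCl : A -> C;
  adCr : A -> C;
  adBlE : forall (x : B) a, ad_fun (iB x *> a) = muB mu (x ** adBl a);
  adBrE : forall (x : B) a, ad_fun (a <* iB x) = muB mu (adBr a ** x);
  adClE : forall (y : C) a, ad_fun (iC y *> a) = muC mu (y ** adCl a);
  adCrE : forall (y : C) a, ad_fun (a <* iC y) = muC mu (adCr a ** y)
}.

Definition left_integral (phi : adapted) : Prop :=
  forall a b,
    tlift (fun u v => iB (anti_inv SB (adCl phi v)) *> u) (DBl b a) =
      iC (adCl phi b) *> a.

Definition right_integral (psi : adapted) : Prop :=
  forall a b,
    tlift (fun u v => iC (SB (adBl psi u)) *> v) (DBr a b) =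
      iB (adBl psi a) *> b.

Definition full_left_integral (phi : adapted) : Prop :=
  [/\ left_integral phi,
      (forall x : B, exists a, adBl phi a = x)
    & (forall x : B, exists a, adBr phi a = x)].

Definition full_right_integral (psi : adapted) : Prop :=
  [/\ right_integral psi,
      (forall y : C, exists a, adCl psi a = y)
    & (forall y : C, exists a, adCr psi a = y)].

Definition is_modular_aut (D : nualgType K) (w : D -> K) (s : nu_iso D D) :
    Prop :=
  forall a b : D, w (a ** b) = w (b ** s a).

Definition sigma_muB (x : B) : B := anti_inv SB (anti_inv SC x).
Definition sigma_muC (y : C) : C := SB (SC y).

(* Delta_B o c = (a ⊗ b) o Delta_B, including the requirement that a ⊗ b
   descends to the quotient. *)
Definition DB_intertwines (c a b : A -> A) : Prop :=
  exists2 F : {linear tens_l H -> tens_l H},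
    (forall u v : A, F (u ⊗ v) = a u ⊗ b v) &
    (forall p u v : A,
      DB (mb_left H) (c p) (a u ⊗ b v) = F (DB (mb_left H) p (u ⊗ v))).

Definition DC_intertwines (c a b : A -> A) : Prop :=
  exists2 F : {linear tens_r H -> tens_r H},
    (forall u v : A, F (u ⊗ v) = a u ⊗ b v) &
    (forall p u v : A,
      DC (mb_right H) (c p) (a u ⊗ b v) = F (DC (mb_right H) p (u ⊗ v))).

End HopfAlgebroid.

(* Main.v *)
(* Write [lam w a b], [lam' w a b], [rho w a b], [rho' w a b] for the slices
   (id ⊗ w)(Delta_B(a)(1 ⊗ b)), (id ⊗ w)((1 ⊗ a)Delta_C(b)),
   (w ⊗ id)((a ⊗ 1)Delta_C(b)), (w ⊗ id)(Delta_B(a)(b ⊗ 1)).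
   Mixed coassociativity says that left and right convolutions commute, and the
   counit then gives psi(a lam(b, c)) = phi(rho(a, b) c) and
   phi(c rho'(b, a)) = psi(lam'(c, b) a).  Together with strong invariance,
   S(lam phi) = lam' phi and S(rho psi) = rho' psi, these turn functionals
   phi(- a) into functionals psi(a' -) and conversely, while applying phi and
   psi to the two legs of Delta_B(b)t, with t written through T_rho or
   T_lambda, turns psi(- a) into phi(- a').  Hence both modular automorphisms
   exist.
   Uniqueness of the modular automorphisms yields
   lam phi a (sphi b) = lam' phi b a and rho psi b a = rho' psi a (spsi b),
   from which everything else is read off.  In particular sphi acts on the
   elements rho' psi a b, which span A, through S^2 and its first argument;
   as Delta_B(rho' psi a b) is again made of such slices, the intertwining
   relations follow without separating points of A ⊗ A by slice maps.
   The invariance property of psi shows that a multiplier n with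
   Delta_B(n a) = (1 ⊗ n)Delta_B(a) satisfies n psi_B(a) = psi_B(n a), so that
   it belongs to M(B). *)

From HB Require Import structures.
Require Import Defs.
From mathcomp Require Import all_boot all_order all_algebra.
From mathcomp Require Import boolp classical_sets reals.

Set Implicit Arguments.
Unset Strict Implicit.
Unset Printing Implicit Defensive.

Import GRing.Theory.
Local Open Scope ring_scope.
Local Open Scope classical_set_scope.

(** * Balanced tensor products *)

(** Two gaps lie between the hypotheses and the argument. Fullness concerns [phi] on the [B] side
    and [psi] on the [C] side, while the spanning by slices used later also needs [phi] onto [C] and
    [psi] onto [B]; this follows by comparing the module maps of elements [a], [a'] with psi(- a) =
    phi(- a'). As [A] may differ from [A ** A] and the counit need not be onto, such comparisons are
    made after multiplying by counit values. The second gap concerns the antipode, which is given by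
    module relations and two identities: that it reverses the comultiplications is itself deduced
    from invariance, on slices along an integral. Strong invariance handles slices along [phi] and
    [psi], whereas exchanging the two sides of a product requires slices along their composites with
    [S] or its inverse; [adS] and [adS'] supply these as adapted functionals. A modular automorphism
    then arises at the end of a chain phi(a -) = psi(- p) = phi(- a'). *)

Section LinearSums.
Variables (K : fieldType) (X : Type) (M N : lmodType K).
Variables (f : X -> M -> M) (g : X -> N -> N).
Implicit Types (V W : lmodType K) (t : tens f g).

Lemma lin0 V W (h : V -> W) : linear h -> h 0 = 0.
Proof. by move=> hl; have := hl (-1) 0 0; rewrite scaler0 addr0 scaleN1r addNr. Qed.

Lemma linD V W (h : V -> W) : linear h -> {morph h : u v / u + v}.
Proof. by move=> hl u v; have := hl 1 u v; rewrite !scale1r. Qed.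

Lemma linB V W (h : V -> W) : linear h -> {morph h : u v / u - v}.
Proof. by move=> hl u v; have := hl (-1) v u; rewrite !scaleN1r !(addrC (- _)). Qed.

Lemma lin_tlift V W (h : V -> W) b t :
  linear h -> h (tlift b t) = tlift (fun m n => h (b m n)) t.
Proof. by move=> hl; rewrite /tlift (big_morph h (linD hl) (lin0 hl)). Qed.

Lemma eq_tlift V (b b' : M -> N -> V) t :
  (forall m n, b m n = b' m n) -> tlift b t = tlift b' t.
Proof. by move=> e; apply: eq_bigr => p _. Qed.

End LinearSums.

Section Composition.
Variables (K : fieldType) (X : Type) (M N : lmodType K).
Variables (f : X -> M -> M) (g : X -> N -> N).
Implicit Types (V W : lmodType K) (t : tens f g).

Lemma tlift_swap V (X' : Type) (M' N' : lmodType K) f' g'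
    (b : M -> N -> M' -> N' -> V) t (s : @tens K X' M' N' f' g') :
  tlift (fun m n => tlift (b m n) s) t =
  tlift (fun m' n' => tlift (fun m n => b m n m' n') t) s.
Proof. exact: exchange_big. Qed.

Lemma tliftK t : tlift (fun m n => m ⊗ n) t = t.
Proof. by rewrite [RHS]tens_sum. Qed.

Lemma tlift_tlift V (b : M -> N -> V) (X' : Type) (M' N' : lmodType K) f' g'
    (c : M' -> N' -> tens f g) (s : @tens K X' M' N' f' g') :
  balanced f g b -> tlift b (tlift c s) = tlift (fun m n => tlift b (c m n)) s.
Proof. by move=> hb; apply: (lin_tlift (h := tlift b)); exact: tlift_linear. Qed.

Lemma tlift_tlift_pair V (b : M -> N -> V) (X' : Type) (M' N' : lmodType K) f' g' u v
    (s : @tens K X' M' N' f' g') :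
  balanced f g b ->
  tlift b (tlift (fun m n => u m n ⊗ v m n) s : tens f g) =
  tlift (fun m n => b (u m n) (v m n)) s.
Proof.
by move=> hb; rewrite tlift_tlift //; apply: eq_tlift => m n; rewrite tliftE.
Qed.

Lemma tlift_tmap V (b : M -> N -> V) (X' : Type) (M' N' : lmodType K) f' g' u v
    (s : @tens K X' M' N' f' g') :
  balanced f g b ->
  tlift b (tmap u v s : tens f g) = tlift (fun m n => b (u m) (v n)) s.
Proof. exact: tlift_tlift_pair. Qed.

Lemma tens_lin_ext V (h h' : tens f g -> V) :
  linear h -> linear h' -> (forall m n, h (m ⊗ n) = h' (m ⊗ n)) -> h =1 h'.
Proof.
move=> hl hl' e t; rewrite -(tliftK t) (lin_tlift _ _ hl) (lin_tlift _ _ hl').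
exact: eq_tlift.
Qed.

Lemma tpairPl k m m' n :
  (k *: m + m') ⊗ n = k *: (m ⊗ n) + m' ⊗ n :> tens f g.
Proof. by have [h _ _] := tpair_balanced f g; exact: h. Qed.

Lemma tpairPr k m n n' :
  m ⊗ (k *: n + n') = k *: (m ⊗ n) + m ⊗ n' :> tens f g.
Proof. by have [_ h _] := tpair_balanced f g; exact: h. Qed.

Lemma tpairB x m n : f x m ⊗ n = m ⊗ g x n :> tens f g.
Proof. by have [_ _ h] := tpair_balanced f g; exact: h. Qed.

Lemma tlift_pairl (X' : Type) (M' N' : lmodType K) f' g' b n
    (s : @tens K X' M' N' f' g') :
  tlift b s ⊗ n = tlift (fun m m' => b m m' ⊗ n) s :> tens f g.
Proof.
exact: (lin_tlift (h := fun z => z ⊗ n) b s (fun k m m' => tpairPl k m m' n)).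
Qed.

Lemma tlift_pairr (X' : Type) (M' N' : lmodType K) f' g' b m
    (s : @tens K X' M' N' f' g') :
  m ⊗ tlift b s = tlift (fun m' n' => m ⊗ b m' n') s :> tens f g.
Proof.
exact: (lin_tlift (h := fun z => m ⊗ z) b s (fun k n n' => tpairPr k m n n')).
Qed.

End Composition.

Section Nested.
Variables (K : fieldType) (X Y : Type) (M N P V : lmodType K).
Variables (f1 : X -> M -> M) (g1 : X -> N -> N).
Variables (f2 : Y -> N -> N) (g2 : Y -> P -> P).

Definition balanced3 (th : M -> N -> P -> V) : Prop :=
  [/\ forall p, balanced f1 g1 (fun m n => th m n p),
      forall m n, linear (th m n) &
      forall y m n p, th m (f2 y n) p = th m n (g2 y p)].

(** All coassociativity axioms, pure and mixed, equate an element nested to the left with one nested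
    to the right through [tcons]. Evaluating a trilinear map on both sides turns such an axiom into
    an identity of iterated [tlift]s, and threefold tensor products need not be handled
    afterwards. *)
Lemma tens3_apply (th : M -> N -> P -> V) (X' X'' : Type)
    (M' N' M'' N'' : lmodType K) f' g' f'' g''
    (T : M' -> tens f1 g1) (v : N' -> P) (U : N'' -> tens f2 g2) (u : M'' -> M)
    (s' : @tens K X' M' N' f' g') (s'' : @tens K X'' M'' N'' f'' g'') :
  balanced3 th ->
  tlift (fun d e => T d ⊗ v e) s' =
  tlift (fun d e => tcons (u d) (U e)) s'' :> tens3 f1 g1 f2 g2 ->
  tlift (fun d e => tlift (fun m n => th m n (v e)) (T d)) s' =
  tlift (fun d e => tlift (th (u d)) (U e)) s''.
Proof.
move=> [b12 lin3 b23] /(congr1 (tlift (fun t p => tlift (fun m n => th m n p) t))).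
have hb : balanced (fun y => @tmap K X X M N M N f1 g1 f1 g1 idfun (f2 y)) g2
    (fun t p => tlift (fun m n => th m n p) t).
  split=> [p|t k p p'|y t p].
  - exact: tlift_linear.
  - rewrite /tlift scaler_sumr -big_split; apply: eq_bigr => q _; exact: lin3.
  - by rewrite tlift_tmap //; apply: eq_tlift => m n; exact: b23.
rewrite !tlift_tlift // => h; move: h.
rewrite (eq_tlift (b' := fun d e => tlift (fun m n => th m n (v e)) (T d))); last first.
  by move=> d e; rewrite tliftE.
move=> ->; apply: eq_tlift => d e.
rewrite /tcons tlift_tlift //; apply: eq_tlift => n p.
by rewrite tliftE // tliftE.
Qed.

End Nested.

Definition mk_linear (K : fieldType) (V W : lmodType K) (f : V -> W)
    (fl : linear f) : {linear V -> W} :=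
  HB.pack f (GRing.isLinear.Build K V W *:%R f fl).

Definition mk_scalar (K : fieldType) (V : lmodType K) (f : V -> K)
    (fl : scalar f) : {scalar V} :=
  HB.pack f (GRing.isLinear.Build K V K *%R f fl).

(** * Multipliers and module structures *)

Lemma nmulPl (K : fieldType) (A : nualgType K) k (a b c : A) :
  (k *: a + b) ** c = k *: (a ** c) + b ** c.
Proof. by rewrite nmulDl nmulZl. Qed.

Lemma nmulPr (K : fieldType) (A : nualgType K) k (a b c : A) :
  c ** (k *: a + b) = k *: (c ** a) + c ** b.
Proof. by rewrite nmulDr nmulZr. Qed.

Lemma nmul0l (K : fieldType) (A : nualgType K) (a : A) : 0 ** a = 0.
Proof. by rewrite -(scale0r (0 : A)) nmulZl !scale0r. Qed.

Lemma nmul0r (K : fieldType) (A : nualgType K) (a : A) : a ** 0 = 0.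
Proof. by rewrite -(scale0r (0 : A)) nmulZr !scale0r. Qed.

Lemma nmulBl (K : fieldType) (A : nualgType K) (a b c : A) :
  (a - b) ** c = a ** c - b ** c.
Proof. by rewrite -!scaleN1r addrC nmulPl addrC. Qed.

Lemma nmulBr (K : fieldType) (A : nualgType K) (a b c : A) :
  c ** (a - b) = c ** a - c ** b.
Proof. by rewrite -!scaleN1r addrC nmulPr addrC. Qed.

Section Multipliers.
Variables (K : fieldType) (A : nualgType K).
Hypothesis ndA : Defs.nondegenerate A.
Implicit Types (a b c : A) (m n : mult A).

Lemma nondeg_l a b : (forall c, c ** a = c ** b) -> a = b.
Proof.
move=> e; apply/eqP; rewrite -subr_eq0; apply/eqP; apply: contrapT => h.
have [_ [c]] := ndA h; apply.
by rewrite -scaleN1r addrC nmulPr scaleN1r e addNr.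
Qed.

Lemma nondeg_r a b : (forall c, a ** c = b ** c) -> a = b.
Proof.
move=> e; apply/eqP; rewrite -subr_eq0; apply/eqP; apply: contrapT => h.
have [[c]] := ndA h; move=> hc _; apply: hc.
by rewrite -scaleN1r addrC nmulPl scaleN1r e addNr.
Qed.

Lemma mL_mul m a b : m *> (a ** b) = (m *> a) ** b.
Proof.
by apply: nondeg_l => c; rewrite mult_compat nmulA -mult_compat nmulA.
Qed.

Lemma mR_mul m a b : (a ** b) <* m = a ** (b <* m).
Proof.
by apply: nondeg_r => c; rewrite -mult_compat -!nmulA -mult_compat.
Qed.

Lemma mL_mR m n a : m *> (a <* n) = (m *> a) <* n.
Proof.
by apply: nondeg_r => b; rewrite -mL_mul -!mult_compat -mL_mul.
Qed.

Lemma mL_inj m n : (forall a, m *> a = n *> a) -> m = n.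
Proof.
move=> e; apply: mult_eq => // a.
by apply: nondeg_r => b; rewrite -!mult_compat e.
Qed.

End Multipliers.

Section Actions.
Variables (K : fieldType) (A B C : nualgType K) (H : quantum_graphs A B C).
Local Notation lB := (lB H).
Local Notation rB := (rB H).
Local Notation lC := (lC H).
Local Notation rC := (rC H).
Local Notation ndA := (qg_nondeg H).
Implicit Types (a b c : A) (x : B) (y : C).

Lemma lBl k x x' a : lB (k *: x + x') a = k *: lB x a + lB x' a.
Proof. by rewrite /Defs.lB linearP. Qed.
Lemma lBr k x a a' : lB x (k *: a + a') = k *: lB x a + lB x a'.
Proof. by rewrite /Defs.lB linearP. Qed.
Lemma rBl k x x' a : rB (k *: x + x') a = k *: rB x a + rB x' a.
Proof. by rewrite /Defs.rB linearP. Qed.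
Lemma rBr k x a a' : rB x (k *: a + a') = k *: rB x a + rB x a'.
Proof. by rewrite /Defs.rB linearP. Qed.
Lemma lCl k y y' a : lC (k *: y + y') a = k *: lC y a + lC y' a.
Proof. by rewrite /Defs.lC linearP. Qed.
Lemma lCr k y a a' : lC y (k *: a + a') = k *: lC y a + lC y a'.
Proof. by rewrite /Defs.lC linearP. Qed.
Lemma rCl k y y' a : rC (k *: y + y') a = k *: rC y a + rC y' a.
Proof. by rewrite /Defs.rC linearP. Qed.
Lemma rCr k y a a' : rC y (k *: a + a') = k *: rC y a + rC y a'.
Proof. by rewrite /Defs.rC linearP. Qed.

Lemma lB_mul x a b : lB x (a ** b) = lB x a ** b.
Proof. exact: mL_mul ndA _ _ _. Qed.
Lemma lC_mul y a b : lC y (a ** b) = lC y a ** b.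
Proof. exact: mL_mul ndA _ _ _. Qed.
Lemma rB_mul x a b : rB x (a ** b) = a ** rB x b.
Proof. exact: mR_mul ndA _ _ _. Qed.
Lemma rC_mul y a b : rC y (a ** b) = a ** rC y b.
Proof. exact: mR_mul ndA _ _ _. Qed.
Lemma rB_lB x a b : rB x a ** b = a ** lB x b.
Proof. by rewrite /Defs.rB -mult_compat. Qed.
Lemma rC_lC y a b : rC y a ** b = a ** lC y b.
Proof. by rewrite /Defs.rC -mult_compat. Qed.

Lemma lBM x x' a : lB (x ** x') a = lB x (lB x' a).
Proof. by rewrite /Defs.lB hom_mul. Qed.
Lemma lCM y y' a : lC (y ** y') a = lC y (lC y' a).
Proof. by rewrite /Defs.lC hom_mul. Qed.
Lemma rBM x x' a : rB (x ** x') a = rB x' (rB x a).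
Proof. by rewrite /Defs.rB hom_mul. Qed.
Lemma rCM y y' a : rC (y ** y') a = rC y' (rC y a).
Proof. by rewrite /Defs.rC hom_mul. Qed.

Lemma lB_lC x y a : lB x (lC y a) = lC y (lB x a).
Proof. exact: (congr1 (fun m => m *> a) (iBC_comm H x y)). Qed.
Lemma rB_rC x y a : rB x (rC y a) = rC y (rB x a).
Proof. exact: (congr1 (fun m => a <* m) (esym (iBC_comm H x y))). Qed.
Lemma lB_rB x x' a : lB x (rB x' a) = rB x' (lB x a).
Proof. exact: mL_mR ndA _ _ _. Qed.
Lemma lB_rC x y a : lB x (rC y a) = rC y (lB x a).
Proof. exact: mL_mR ndA _ _ _. Qed.
Lemma lC_rB x y a : lC y (rB x a) = rB x (lC y a).
Proof. exact: mL_mR ndA _ _ _. Qed.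
Lemma lC_rC y y' a : lC y (rC y' a) = rC y' (lC y a).
Proof. exact: mL_mR ndA _ _ _. Qed.

Lemma lB_inj x x' : (forall a, lB x a = lB x' a) -> x = x'.
Proof. by move=> e; apply: (@iB_inj _ _ _ _ H); apply: (mL_inj ndA). Qed.
Lemma lC_inj y y' : (forall a, lC y a = lC y' a) -> y = y'.
Proof. by move=> e; apply: (@iC_inj _ _ _ _ H); apply: (mL_inj ndA). Qed.

(** BA = A as an induction principle: a property stable under sums is checked on products only. *)
Lemma lB_span (P : A -> Prop) : P 0 ->
  (forall a b, P a -> P b -> P (a + b)) -> (forall x a, P (lB x a)) ->
  forall a, P a.
Proof.
move=> P0 PD Px a; have [s ->] := BA_full H a.
by elim/big_ind: _ => // p _; exact: Px.
Qed.
Lemma rB_span (P : A -> Prop) : P 0 ->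
  (forall a b, P a -> P b -> P (a + b)) -> (forall x a, P (rB x a)) ->
  forall a, P a.
Proof.
move=> P0 PD Px a; have [s ->] := AB_full H a.
by elim/big_ind: _ => // p _; exact: Px.
Qed.
Lemma lC_span (P : A -> Prop) : P 0 ->
  (forall a b, P a -> P b -> P (a + b)) -> (forall y a, P (lC y a)) ->
  forall a, P a.
Proof.
move=> P0 PD Px a; have [s ->] := CA_full H a.
by elim/big_ind: _ => // p _; exact: Px.
Qed.
Lemma rC_span (P : A -> Prop) : P 0 ->
  (forall a b, P a -> P b -> P (a + b)) -> (forall y a, P (rC y a)) ->
  forall a, P a.
Proof.
move=> P0 PD Px a; have [s ->] := AC_full H a.
by elim/big_ind: _ => // p _; exact: Px.
Qed.

(* All four module structures are used at once, so that an identity of linear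
   maps only has to be checked on the elements [bimul]. *)
Lemma bimul_ext (V : lmodType K) (h h' : A -> V) : linear h -> linear h' ->
  (forall x y a x' y', h (bimul H x y a x' y') = h' (bimul H x y a x' y')) ->
  h =1 h'.
Proof.
move=> hl hl' e.
have z : h 0 = h' 0 by rewrite !lin0.
have D a b : h a = h' a -> h b = h' b -> h (a + b) = h' (a + b).
  by rewrite !linD // => -> ->.
have D1 (F : A -> A) : linear F -> forall a b, h (F a) = h' (F a) ->
    h (F b) = h' (F b) -> h (F (a + b)) = h' (F (a + b)).
  by move=> hF a b; rewrite (linD hF); exact: D.
have z1 (F : A -> A) : linear F -> h (F 0) = h' (F 0).
  by move=> hF; rewrite (lin0 hF).
apply: lB_span => // x a.
have l1 : linear (lB x) by move=> k u v; rewrite lBr.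
move: a; apply: lC_span; [exact: z1|exact: D1|] => y a.
have l2 : linear (fun a => lB x (lC y a)) by move=> k u v; rewrite lCr lBr.
move: a; apply: rC_span; [exact: (z1 _ l2)|exact: (D1 _ l2)|] => y' a.
have l3 : linear (fun a => lB x (lC y (rC y' a))) by move=> k u v; rewrite rCr lCr lBr.
move: a; apply: rB_span; [exact: (z1 _ l3)|exact: (D1 _ l3)|] => x' a.
exact: e.
Qed.

Lemma bimul_lB x0 x y a x' y' :
  lB x0 (bimul H x y a x' y') = bimul H (x0 ** x) y a x' y'.
Proof. by rewrite /bimul -/(lB _ _) -lBM. Qed.
Lemma bimul_lC y0 x y a x' y' :
  lC y0 (bimul H x y a x' y') = bimul H x (y0 ** y) a x' y'.
Proof. by rewrite /bimul -/(lB _ _) -lB_lC -!/(lC _ _) -lCM. Qed.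
Lemma bimul_rB x0 x y a x' y' :
  rB x0 (bimul H x y a x' y') = bimul H x y a (x' ** x0) y'.
Proof.
rewrite /bimul -!/(lB _ _) -!/(lC _ _) -!/(rC _ _) -!/(rB _ _).
by rewrite -lB_rB -lC_rB rB_rC -rBM.
Qed.
Lemma bimul_rC y0 x y a x' y' :
  rC y0 (bimul H x y a x' y') = bimul H x y a x' (y' ** y0).
Proof.
rewrite /bimul -!/(lB _ _) -!/(lC _ _) -!/(rC _ _).
by rewrite -lB_rC -lC_rC -rCM.
Qed.

End Actions.

Definition linE := (@nmulPl, @nmulPr, @lBl, @lBr, @rBl, @rBr, @lCl, @lCr, @rCl,
  @rCr, @tpairPl, @tpairPr).

(** Injectivity of [i] makes the chosen preimages unique; linearity and compatibility of the two
    halves of the multiplier of [D] then follow from those of [m]. *)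
Lemma mult_of_subP (K : fieldType) (A D : nualgType K) (i : nu_hom D (mult A)) m :
  injective i -> (forall x, exists x', m ** i x = i x') ->
  (forall x, exists x', i x ** m = i x') -> mult_of_sub i m.
Proof.
move=> inj /choice[f fP] /choice[g gP].
have fl : linear f.
  by move=> k a b; apply: inj; rewrite -fP !linearP /= nmulPr !fP.
have gl : linear g.
  by move=> k a b; apply: inj; rewrite -gP !linearP /= nmulPl !gP.
have fg a b : a ** f b = g a ** b.
  by apply: inj; rewrite !hom_mul -fP -gP nmulA.
by exists (Mult fl gl fg) => x; split; rewrite ?fP ?gP.
Qed.

Section InverseIso.
Variables (K : fieldType) (A : nualgType K) (s : nu_iso A A).

Lemma iso_inv_mul a b : iso_inv s (a ** b) = iso_inv s a ** iso_inv s b.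
Proof. by apply: (can_inj (isoK s)); rewrite iso_mul !isoVK. Qed.

Definition inverse_iso : nu_iso A A :=
  @NuIso K A A (mk_linear (iso_inv_linear s)) iso_inv_mul s (isoVK s) (isoK s).

Lemma mult_extK m : mult_ext s (mult_ext inverse_iso m) = m.
Proof. by apply: mult_eq => a /=; rewrite !isoVK. Qed.

End InverseIso.

(** * Comultiplications *)

Section TensorMaps.
Variables (K : fieldType) (X : Type) (M N : lmodType K).
Variables (f : X -> M -> M) (g : X -> N -> N).

(** Sufficient for u ⊗ v to descend to the same quotient, and satisfied by multiplications and
    commuting module actions. Maps that twist the actions, such as those built from the antipode,
    are treated through [balanced] directly. *)
Definition tcompat (u : M -> M) (v : N -> N) : Prop :=
  [/\ linear u, linear v, forall x m, u (f x m) = f x (u m)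
    & forall x n, v (g x n) = g x (v n)].

Lemma tcompat_balanced u v : tcompat u v ->
  balanced f g (fun m n => u m ⊗ v n : tens f g).
Proof.
case=> lu lv cu cv; split=> [n k m m'|m k n n'|x m n].
- by rewrite lu tpairPl.
- by rewrite lv tpairPr.
- by rewrite cu cv tpairB.
Qed.

Lemma tmapE u v m n : tcompat u v ->
  tmap u v (m ⊗ n : tens f g) = u m ⊗ v n :> tens f g.
Proof. by move=> h; rewrite /tmap tliftE //; exact: tcompat_balanced. Qed.

Lemma tmap_linear u v : tcompat u v -> linear (tmap u v : tens f g -> tens f g).
Proof. by move=> h; apply: tlift_linear; exact: tcompat_balanced. Qed.

Lemma tmap_tlift u v (X' : Type) (M' N' : lmodType K) f' g' b
    (s : @tens K X' M' N' f' g') : tcompat u v ->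
  tmap u v (tlift b s : tens f g) =
  tlift (fun m n => tmap u v (b m n)) s :> tens f g.
Proof. by move=> h; apply: lin_tlift; exact: tmap_linear. Qed.

Lemma tmap_comp u v u' v' (t : tens f g) : tcompat u v ->
  tmap u v (tmap u' v' t : tens f g) =
  tmap (u \o u') (v \o v') t :> tens f g.
Proof. by move=> h; rewrite /tmap tlift_tmap //; exact: tcompat_balanced. Qed.

Lemma eq_tmap u v u' v' (t : tens f g) : u =1 u' -> v =1 v' ->
  tmap u v t = tmap u' v' t :> tens f g.
Proof. by move=> hu hv; apply: eq_tlift => m n; rewrite hu hv. Qed.

End TensorMaps.

Ltac tcomp := solve [split; [move=> ? ? ?|move=> ? ? ?|move=> ? ?|move=> ? ?];
  rewrite /= ?linE // ?/Defs.lSB ?/Defs.rSC;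
  by rewrite ?(lB_mul, lC_mul, rB_mul, rC_mul, lB_lC, rB_rC, lB_rB, lB_rC,
      lC_rB, lC_rC)].

Section LeftComult.
Variables (K : fieldType) (A B C : nualgType K) (H : quantum_graphs A B C).
Variable D : left_comult H.
Local Notation lB := (lB H).
Local Notation rB := (rB H).
Local Notation lC := (lC H).
Local Notation rC := (rC H).
Local Notation sB := (SB H).
Local Notation sC := (SC H).
Local Notation DB := (DB D).
Local Notation DBr := (DBr D).
Local Notation DBl := (DBl D).
Local Notation tlm := (@tmap K B B A A A A lB (lSB H) lB (lSB H)).
Local Notation r1 b := (tlm (fun u => u ** b) idfun).
Local Notation r2 b := (tlm idfun (fun v => v ** b)).
Implicit Types (a b c d : A) (x : B) (y : C) (t w : tens_l H).

Lemma r1_ok b : tcompat lB (lSB H) (fun u => u ** b) idfun.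
Proof. tcomp. Qed.
Lemma r2_ok b : tcompat lB (lSB H) idfun (fun v => v ** b).
Proof. tcomp. Qed.
Lemma tlB_ok x : tcompat lB (lSB H) idfun (lB x).
Proof. tcomp. Qed.
Lemma tlC_ok y : tcompat lB (lSB H) (lC y) idfun.
Proof. tcomp. Qed.
Lemma tlBlC_ok x y : tcompat lB (lSB H) (lC y) (lB x).
Proof. tcomp. Qed.

Lemma DBpairr a b c : DB a (b ⊗ c) = r1 b (DBr a c).
Proof. exact: DBrE. Qed.

Lemma DBpairl a b c : DB a (b ⊗ c) = r2 c (DBl a b).
Proof. exact: DBlE. Qed.

(* Cancellation of right factors is exactly what the uniqueness clauses for
   [DBl] and [DBr] contain, since the zero map is [DB 0]. *)
Lemma cancel_r2 w w' : (forall c, r2 c w = r2 c w') -> w = w'.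
Proof.
move=> e; have h v : (forall c, r2 c v = 0) -> v = DBl 0 0.
  move=> hv; apply: DBl_uniq => c; rewrite -[RHS]/(r2 c v) hv.
  exact: (lin0 (DB_linear_arg D (0 ⊗ c))).
have -> : w = (w - w') + w' by rewrite subrK.
have /h -> : forall c, r2 c (w - w') = 0.
  by move=> c; rewrite (linB (tmap_linear (r2_ok c))) e subrr.
rewrite -(h 0) ?add0r // => c.
exact: (lin0 (tmap_linear (r2_ok c))).
Qed.

Lemma cancel_r1 w w' : (forall c, r1 c w = r1 c w') -> w = w'.
Proof.
move=> e; have h v : (forall c, r1 c v = 0) -> v = DBr 0 0.
  move=> hv; apply: DBr_uniq => c; rewrite -[RHS]/(r1 c v) hv.
  exact: (lin0 (DB_linear_arg D (c ⊗ 0))).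
have -> : w = (w - w') + w' by rewrite subrK.
have /h -> : forall c, r1 c (w - w') = 0.
  by move=> c; rewrite (linB (tmap_linear (r1_ok c))) e subrr.
rewrite -(h 0) ?add0r // => c.
exact: (lin0 (tmap_linear (r1_ok c))).
Qed.

Lemma DBlr a b c : r1 b (DBr a c) = r2 c (DBl a b).
Proof. by rewrite -DBpairr DBpairl. Qed.

Lemma DB_r2 a c t : DB a (r2 c t) = r2 c (DB a t).
Proof.
have l1 := DB_linear D a; have l2 := tmap_linear (r2_ok c).
apply: (tens_lin_ext (h := fun t => DB a (r2 c t)) (h' := fun t => r2 c (DB a t))).
- by move=> k u v; rewrite l2 l1.
- by move=> k u v; rewrite l1 l2.
- move=> m n; rewrite (tmapE _ _ (r2_ok c)) !DBpairl.
  rewrite (tmap_comp _ _ _ (r2_ok c)); apply: eq_tmap => // v /=.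
  by rewrite nmulA.
Qed.

Lemma DB_r1 a c t : DB a (r1 c t) = r1 c (DB a t).
Proof.
have l1 := DB_linear D a; have l2 := tmap_linear (r1_ok c).
apply: (tens_lin_ext (h := fun t => DB a (r1 c t)) (h' := fun t => r1 c (DB a t))).
- by move=> k u v; rewrite l2 l1.
- by move=> k u v; rewrite l1 l2.
- move=> m n; rewrite (tmapE _ _ (r1_ok c)) !DBpairr.
  rewrite (tmap_comp _ _ _ (r1_ok c)); apply: eq_tmap => // v /=.
  by rewrite nmulA.
Qed.

Lemma DB_DBl a b c : DB a (DBl b c) = DBl (a ** b) c.
Proof. by apply: cancel_r2 => d; rewrite -DB_r2 -!DBpairl DB_mul. Qed.

Lemma DB_DBr a b c : DB a (DBr b c) = DBr (a ** b) c.
Proof. by apply: cancel_r1 => d; rewrite -DB_r1 -!DBpairr DB_mul. Qed.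

Lemma DBrPl k a a' c : DBr (k *: a + a') c = k *: DBr a c + DBr a' c.
Proof.
apply: cancel_r1 => b; rewrite (tmap_linear (r1_ok b)) -!DBpairr.
exact: DB_linear_arg.
Qed.

Lemma DBrPr k a c c' : DBr a (k *: c + c') = k *: DBr a c + DBr a c'.
Proof.
apply: cancel_r1 => b; rewrite (tmap_linear (r1_ok b)) -!DBpairr tpairPr.
exact: DB_linear.
Qed.

Lemma DBlPl k a a' c : DBl (k *: a + a') c = k *: DBl a c + DBl a' c.
Proof.
apply: cancel_r2 => b; rewrite (tmap_linear (r2_ok b)) -!DBpairl.
exact: DB_linear_arg.
Qed.

Lemma DBlPr k a c c' : DBl a (k *: c + c') = k *: DBl a c + DBl a c'.
Proof.
apply: cancel_r2 => b; rewrite (tmap_linear (r2_ok b)) -!DBpairl tpairPl.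
exact: DB_linear.
Qed.

(** The axiom [DB_bimul] moves four factors at once, and none can be set to 1 in the possibly
    non-unital [B] and [C]. On the spanning elements [bimul] a single extra factor merges with the
    one already present. *)
Lemma DB_lB x a t : DB (lB x a) t = tlm idfun (lB x) (DB a t).
Proof.
have l := tmap_linear (tlB_ok x).
apply: (bimul_ext (H := H) (h := fun a => DB (lB x a) t)
  (h' := fun a => tlm idfun (lB x) (DB a t))) => [k u v|k u v|x1 y1 b x2 y2].
- by rewrite lBr DB_linear_arg.
- by rewrite DB_linear_arg l.
- rewrite bimul_lB !DB_bimul /tmap_l (tmap_comp _ _ _ (tlB_ok x)).
  by apply: eq_tmap => // u /=; rewrite lBM.
Qed.

Lemma DB_lC y a t : DB (lC y a) t = tlm (lC y) idfun (DB a t).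
Proof.
have l := tmap_linear (tlC_ok y).
apply: (bimul_ext (H := H) (h := fun a => DB (lC y a) t)
  (h' := fun a => tlm (lC y) idfun (DB a t))) => [k u v|k u v|x1 y1 b x2 y2].
- by rewrite lCr DB_linear_arg.
- by rewrite DB_linear_arg l.
- rewrite bimul_lC !DB_bimul /tmap_l (tmap_comp _ _ _ (tlC_ok y)).
  by apply: eq_tmap => // u /=; rewrite lCM.
Qed.

Lemma DB_rB x a t : DB (rB x a) t = DB a (tlm idfun (lB x) t).
Proof.
have l := tmap_linear (tlB_ok x).
apply: (bimul_ext (H := H) (h := fun a => DB (rB x a) t)
  (h' := fun a => DB a (tlm idfun (lB x) t))) => [k u v|k u v|x1 y1 b x2 y2].
- by rewrite rBr DB_linear_arg.
- exact: DB_linear_arg.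
- rewrite bimul_rB !DB_bimul /tmap_l; congr (tmap _ _ (DB _ _)).
  rewrite (tmap_comp _ _ _ (tlBlC_ok _ _)).
  by apply: eq_tmap => // u /=; rewrite lBM.
Qed.

Lemma DB_rC y a t : DB (rC y a) t = DB a (tlm (lC y) idfun t).
Proof.
have l := tmap_linear (tlC_ok y).
apply: (bimul_ext (H := H) (h := fun a => DB (rC y a) t)
  (h' := fun a => DB a (tlm (lC y) idfun t))) => [k u v|k u v|x1 y1 b x2 y2].
- by rewrite rCr DB_linear_arg.
- exact: DB_linear_arg.
- rewrite bimul_rC !DB_bimul /tmap_l; congr (tmap _ _ (DB _ _)).
  rewrite (tmap_comp _ _ _ (tlBlC_ok _ _)).
  by apply: eq_tmap => // u /=; rewrite lCM.
Qed.

Lemma tlm_r1 u v b t : tcompat lB (lSB H) u v -> (forall c, u (c ** b) = u c ** b) ->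
  tlm u v (r1 b t) = r1 b (tlm u v t).
Proof.
move=> h e; rewrite (tmap_comp _ _ _ h) (tmap_comp _ _ _ (r1_ok b)).
exact: eq_tmap.
Qed.

Lemma tlm_r2 u v b t : tcompat lB (lSB H) u v -> (forall c, v (c ** b) = v c ** b) ->
  tlm u v (r2 b t) = r2 b (tlm u v t).
Proof.
move=> h e; rewrite (tmap_comp _ _ _ h) (tmap_comp _ _ _ (r2_ok b)).
exact: eq_tmap.
Qed.

Lemma DBl_lB x a b : DBl (lB x a) b = tlm idfun (lB x) (DBl a b).
Proof.
apply: cancel_r2 => c; rewrite -DBpairl DB_lB DBpairl (tlm_r2 _ (tlB_ok x)) //.
by move=> d; rewrite lB_mul.
Qed.

Lemma DBr_lC y a c : DBr (lC y a) c = tlm (lC y) idfun (DBr a c).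
Proof.
apply: cancel_r1 => b; rewrite -DBpairr DB_lC DBpairr (tlm_r1 _ (tlC_ok y)) //.
by move=> d; rewrite lC_mul.
Qed.

Lemma DBr_rB x a c : DBr (rB x a) c = DBr a (lB x c).
Proof.
apply: cancel_r1 => b; rewrite -DBpairr DB_rB (tmapE _ _ (tlB_ok x)).
by rewrite DBpairr.
Qed.

Lemma DBl_rC y a b : DBl (rC y a) b = DBl a (lC y b).
Proof.
apply: cancel_r2 => c; rewrite -DBpairl DB_rC (tmapE _ _ (tlC_ok y)).
by rewrite DBpairl.
Qed.

Lemma DBr_rC y a c : DBr (rC y a) c = tlm (rC y) idfun (DBr a c).
Proof.
apply: cancel_r1 => b; rewrite -DBpairr DB_rC (tmapE _ _ (tlC_ok y)) DBpairr.
rewrite (tmap_comp _ _ _ (r1_ok b)).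
by apply: eq_tmap => // u /=; rewrite rC_lC.
Qed.

Lemma DBl_rB x a b : DBl (rB x a) b = tlm idfun (rB x) (DBl a b).
Proof.
apply: cancel_r2 => c; rewrite -DBpairl DB_rB (tmapE _ _ (tlB_ok x)) DBpairl.
rewrite (tmap_comp _ _ _ (r2_ok c)).
by apply: eq_tmap => // u /=; rewrite rB_lB.
Qed.

Lemma DBr_lSB x a c : DBr a (lC (sB x) c) = tlm (rB x) idfun (DBr a c).
Proof.
apply: cancel_r1 => b; rewrite -DBpairr -[lC _ c]/(lSB H x c) -tpairB DBpairr.
rewrite (tmap_comp _ _ _ (r1_ok b)).
by apply: eq_tmap => // u /=; rewrite rB_lB.
Qed.

End LeftComult.

Section RightComult.
Variables (K : fieldType) (A B C : nualgType K) (H : quantum_graphs A B C).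
Variable D : right_comult H.
Local Notation lB := (lB H).
Local Notation rB := (rB H).
Local Notation lC := (lC H).
Local Notation rC := (rC H).
Local Notation sB := (SB H).
Local Notation sC := (SC H).
Local Notation DC := (DC D).
Local Notation DCr := (DCr D).
Local Notation DCl := (DCl D).
Local Notation trm := (@tmap K C C A A A A (rSC H) rC (rSC H) rC).
Local Notation l1 a := (trm (fun u => a ** u) idfun).
Local Notation l2 b := (trm idfun (fun v => b ** v)).
Implicit Types (a b c d : A) (x : B) (y : C) (t w : tens_r H).

Lemma l1_ok b : tcompat (rSC H) rC (fun u => b ** u) idfun.
Proof. tcomp. Qed.
Lemma l2_ok b : tcompat (rSC H) rC idfun (fun v => b ** v).
Proof. tcomp. Qed.
Lemma rrB2_ok x : tcompat (rSC H) rC idfun (rB x).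
Proof. tcomp. Qed.
Lemma rrC1_ok y : tcompat (rSC H) rC (rC y) idfun.
Proof. tcomp. Qed.
Lemma rrCrB_ok x y : tcompat (rSC H) rC (rC y) (rB x).
Proof. tcomp. Qed.

Lemma DCpairl a b c : DC c (a ⊗ b) = l2 b (DCl c a).
Proof. exact: DClE. Qed.

Lemma DCpairr a b c : DC c (a ⊗ b) = l1 a (DCr c b).
Proof. exact: DCrE. Qed.

Lemma cancel_l2 w w' : (forall b, l2 b w = l2 b w') -> w = w'.
Proof.
move=> e; have h v : (forall c, l2 c v = 0) -> v = DCl 0 0.
  move=> hv; apply: DCl_uniq => c; rewrite -[RHS]/(l2 c v) hv.
  exact: (lin0 (DC_linear_arg D (0 ⊗ c))).
have -> : w = (w - w') + w' by rewrite subrK.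
have /h -> : forall c, l2 c (w - w') = 0.
  by move=> c; rewrite (linB (tmap_linear (l2_ok c))) e subrr.
rewrite -(h 0) ?add0r // => c.
exact: (lin0 (tmap_linear (l2_ok c))).
Qed.

Lemma cancel_l1 w w' : (forall b, l1 b w = l1 b w') -> w = w'.
Proof.
move=> e; have h v : (forall c, l1 c v = 0) -> v = DCr 0 0.
  move=> hv; apply: DCr_uniq => c; rewrite -[RHS]/(l1 c v) hv.
  exact: (lin0 (DC_linear_arg D (c ⊗ 0))).
have -> : w = (w - w') + w' by rewrite subrK.
have /h -> : forall c, l1 c (w - w') = 0.
  by move=> c; rewrite (linB (tmap_linear (l1_ok c))) e subrr.
rewrite -(h 0) ?add0r // => c.
exact: (lin0 (tmap_linear (l1_ok c))).
Qed.

Lemma DClr a b c : l2 b (DCl c a) = l1 a (DCr c b).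
Proof. by rewrite -DCpairl DCpairr. Qed.

Lemma DClPl k c c' a : DCl (k *: c + c') a = k *: DCl c a + DCl c' a.
Proof.
apply: cancel_l2 => b; rewrite (tmap_linear (l2_ok b)) -!DCpairl.
exact: DC_linear_arg.
Qed.

Lemma DCrPl k c c' a : DCr (k *: c + c') a = k *: DCr c a + DCr c' a.
Proof.
apply: cancel_l1 => b; rewrite (tmap_linear (l1_ok b)) -!DCpairr.
exact: DC_linear_arg.
Qed.

Lemma DC_lB x a t : DC (lB x a) t = DC a (trm idfun (rB x) t).
Proof.
have l := tmap_linear (rrB2_ok x).
apply: (bimul_ext (H := H) (h := fun a => DC (lB x a) t)
  (h' := fun a => DC a (trm idfun (rB x) t))) => [k u v|k u v|x1 y1 b x2 y2].
- by rewrite lBr DC_linear_arg.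
- exact: DC_linear_arg.
- rewrite bimul_lB !DC_bimul /tmap_r; congr (tmap _ _ (DC _ _)).
  rewrite (tmap_comp _ _ _ (rrCrB_ok _ _)).
  by apply: eq_tmap => // u /=; rewrite rBM.
Qed.

Lemma DC_lC y a t : DC (lC y a) t = DC a (trm (rC y) idfun t).
Proof.
have l := tmap_linear (rrC1_ok y).
apply: (bimul_ext (H := H) (h := fun a => DC (lC y a) t)
  (h' := fun a => DC a (trm (rC y) idfun t))) => [k u v|k u v|x1 y1 b x2 y2].
- by rewrite lCr DC_linear_arg.
- exact: DC_linear_arg.
- rewrite bimul_lC !DC_bimul /tmap_r; congr (tmap _ _ (DC _ _)).
  rewrite (tmap_comp _ _ _ (rrCrB_ok _ _)).
  by apply: eq_tmap => // u /=; rewrite rCM.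
Qed.

Lemma DC_rB x a t : DC (rB x a) t = trm idfun (rB x) (DC a t).
Proof.
have l := tmap_linear (rrB2_ok x).
apply: (bimul_ext (H := H) (h := fun a => DC (rB x a) t)
  (h' := fun a => trm idfun (rB x) (DC a t))) => [k u v|k u v|x1 y1 b x2 y2].
- by rewrite rBr DC_linear_arg.
- by rewrite DC_linear_arg l.
- rewrite bimul_rB !DC_bimul /tmap_r (tmap_comp _ _ _ (rrB2_ok x)).
  by apply: eq_tmap => // u /=; rewrite rBM.
Qed.

Lemma DC_rC y a t : DC (rC y a) t = trm (rC y) idfun (DC a t).
Proof.
have l := tmap_linear (rrC1_ok y).
apply: (bimul_ext (H := H) (h := fun a => DC (rC y a) t)
  (h' := fun a => trm (rC y) idfun (DC a t))) => [k u v|k u v|x1 y1 b x2 y2].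
- by rewrite rCr DC_linear_arg.
- by rewrite DC_linear_arg l.
- rewrite bimul_rC !DC_bimul /tmap_r (tmap_comp _ _ _ (rrC1_ok y)).
  by apply: eq_tmap => // u /=; rewrite rCM.
Qed.

Lemma trm_l1 u v b t : tcompat (rSC H) rC u v -> (forall c, u (b ** c) = b ** u c) ->
  trm u v (l1 b t) = l1 b (trm u v t).
Proof.
move=> h e; rewrite (tmap_comp _ _ _ h) (tmap_comp _ _ _ (l1_ok b)).
exact: eq_tmap.
Qed.

Lemma trm_l2 u v b t : tcompat (rSC H) rC u v -> (forall c, v (b ** c) = b ** v c) ->
  trm u v (l2 b t) = l2 b (trm u v t).
Proof.
move=> h e; rewrite (tmap_comp _ _ _ h) (tmap_comp _ _ _ (l2_ok b)).
exact: eq_tmap.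
Qed.

Lemma DCl_lB x a b : DCl (lB x a) b = trm idfun (lB x) (DCl a b).
Proof.
apply: cancel_l2 => d; rewrite -DCpairl DC_lB (tmapE _ _ (rrB2_ok x)) DCpairl.
rewrite (tmap_comp _ _ _ (l2_ok d)).
by apply: eq_tmap => // u /=; rewrite rB_lB.
Qed.

Lemma DCr_lC y a b : DCr (lC y a) b = trm (lC y) idfun (DCr a b).
Proof.
apply: cancel_l1 => d; rewrite -DCpairr DC_lC (tmapE _ _ (rrC1_ok y)) DCpairr.
rewrite (tmap_comp _ _ _ (l1_ok d)).
by apply: eq_tmap => // u /=; rewrite rC_lC.
Qed.

Lemma DCl_rB x a b : DCl (rB x a) b = trm idfun (rB x) (DCl a b).
Proof.
apply: cancel_l2 => d; rewrite -DCpairl DC_rB DCpairl (trm_l2 _ (rrB2_ok x)) //.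
by move=> c; rewrite rB_mul.
Qed.

Lemma DCr_rC y a b : DCr (rC y a) b = trm (rC y) idfun (DCr a b).
Proof.
apply: cancel_l1 => d; rewrite -DCpairr DC_rC DCpairr (trm_l1 _ (rrC1_ok y)) //.
by move=> c; rewrite rC_mul.
Qed.

Lemma DCr_rC_arg y a b : DCr a (rC y b) = trm (lB (sC y)) idfun (DCr a b).
Proof.
apply: cancel_l1 => d; rewrite -DCpairr -tpairB DCpairr.
rewrite (tmap_comp _ _ _ (l1_ok d)).
by apply: eq_tmap => // u /=; rewrite /rSC rB_lB.
Qed.

End RightComult.

(** * Slices, integrals and the antipode *)

Section Hopf.
Variables (K : fieldType) (A B C : nualgType K) (H : regular_mha A B C).
Variables (eB : left_counit H) (eC : right_counit H) (S : antipode eB eC).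
Variable mu : base_weight eB eC.
Local Notation lB := (lB H).
Local Notation rB := (rB H).
Local Notation lC := (lC H).
Local Notation rC := (rC H).
Local Notation sB := (SB H).
Local Notation sC := (SC H).
Local Notation sB' := (anti_inv (SB H)).
Local Notation sC' := (anti_inv (SC H)).
Local Notation S' := (anti_inv S).
Local Notation DB := (DB (mb_left H)).
Local Notation DBl := (DBl (mb_left H)).
Local Notation DBr := (DBr (mb_left H)).
Local Notation DC := (DC (mb_right H)).
Local Notation DCl := (DCl (mb_right H)).
Local Notation DCr := (DCr (mb_right H)).
Local Notation tlm := (@tmap K B B A A A A lB (lSB H) lB (lSB H)).
Local Notation trm := (@tmap K C C A A A A (rSC H) rC (rSC H) rC).
Local Notation r1 b := (tlm (fun u => u ** b) idfun).
Local Notation r2 b := (tlm idfun (fun v => v ** b)).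
Local Notation l1 a := (trm (fun u => a ** u) idfun).
Local Notation l2 b := (trm idfun (fun v => b ** v)).
Local Notation muB := (muB mu).
Local Notation muC := (muC mu).
Implicit Types (a b c d : A) (x : B) (y : C) (w : adapted mu).

(** * Base weights and the module maps of adapted functionals *)

Lemma muB_inj_r z z' : (forall x, muB (x ** z) = muB (x ** z')) -> z = z'.
Proof.
move=> e; apply/eqP; rewrite -subr_eq0; apply/eqP; apply: contrapT => h.
have [_ [x]] := muB_faithful mu h; apply.
by rewrite nmulBr linearB /= e subrr.
Qed.

Lemma muB_inj_l z z' : (forall x, muB (z ** x) = muB (z' ** x)) -> z = z'.
Proof.
move=> e; apply/eqP; rewrite -subr_eq0; apply/eqP; apply: contrapT => h.
have [[x hx] _] := muB_faithful mu h; apply: hx.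
by rewrite nmulBl linearB /= e subrr.
Qed.

Lemma muC_inj_r z z' : (forall y, muC (y ** z) = muC (y ** z')) -> z = z'.
Proof.
move=> e; apply/eqP; rewrite -subr_eq0; apply/eqP; apply: contrapT => h.
have [_ [x]] := muC_faithful mu h; apply.
by rewrite nmulBr linearB /= e subrr.
Qed.

Lemma muC_inj_l z z' : (forall y, muC (z ** y) = muC (z' ** y)) -> z = z'.
Proof.
move=> e; apply/eqP; rewrite -subr_eq0; apply/eqP; apply: contrapT => h.
have [[x hx] _] := muC_faithful mu h; apply: hx.
by rewrite nmulBl linearB /= e subrr.
Qed.

Lemma muB_sB' y : muB (sB' y) = muC y.
Proof. by rewrite -(muC_SB mu) antiVK. Qed.

Lemma muC_sC' x : muC (sC' x) = muB x.
Proof. by rewrite -(muB_SC mu) antiVK. Qed.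

Lemma ad_lB w x a : w (lB x a) = muB (x ** adBl w a).
Proof. exact: adBlE. Qed.
Lemma ad_rB w x a : w (rB x a) = muB (adBr w a ** x).
Proof. exact: adBrE. Qed.
Lemma ad_lC w y a : w (lC y a) = muC (y ** adCl w a).
Proof. exact: adClE. Qed.
Lemma ad_rC w y a : w (rC y a) = muC (adCr w a ** y).
Proof. exact: adCrE. Qed.

(** The record [adapted] lists bare maps; their linearity, and below their module property, is
    forced by faithfulness of the base weight. *)
Lemma adBlP w k a b : adBl w (k *: a + b) = k *: adBl w a + adBl w b.
Proof. by apply: muB_inj_r => x; rewrite nmulPr linearP /= -!ad_lB lBr linearP. Qed.
Lemma adBrP w k a b : adBr w (k *: a + b) = k *: adBr w a + adBr w b.
Proof. by apply: muB_inj_l => x; rewrite nmulPl linearP /= -!ad_rB rBr linearP. Qed.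
Lemma adClP w k a b : adCl w (k *: a + b) = k *: adCl w a + adCl w b.
Proof. by apply: muC_inj_r => x; rewrite nmulPr linearP /= -!ad_lC lCr linearP. Qed.
Lemma adCrP w k a b : adCr w (k *: a + b) = k *: adCr w a + adCr w b.
Proof. by apply: muC_inj_l => x; rewrite nmulPl linearP /= -!ad_rC rCr linearP. Qed.

Lemma adBl_lB w x a : adBl w (lB x a) = x ** adBl w a.
Proof. by apply: muB_inj_r => x'; rewrite nmulA -!ad_lB -lBM. Qed.
Lemma adBr_rB w x a : adBr w (rB x a) = adBr w a ** x.
Proof. by apply: muB_inj_l => x'; rewrite -nmulA -!ad_rB -rBM. Qed.
Lemma adCl_lC w y a : adCl w (lC y a) = y ** adCl w a.
Proof. by apply: muC_inj_r => y'; rewrite nmulA -!ad_lC -lCM. Qed.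
Lemma adCr_rC w y a : adCr w (rC y a) = adCr w a ** y.
Proof. by apply: muC_inj_l => y'; rewrite -nmulA -!ad_rC -rCM. Qed.

Lemma ad_tlift w (X : Type) (M N : lmodType K) f g h (t : @tens K X M N f g) :
  w (tlift h t) = \sum_(p <- trepr t) w (h p.1 p.2).
Proof. exact: linear_sum. Qed.

Lemma chi_tlift (X : Type) (M N : lmodType K) f g h (t : @tens K X M N f g) :
  muB (eB (tlift h t)) = \sum_(p <- trepr t) muB (eB (h p.1 p.2)).
Proof. by rewrite linear_sum /= linear_sum. Qed.

Lemma chiC_tlift (X : Type) (M N : lmodType K) f g h (t : @tens K X M N f g) :
  muC (eC (tlift h t)) = \sum_(p <- trepr t) muC (eC (h p.1 p.2)).
Proof. by rewrite linear_sum /= linear_sum. Qed.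

Lemma eB_lB x a : eB (lB x a) = x ** eB a.
Proof. exact: eB_lmul. Qed.
Lemma eB_lC x a : eB (lC (sB x) a) = eB a ** x.
Proof. exact: eB_SB. Qed.
Lemma eC_rC y a : eC (rC y a) = eC a ** y.
Proof. exact: eC_rmul. Qed.
Lemma eC_rB y a : eC (rB (sC y) a) = y ** eC a.
Proof. exact: eC_SC. Qed.

Lemma S_lB x a : S (lB x a) = rC (sB x) (S a).
Proof.
move: a; apply: (bimul_ext (H := H)) => [k u v|k u v|x1 y1 b x2 y2].
- by rewrite lBr linearP.
- by rewrite linearP rCr.
- by rewrite bimul_lB !antipode_bimul anti_mul -!/(lB _ _) -!/(rB _ _) -!/(rC _ _)
    -!/(lC _ _) -lB_rC -lC_rC -rCM.
Qed.

Lemma S_lC y a : S (lC y a) = rB (sC y) (S a).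
Proof.
move: a; apply: (bimul_ext (H := H)) => [k u v|k u v|x1 y1 b x2 y2].
- by rewrite lCr linearP.
- by rewrite linearP rBr.
- by rewrite bimul_lC !antipode_bimul anti_mul -!/(lB _ _) -!/(rB _ _) -!/(rC _ _)
    -!/(lC _ _) -lB_rB -lC_rB rB_rC -rBM.
Qed.

Lemma S_rB x a : S (rB x a) = lC (sB x) (S a).
Proof.
move: a; apply: (bimul_ext (H := H)) => [k u v|k u v|x1 y1 b x2 y2].
- by rewrite rBr linearP.
- by rewrite linearP lCr.
- by rewrite bimul_rB !antipode_bimul anti_mul -!/(lB _ _) -!/(rB _ _) -!/(rC _ _)
    -!/(lC _ _) -lB_lC -lCM.
Qed.

Lemma S_rC y a : S (rC y a) = lB (sC y) (S a).
Proof.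
move: a; apply: (bimul_ext (H := H)) => [k u v|k u v|x1 y1 b x2 y2].
- by rewrite rCr linearP.
- by rewrite linearP lBr.
- by rewrite bimul_rC !antipode_bimul anti_mul -!/(lB _ _) -!/(rB _ _) -!/(rC _ _)
    -!/(lC _ _) -lBM.
Qed.

Lemma S'_rC y a : S' (rC y a) = lB (sB' y) (S' a).
Proof. by apply: (can_inj (antiK S)); rewrite S_lB !antiVK. Qed.
Lemma S'_rB x a : S' (rB x a) = lC (sC' x) (S' a).
Proof. by apply: (can_inj (antiK S)); rewrite S_lC !antiVK. Qed.
Lemma S'_lC y a : S' (lC y a) = rB (sB' y) (S' a).
Proof. by apply: (can_inj (antiK S)); rewrite S_rB !antiVK. Qed.
Lemma S'_lB x a : S' (lB x a) = rC (sC' x) (S' a).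
Proof. by apply: (can_inj (antiK S)); rewrite S_rC !antiVK. Qed.

(** * Slices of the comultiplications along adapted functionals *)

Definition lam w a b : A :=
  tlift (fun u v => lB (sB' (adCl w v)) u) (DBr a b).
Definition lam' w a b : A :=
  tlift (fun u v => rB (sC (adCr w v)) u) (DCr b a).
Definition rho w a b : A :=
  tlift (fun u v => rC (sC' (adBr w u)) v) (DCl b a).
Definition rho' w a b : A :=
  tlift (fun u v => lC (sB (adBl w u)) v) (DBl a b).

(** The slicing functional leaves a value in [B] or [C] that must act on the surviving leg, and the
    balancing relation decides how it gets there. In [tens_l] one has x a ⊗ b = a ⊗ S_B(x) b, so a
    value y in [C] reaches the first leg as S_B^-1(y). This is the origin of [sB'] here and of [sC],
    [sC'], [sB] in the other slices. *)
Lemma lam_bal w : balanced lB (lSB H) (fun u v => lB (sB' (adCl w v)) u).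
Proof.
split=> [n k m m'|m k n n'|x m n]; first by rewrite lBr.
- by rewrite adClP linearP /= lBl.
- by rewrite /lSB adCl_lC anti_inv_mul antiK lBM.
Qed.

Lemma lam'_bal w : balanced (rSC H) rC (fun u v => rB (sC (adCr w v)) u).
Proof.
split=> [n k m m'|m k n n'|y m n]; first by rewrite rBr.
- by rewrite adCrP linearP /= rBl.
- by rewrite /rSC adCr_rC anti_mul rBM.
Qed.

Lemma rho_bal w : balanced (rSC H) rC (fun u v => rC (sC' (adBr w u)) v).
Proof.
split=> [n k m m'|m k n n'|y m n]; last 2 first.
- by rewrite rCr.
- by rewrite /rSC adBr_rB anti_inv_mul antiK rCM.
- by rewrite adBrP linearP /= rCl.
Qed.

Lemma rho'_bal w : balanced lB (lSB H) (fun u v => lC (sB (adBl w u)) v).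
Proof.
split=> [n k m m'|m k n n'|x m n]; last 2 first.
- by rewrite lCr.
- by rewrite /lSB adBl_lB anti_mul lCM.
- by rewrite adBlP linearP /= lCl.
Qed.

Lemma lamPl w k a a' b : lam w (k *: a + a') b = k *: lam w a b + lam w a' b.
Proof. by rewrite /lam DBrPl; apply: tlift_linear; exact: lam_bal. Qed.
Lemma lam'Pr w k a b b' : lam' w a (k *: b + b') = k *: lam' w a b + lam' w a b'.
Proof. by rewrite /lam' DCrPl; apply: tlift_linear; exact: lam'_bal. Qed.
Lemma rhoPr w k a b b' : rho w a (k *: b + b') = k *: rho w a b + rho w a b'.
Proof. by rewrite /rho DClPl; apply: tlift_linear; exact: rho_bal. Qed.
Lemma rho'Pl w k a a' b : rho' w (k *: a + a') b = k *: rho' w a b + rho' w a' b.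
Proof. by rewrite /rho' DBlPl; apply: tlift_linear; exact: rho'_bal. Qed.
(* The functional [muB \o eB = muC \o eC] plays the role of the counit: it
   turns each slice back into the functional it was made from. *)
Lemma chi_lam w a b : muB (eB (lam w a b)) = w (a ** b).
Proof.
rewrite -(eB_DBr eB) ad_tlift chi_tlift; apply: eq_bigr => p _.
by rewrite eB_lB ad_lC -(muB_sB' (_ ** _)) anti_inv_mul antiK.
Qed.

Lemma chi_rho' w a b : muB (eB (rho' w a b)) = w (a ** b).
Proof.
rewrite -(eB_DBl eB) ad_tlift chi_tlift; apply: eq_bigr => p _.
by rewrite eB_lC ad_lB.
Qed.

Lemma chi_lam' w a b : muB (eB (lam' w a b)) = w (a ** b).
Proof.
rewrite mu_counit -(eC_DCr eC) ad_tlift chiC_tlift; apply: eq_bigr => p _.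
by rewrite eC_rB ad_rC.
Qed.

Lemma chi_rho w a b : muB (eB (rho w a b)) = w (a ** b).
Proof.
rewrite mu_counit -(eC_DCl eC) ad_tlift chiC_tlift; apply: eq_bigr => p _.
by rewrite eC_rC ad_rB -(muC_sC' (_ ** _)) anti_inv_mul antiK.
Qed.

Lemma lam_rC w a b y : lam w (rC y a) b = rC y (lam w a b).
Proof.
rewrite /lam DBr_rC tlift_tmap; last exact: lam_bal.
rewrite (lin_tlift (h := rC y)); last by move=> k u v; rewrite rCr.
by apply: eq_tlift => u v; rewrite lB_rC.
Qed.

Lemma rho_lB w a b x : rho w a (lB x b) = lB x (rho w a b).
Proof.
rewrite /rho DCl_lB tlift_tmap; last exact: rho_bal.
rewrite (lin_tlift (h := lB x)); last by move=> k u v; rewrite lBr.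
by apply: eq_tlift => u v; rewrite lB_rC.
Qed.

Lemma lam'_lC w a b y : lam' w a (lC y b) = lC y (lam' w a b).
Proof.
rewrite /lam' DCr_lC tlift_tmap; last exact: lam'_bal.
rewrite (lin_tlift (h := lC y)); last by move=> k u v; rewrite lCr.
by apply: eq_tlift => u v; rewrite lC_rB.
Qed.

Lemma rho'_rB w a b x : rho' w (rB x a) b = rB x (rho' w a b).
Proof.
rewrite /rho' DBl_rB tlift_tmap; last exact: rho'_bal.
rewrite (lin_tlift (h := rB x)); last by move=> k u v; rewrite rBr.
by apply: eq_tlift => u v; rewrite lC_rB.
Qed.

(** * Commutation of left and right convolutions *)

Lemma rho_lam w w' a b c : rho w a (lam w' b c) = lam w' (rho w a b) c.
Proof.
rewrite {1}/lam (lin_tlift (h := rho w a)); last by move=> k u v; rewrite rhoPr.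
rewrite (eq_tlift (b' := fun d e => tlift (fun u v =>
  lB (sB' (adCl w' e)) (rC (sC' (adBr w u)) v)) (DCl d a))); last first.
  move=> u v; rewrite rho_lB /rho (lin_tlift (h := lB _)) //.
  by move=> k z z'; rewrite lBr.
rewrite (tens3_apply (th := fun u v e =>
  lB (sB' (adCl w' e)) (rC (sC' (adBr w u)) v)) _ (mb_mixed_rl H a b c)).
- rewrite /rho (lin_tlift (h := fun z => lam w' z c)); last first.
    by move=> k u v; rewrite lamPl.
  apply: eq_tlift => d e; rewrite lam_rC /lam (lin_tlift (h := rC _)).
    by apply: eq_tlift => n p; rewrite lB_rC.
  by move=> k z z'; rewrite rCr.
- split=> [p|m n k p p'|x m n p].
  + have [h1 h2 h3] := rho_bal w.
    split=> [n k m m'|m k n n'|y m n].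
    * by rewrite h1 lBr.
    * by rewrite h2 lBr.
    * by rewrite h3.
  + by rewrite adClP linearP /= lBl.
  + by rewrite /lSB adCl_lC anti_inv_mul antiK -lB_rC lBM.
Qed.

Lemma rho'_lam' w w' a b c : rho' w (lam' w' c b) a = lam' w' c (rho' w b a).
Proof.
rewrite {1}/lam' (lin_tlift (h := fun z => rho' w z a)); last first.
  by move=> k u v; rewrite rho'Pl.
rewrite (eq_tlift (b' := fun d e => tlift (fun u v =>
  rB (sC (adCr w' e)) (lC (sB (adBl w u)) v)) (DBl d a))); last first.
  move=> u v; rewrite rho'_rB /rho' (lin_tlift (h := rB _)) //.
  by move=> k z z'; rewrite rBr.
rewrite (tens3_apply (th := fun u v e =>
  rB (sC (adCr w' e)) (lC (sB (adBl w u)) v)) _ (mb_mixed_lr H a b c)).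
- rewrite /rho' (lin_tlift (h := lam' w' c)); last first.
    by move=> k u v; rewrite lam'Pr.
  apply: eq_tlift => d e; rewrite lam'_lC /lam' (lin_tlift (h := lC _)).
    by apply: eq_tlift => n p; rewrite lC_rB.
  by move=> k z z'; rewrite lCr.
- split=> [p|m n k p p'|y m n p].
  + have [h1 h2 h3] := rho'_bal w.
    split=> [n k m m'|m k n n'|x m n].
    * by rewrite h1 rBr.
    * by rewrite h2 rBr.
    * by rewrite h3.
  + by rewrite adCrP linearP /= rBl.
  + by rewrite /rSC adCr_rC anti_mul lC_rB rBM.
Qed.

Lemma ad_rho_lam w w' a b c : w (a ** lam w' b c) = w' (rho w a b ** c).
Proof. by rewrite -chi_rho rho_lam chi_lam. Qed.

Lemma ad_rho'_lam' w w' a b c : w (lam' w' c b ** a) = w' (c ** rho' w b a).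
Proof. by rewrite -chi_rho' rho'_lam' chi_lam'. Qed.

(** Here [lam w a b] is [LamT w (DBr a b)] and [rho' w a b] is [RhoT w (DBl a b)]. Slicing general
    elements of [tens_l] is needed since invariance concerns the opposite combinations, [LamT] on
    [DBl] and [RhoT] on [DBr]. *)
Definition LamT w (t : tens_l H) : A := tlift (fun u v => lB (sB' (adCl w v)) u) t.
Definition RhoT w (t : tens_l H) : A := tlift (fun u v => lC (sB (adBl w u)) v) t.

Lemma LamT_lin w : linear (LamT w).
Proof. by apply: tlift_linear; exact: lam_bal. Qed.
Lemma RhoT_lin w : linear (RhoT w).
Proof. by apply: tlift_linear; exact: rho'_bal. Qed.

(* Both sides apply the relative tensor product of [w] and [w'] to [t]. *)
Lemma ad_LamT w w' t : w (LamT w' t) = w' (RhoT w t).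
Proof.
rewrite /LamT /RhoT !ad_tlift; apply: eq_bigr => p _.
by rewrite ad_lB ad_lC -(muC_SB mu) anti_mul antiVK.
Qed.

Lemma LamT_r1 w t c : LamT w (r1 c t) = LamT w t ** c.
Proof.
rewrite /LamT tlift_tmap; last exact: lam_bal.
rewrite (lin_tlift (h := fun z => z ** c)); last by move=> k u v; rewrite nmulPl.
by apply: eq_tlift => u v; rewrite lB_mul.
Qed.

Lemma RhoT_r2 w t c : RhoT w (r2 c t) = RhoT w t ** c.
Proof.
rewrite /RhoT tlift_tmap; last exact: rho'_bal.
rewrite (lin_tlift (h := fun z => z ** c)); last by move=> k u v; rewrite nmulPl.
by apply: eq_tlift => u v; rewrite lC_mul.
Qed.

Lemma lam_mul w a b c : lam w a b ** c = LamT w (DB a (c ⊗ b)).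
Proof. by rewrite DBpairr LamT_r1. Qed.

Lemma rho'_mul w a b c : rho' w a b ** c = RhoT w (DB a (b ⊗ c)).
Proof. by rewrite DBpairl RhoT_r2. Qed.

(** Both sides are the relative tensor product of [w] and [w'] evaluated on Delta_B(a)(c ⊗ b). *)
Lemma ad_lam_rho' w w' a b c : w (lam w' a b ** c) = w' (rho' w a c ** b).
Proof. by rewrite lam_mul rho'_mul ad_LamT. Qed.

(** Both sides are the relative tensor product of [w] and [w'] evaluated on (a ⊗ c)Delta_C(b). *)
Lemma ad_rho_lam'_r w w' a b c : w' (c ** rho w a b) = w (a ** lam' w' c b).
Proof.
have -> : c ** rho w a b = tlift (fun u v => rC (sC' (adBr w u)) v)
    (l2 c (DCl b a)).
  rewrite tlift_tmap; last exact: rho_bal.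
  rewrite /rho (lin_tlift (h := fun z => c ** z)); last by move=> k u v; rewrite nmulPr.
  by apply: eq_tlift => u v; rewrite rC_mul.
have -> : a ** lam' w' c b = tlift (fun u v => rB (sC (adCr w' v)) u)
    (l1 a (DCr b c)).
  rewrite tlift_tmap; last exact: lam'_bal.
  rewrite /lam' (lin_tlift (h := fun z => a ** z)); last by move=> k u v; rewrite nmulPr.
  by apply: eq_tlift => u v; rewrite rB_mul.
rewrite -DClr !ad_tlift; apply: eq_bigr => p _.
by rewrite ad_rC ad_rB -(muC_sC' (_ ** _)) anti_inv_mul antiK.
Qed.

(** * The counit on either leg of [tens_l], and the agreement of the module maps of an integral *)

Definition EpsL (t : tens_l H) : A := tlift (fun u v => lB (eB v) u) t.
Definition EpsR (t : tens_l H) : A := tlift (fun u v => lC (sB (eB u)) v) t.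

Lemma EpsL_bal : balanced lB (lSB H) (fun u v => lB (eB v) u).
Proof.
split=> [n k m m'|m k n n'|x m n]; first by rewrite lBr.
- by rewrite linearP /= lBl.
- by rewrite /lSB eB_lC lBM.
Qed.

Lemma EpsR_bal : balanced lB (lSB H) (fun u v => lC (sB (eB u)) v).
Proof.
split=> [n k m m'|m k n n'|x m n]; last 2 first.
- by rewrite lCr.
- by rewrite /lSB eB_lB anti_mul lCM.
- by rewrite !linearP /= lCl.
Qed.

Lemma EpsL_DBl a b : EpsL (DBl a b) = a ** b.
Proof. exact: eB_DBl. Qed.
Lemma EpsR_DBr a b : EpsR (DBr a b) = a ** b.
Proof. exact: eB_DBr. Qed.


Lemma EpsL_r1 t c : EpsL (r1 c t) = EpsL t ** c.
Proof.
rewrite /EpsL tlift_tmap; last exact: EpsL_bal.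
rewrite (lin_tlift (h := fun z => z ** c)); last by move=> k u v; rewrite nmulPl.
by apply: eq_tlift => u v; rewrite lB_mul.
Qed.

Lemma EpsR_r2 t c : EpsR (r2 c t) = EpsR t ** c.
Proof.
rewrite /EpsR tlift_tmap; last exact: EpsR_bal.
rewrite (lin_tlift (h := fun z => z ** c)); last by move=> k u v; rewrite nmulPl.
by apply: eq_tlift => u v; rewrite lC_mul.
Qed.

(** The counit axioms place the extra factor on the surviving leg; here it sits under the counit.
    After multiplication by a test element, [eB_mulB] replaces it by the element [eB b] of [B],
    which passes through Delta_B into [a]. *)
Lemma EpsL_DBr a b : EpsL (DBr a b) = rB (eB b) a.
Proof.
apply: (nondeg_r (qg_nondeg H)) => c.
rewrite rB_lB -EpsL_r1 DBlr /EpsL tlift_tmap; last exact: EpsL_bal.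
rewrite -rB_lB -EpsL_DBl DBl_rB /EpsL [RHS]tlift_tmap; last exact: EpsL_bal.
by apply: eq_tlift => u v; rewrite eB_mulB.
Qed.

Lemma EpsR_DBl a b : EpsR (DBl a b) = rC (sB (eB b)) a.
Proof.
apply: (nondeg_r (qg_nondeg H)) => c.
rewrite rC_lC -EpsR_r2 -DBlr /EpsR tlift_tmap; last exact: EpsR_bal.
rewrite -rC_lC -EpsR_DBr DBr_rC /EpsR [RHS]tlift_tmap; last exact: EpsR_bal.
by apply: eq_tlift => u v; rewrite eB_mulC.
Qed.

(* The counit need not be surjective onto [B], but its image is an essential
   ideal on both sides. *)
Lemma eB_essential_r z : (forall a, z ** eB a = 0) -> z = 0.
Proof.
move=> e; apply: (lB_inj (H := H)) => a; apply: (nondeg_r (qg_nondeg H)) => c.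
have l0 u : lB 0 u = 0 by apply: (lin0 (h := lB^~ u)) => k v v'; rewrite lBl.
rewrite l0 -lB_mul -EpsL_DBl /EpsL (lin_tlift (h := lB z)); last first.
  by move=> k u v; rewrite lBr.
by rewrite nmul0l /tlift big1 // => p _; rewrite -lBM e l0.
Qed.

Lemma eB_essential_l z : (forall a, eB a ** z = 0) -> z = 0.
Proof.
move=> e; rewrite -(antiK sB z).
suff -> : sB z = 0 by rewrite linear0.
apply: (lC_inj (H := H)) => a; apply: (nondeg_r (qg_nondeg H)) => c.
have l0 u : lC 0 u = 0 by apply: (lin0 (h := lC^~ u)) => k v v'; rewrite lCl.
rewrite l0 -EpsR_DBr DBr_lC /EpsR tlift_tmap; last exact: EpsR_bal.
by rewrite nmul0l /tlift big1 // => p _; rewrite eB_lC e linear0 l0.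
Qed.

Lemma left_int w : left_integral w -> forall a b, LamT w (DBl b a) = lC (adCl w b) a.
Proof. exact. Qed.
Lemma right_int w : right_integral w -> forall a b, RhoT w (DBr a b) = lB (adBl w a) b.
Proof. exact. Qed.

(** Pair [w] on the first leg and [muB \o eB] on the second with Delta_B(a)(1 ⊗ d). Right invariance
    gives the value muB(adBl w a ** eB d), the counit gives muB(adBr w a ** eB d), and the values of
    the counit are numerous enough to conclude. *)
Lemma right_int_adB w : right_integral w -> forall a, adBl w a = adBr w a.
Proof.
move=> hw a; apply/eqP; rewrite -subr_eq0; apply/eqP.
apply: eB_essential_r => c; apply: muB_inj_l => x.
(* The test element [x] is absorbed into the counit, [eB c ** x] being eB(S_B(x) c), so that only
   elements [eB d] remain. *)
rewrite nmul0l linear0 -nmulA -eB_lC nmulBl linearB /=.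
set d := lC _ c.
have -> : muB (adBr w a ** eB d) = w (rB (eB d) a) by rewrite ad_rB.
have -> : muB (adBl w a ** eB d) = muB (eB (lB (adBl w a) d)) by rewrite eB_lB.
rewrite -right_int // -EpsL_DBr /RhoT /EpsL ad_tlift chi_tlift.
apply/eqP; rewrite subr_eq0; apply/eqP; apply: eq_bigr => p _.
by rewrite eB_lC ad_lB.
Qed.

(** The same comparison on Delta_B(a)(d ⊗ 1), with the counit on the first leg and [w] on the
    second. *)
Lemma left_int_adC w : left_integral w -> forall a, adCl w a = adCr w a.
Proof.
move=> hw a; apply: (can_inj (antiVK sB)).
apply/eqP; rewrite -subr_eq0; apply/eqP.
apply: eB_essential_l => c; apply: muB_inj_r => x.
rewrite nmul0r linear0 nmulA -eB_lB nmulBr linearB /=.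
set d := lB _ c.
have h y : muB (eB d ** sB' y) = muC (y ** sB (eB d)).
  by rewrite -(muC_SB mu) anti_mul antiVK.
rewrite !h -ad_rC -EpsR_DBl -h.
have -> : muB (eB d ** sB' (adCl w a)) = muB (eB (lC (adCl w a) d)).
  by rewrite -{2}(antiVK sB (adCl w a)) eB_lC.
rewrite -left_int // /LamT /EpsR ad_tlift chi_tlift.
apply/eqP; rewrite subr_eq0; apply/eqP; apply: eq_bigr => p _.
by rewrite eB_lB ad_lC -(muB_sB' (_ ** _)) anti_inv_mul antiK.
Qed.

(** * Passage between psi(- a) and phi(- a') *)

Definition right_related w w' a a' : Prop :=
  forall b, w (b ** a) = w' (b ** a').

Lemma right_related0 w w' : right_related w w' 0 0.
Proof.
by move=> b; rewrite nmul0r !linear0.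
Qed.

Lemma right_relatedD w w' a a' b b' : right_related w w' a a' ->
  right_related w w' b b' -> right_related w w' (a + b) (a' + b').
Proof. by move=> h h' c; rewrite !nmulDr !linearD h h'. Qed.

Lemma right_related_mul w w' a a' b : right_related w w' a a' ->
  right_related w w' (b ** a) (b ** a').
Proof. by move=> h c; rewrite !nmulA h. Qed.

Lemma right_related_lB w w' x a a' : right_related w w' a a' ->
  right_related w w' (lB x a) (lB x a').
Proof. by move=> h c; rewrite -!rB_lB h. Qed.

Lemma right_related_lC w w' y a a' : right_related w w' a a' ->
  right_related w w' (lC y a) (lC y a').
Proof. by move=> h c; rewrite -!rC_lC h. Qed.

Lemma right_related_uniq w w' a a' a'' : faithful w' ->
  right_related w w' a a' -> right_related w w' a a'' -> a' = a''.
Proof.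
move=> fw h h'; apply/eqP; rewrite -subr_eq0; apply/eqP; apply: contrapT => n0.
have [_ [c]] := fw _ n0; apply.
by rewrite nmulBr linearB /= -h -h' subrr.
Qed.

Section RightRelated.
Variables phi psi : adapted mu.
Hypotheses (phi_left : left_integral phi) (psi_right : right_integral psi).

(** Right invariance yields muB(adBl psi (a ** p) ** adBl phi q). Since the two [B]-valued maps of
    [psi] agree, [adBl phi q] can re-enter [psi] as a right factor. *)
Lemma LamT_T_rho a p q :
  psi (LamT phi (DB a (DBr p q))) = psi (a ** rB (adBl phi q) p).
Proof.
rewrite DB_DBr ad_LamT (right_int psi_right) ad_lB (right_int_adB psi_right).
by rewrite -ad_rB rB_mul.
Qed.

Lemma LamT_T_lambda a p q :
  psi (LamT phi (DB a (DBl q p))) = phi (a ** rC (adCl psi p) q).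
Proof.
rewrite DB_DBl (left_int phi_left) ad_lC (left_int_adC phi_left).
by rewrite -ad_rC rC_mul.
Qed.

Lemma LamT_DB_sum a (X : Type) (M N : lmodType K) f g h (t : @tens K X M N f g) :
  psi (LamT phi (DB a (tlift h t))) =
  \sum_(p <- trepr t) psi (LamT phi (DB a (h p.1 p.2))).
Proof.
rewrite (lin_tlift (h := DB a)); last exact: DB_linear.
by rewrite (lin_tlift (h := LamT phi)) ?ad_tlift //; exact: LamT_lin.
Qed.

Lemma right_related_ex : (forall x, exists a, adBl phi a = x) ->
  forall a, exists a', right_related psi phi a a'.
Proof.
move=> su; apply: (rB_span (H := H)).
- by exists 0; exact: right_related0.
- move=> a b [a' h] [b' h']; exists (a' + b'); exact: right_relatedD.
- move=> x p; have [q <-] := su x; have [g _ gK] := T_lambda_bij H.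
  (* If T_lambda sends the sum of a_i ⊗ b_i to Delta_B(p)(1 ⊗ q), the witness is the sum of b_i
     psi_C(a_i): [LamT_T_rho] and [LamT_T_lambda] evaluate one and the same quantity. *)
  exists (tlift (fun a b => rC (adCl psi a) b) (g (DBr p q))) => a.
  rewrite -LamT_T_rho -{1}(gK (DBr p q)) /T_lambda LamT_DB_sum.
  rewrite (lin_tlift (h := fun z => a ** z)); last by move=> k u v; rewrite nmulPr.
  by rewrite ad_tlift; apply: eq_bigr => r _; rewrite LamT_T_lambda.
Qed.

Lemma right_related_ex' : (forall y, exists a, adCl psi a = y) ->
  forall a, exists a', right_related phi psi a a'.
Proof.
move=> su; apply: (rC_span (H := H)).
- by exists 0; exact: right_related0.
- move=> a b [a' h] [b' h']; exists (a' + b'); exact: right_relatedD.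
- move=> x q; have [p <-] := su x; have [g _ gK] := T_rho_bij H.
  exists (tlift (fun a b => rB (adBl phi b) a) (g (DBl q p))) => a.
  rewrite -LamT_T_lambda -{1}(gK (DBl q p)) /T_rho LamT_DB_sum.
  rewrite (lin_tlift (h := fun z => a ** z)); last by move=> k u v; rewrite nmulPr.
  by rewrite ad_tlift; apply: eq_bigr => r _; rewrite LamT_T_rho.
Qed.

End RightRelated.

(** For sums of products even the values of the two functionals agree, not only those after a
    further left multiplication: the first factor of each summand plays the part of the multiplier
    in [right_related]. *)
Lemma related_prod_sum w w' (X : Type) (f g : X -> A -> A) (h h' : A -> A -> A)
    (t : tens f g) :
  (forall a, exists a', right_related w w' a a') ->
  exists2 z', right_related w w' (tlift (fun p q => h p q ** h' p q) t) z' &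
    w (tlift (fun p q => h p q ** h' p q) t) = w' z'.
Proof.
move=> ex; rewrite /tlift; elim/big_ind: _ => [|z1 z2 [z1' h1 e1] [z2' h2 e2]|p _].
- by exists 0; [exact: right_related0|rewrite !linear0].
- by exists (z1' + z2'); [exact: right_relatedD|rewrite !linearD e1 e2].
- have [a' ha] := ex (h' p.1 p.2).
  by exists (h p.1 p.2 ** a'); [exact: right_related_mul|exact: ha].
Qed.

(* [A ** A] may be a proper subspace of [A], and the relation only concerns
   functionals on [A ** A].  It is lifted to [A] through the essential ideal
   [eB(A)], because [eB(A) A] is contained in [A ** A]. *)
Section Relate.
Variables w w' : adapted mu.
Hypothesis ex : forall a, exists a', right_related w w' a a'.
Hypothesis fw : faithful w'.

Lemma related_adBl a a' : right_related w w' a a' -> adBl w a = adBl w' a'.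
Proof.
move=> r; apply/eqP; rewrite -subr_eq0; apply/eqP; apply: eB_essential_l => c.
rewrite nmulBr -!adBl_lB.
apply/eqP; rewrite subr_eq0; apply/eqP; apply: muB_inj_r => x.
rewrite -!ad_lB -!lBM -eB_lB; set d := lB x c.
have [g _ gK] := T_lambda_bij H.
(* Applying the counit to the second leg of a ⊗ d, written as T_lambda of a sum of p ⊗ q, exhibits
   eB(d) a as a sum of products, to which [related_prod_sum] applies. *)
have E : lB (eB d) a = tlift (fun p q => q ** p) (g (a ⊗ d)).
  rewrite -[LHS](tliftE _ _ EpsL_bal) -{1}(gK (a ⊗ d)) /T_lambda.
  rewrite tlift_tlift; last exact: EpsL_bal.
  by apply: eq_tlift => p q; rewrite -EpsL_DBl.
have [z' h1 h2] := related_prod_sum (fun p q => q) (fun p q => p) (g (a ⊗ d)) ex.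
rewrite E h2; congr (w' _); apply: (right_related_uniq fw h1).
by rewrite -E; exact: right_related_lB.
Qed.

Lemma related_adCl a a' : right_related w w' a a' -> adCl w a = adCl w' a'.
Proof.
move=> r; apply: (can_inj (antiVK sB)).
apply/eqP; rewrite -subr_eq0; apply/eqP; apply: eB_essential_r => c.
apply: (can_inj (antiK sB)); rewrite anti_mul linearB /= !antiVK linear0.
rewrite nmulBr -!adCl_lC; apply/eqP; rewrite subr_eq0; apply/eqP.
apply: muC_inj_r => y.
rewrite -!ad_lC -!lCM -(antiVK sB y) -anti_mul -eB_lC; set d := lC _ c.
have [g _ gK] := T_rho_bij H.
have E : lC (sB (eB d)) a = tlift (fun p q => p ** q) (g (d ⊗ a)).
  rewrite -[LHS](tliftE _ _ EpsR_bal) -{1}(gK (d ⊗ a)) /T_rho.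
  rewrite tlift_tlift; last exact: EpsR_bal.
  by apply: eq_tlift => p q; rewrite -EpsR_DBr.
have [z' h1 h2] := related_prod_sum (fun p q => p) (fun p q => q) (g (d ⊗ a)) ex.
rewrite E h2; congr (w' _); apply: (right_related_uniq fw h1).
by rewrite -E; exact: right_related_lC.
Qed.

End Relate.

(** Related elements have equal [B]-valued images, so every value of [adBl phi] is also a value of
    [adBl psi]; fullness of [phi] then transfers to [psi]. *)
Lemma adBl_surj (phi psi : adapted mu) : left_integral phi -> right_integral psi ->
  faithful phi -> faithful psi ->
  (forall x, exists a, adBl phi a = x) -> (forall y, exists a, adCl psi a = y) ->
  forall x, exists a, adBl psi a = x.
Proof.
move=> hphi hpsi fphi fpsi su su' x; have [q <-] := su x.
have [a ha] := right_related_ex' hphi hpsi su' q.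
exists a; apply/esym; apply: (related_adBl _ fpsi ha).
exact: right_related_ex'.
Qed.

Lemma adCl_surj (phi psi : adapted mu) : left_integral phi -> right_integral psi ->
  faithful phi -> faithful psi ->
  (forall x, exists a, adBl phi a = x) -> (forall y, exists a, adCl psi a = y) ->
  forall y, exists a, adCl phi a = y.
Proof.
move=> hphi hpsi fphi fpsi su su' y; have [q <-] := su' y.
have [a ha] := right_related_ex hphi hpsi su q.
exists a; apply/esym; apply: (related_adCl _ fphi ha).
exact: right_related_ex.
Qed.

(* [T_lambda^-1 = (S^-1 ⊗ id) lambda_T (S ⊗ id)] *)
Lemma T_lambda_inv a c :
  tlift (fun u v => DBl v (S' u)) (DCl a (S c)) = c ⊗ a.
Proof.
apply: (cancel_r2 (mb_left H)) => d.
rewrite (tmapE _ _ (r2_ok H d)) (tmap_tlift _ _ (r2_ok H d)).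
rewrite (eq_tlift (b' := fun u v => tlift (fun n p => (n ** S' u) ⊗ p) (DBr v d)));
  last by move=> u v; rewrite -DBlr.
rewrite -(tens3_apply (th := fun u n p => (n ** S' u) ⊗ p) _
  (mb_mixed_rl H (S c) a d)); last first.
  split=> [p|m n k p p'|x m n p]; last 2 first.
  - by rewrite tpairPr.
  - by rewrite -lB_mul tpairB.
  split=> [n k m m'|m k n n'|y m n].
  - by rewrite linearP /= nmulPr tpairPl.
  - by rewrite nmulPl tpairPl.
  - by rewrite /rSC S'_rB antiK rC_lC.
rewrite (eq_tlift (b' := fun d' e => c ⊗ lC (sB (eB d')) e)); last first.
  move=> d' e; rewrite -tlift_pairl -[lC _ e]/(lSB H _ e) -tpairB.
  congr (_ ⊗ _); apply: (can_inj (antiK S)); rewrite S_lB.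
  rewrite (lin_tlift (h := S)); last by move=> k u v; rewrite linearP.
  rewrite -[RHS](antipode_right S); apply: eq_tlift => u v.
  by rewrite anti_mul antiVK.
by rewrite -tlift_pairr; congr (_ ⊗ _); exact: eB_DBr.
Qed.

(** The factor [c] on the second leg comes out on the right because [S] reverses products;
    multiplying by a test element [d] on the left restores the form of [antipode_right]. *)
Lemma antipode_right_DCr a c :
  tlift (fun u v => u ** S v) (DCr a c) = lC (sB (eB a)) (S c).
Proof.
apply: (nondeg_l (qg_nondeg H)) => d; rewrite -rC_lC.
rewrite (lin_tlift (h := fun z => d ** z)); last by move=> k u v; rewrite nmulPr.
have hb : balanced (rSC H) rC (fun u v => u ** S v).
  split=> [n k m m'|m k n n'|y m n].
  - by rewrite nmulPl.
  - by rewrite linearP /= nmulPr.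
  - by rewrite /rSC S_rC rB_lB.
transitivity (tlift (fun u v => u ** S v) (l1 d (DCr a c))).
  by rewrite tlift_tmap //; apply: eq_tlift => u v; rewrite nmulA.
rewrite -DClr tlift_tmap //; rewrite -[rC _ d]/(d <* _) -(antipode_right S).
rewrite (lin_tlift (h := fun z => z ** S c)); last by move=> k u v; rewrite nmulPl.
by apply: eq_tlift => u v; rewrite anti_mul nmulA.
Qed.

(* [T_rho^-1 = (id ⊗ S) rho_T (id ⊗ S^-1)] *)
Lemma T_rho_inv a c :
  tlift (fun u v => DBr u (S v)) (DCr a (S' c)) = a ⊗ c.
Proof.
apply: (cancel_r1 (mb_left H)) => d.
rewrite (tmapE _ _ (r1_ok H d)) (tmap_tlift _ _ (r1_ok H d)).
rewrite (eq_tlift (b' := fun u v => tlift (fun n p => n ⊗ (p ** S v)) (DBl u d)));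
  last by move=> u v; rewrite DBlr.
rewrite (tens3_apply (th := fun n p v => n ⊗ (p ** S v)) _
  (mb_mixed_lr H d a (S' c))); last first.
  split=> [p|m n k p p'|y m n p]; last 2 first.
  - by rewrite linearP /= nmulPr tpairPr.
  - by rewrite /rSC S_rC rB_lB.
  split=> [n k m m'|m k n n'|x m n].
  - by rewrite tpairPl.
  - by rewrite nmulPl tpairPr.
  - by rewrite /lSB -lC_mul -[lC _ _]/(lSB H x _) tpairB.
rewrite (eq_tlift (b' := fun u e => lB (eB e) u ⊗ c)); last first.
  move=> u e; rewrite -tlift_pairr antipode_right_DCr antiVK tpairB.
  by [].
by rewrite -tlift_pairl; congr (_ ⊗ _); exact: eB_DBl.
Qed.

(** * Strong invariance of integrals *)

Lemma lam_explicit w a b c : left_integral w ->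
  lam w a b ** c = tlift (fun u v => lC (adCl w (a ** v)) (S' u)) (DCl b (S c)).
Proof.
(* The product is [LamT w] of Delta_B(a)(c ⊗ b). Writing c ⊗ b in the image of T_lambda leaves terms
   [DBl (a ** v) (S' u)], on which left invariance computes [LamT]. *)
move=> hw; rewrite lam_mul -T_lambda_inv (lin_tlift (h := DB a)); last exact: DB_linear.
rewrite (lin_tlift (h := LamT w)); last exact: LamT_lin.
by apply: eq_tlift => u v; rewrite DB_DBl left_int.
Qed.

Lemma rho'_explicit w a b c : right_integral w ->
  rho' w a b ** c = tlift (fun u v => lB (adBl w (a ** u)) (S v)) (DCr b (S' c)).
Proof.
move=> hw; rewrite rho'_mul -T_rho_inv (lin_tlift (h := DB a)); last exact: DB_linear.
rewrite (lin_tlift (h := RhoT w)); last exact: RhoT_lin.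
by apply: eq_tlift => u v; rewrite DB_DBr right_int.
Qed.

(** In [lam_explicit] the element [a] occurs only inside [w]. Applying [S] undoes the [S'] there and
    leaves the slice of (c ⊗ a)Delta_C(b), which is [c ** lam' w a b]; the agreement of [adCl] and
    [adCr] makes the two slices fit. *)
Lemma S_lam w a b : left_integral w -> S (lam w a b) = lam' w a b.
Proof.
move=> hw; apply: (nondeg_l (qg_nondeg H)) => c; rewrite -(antiVK S c).
rewrite -anti_mul lam_explicit // (lin_tlift (h := S)); last first.
  by move=> k u v; rewrite linearP.
rewrite /lam' (lin_tlift (h := fun z => _ ** z)); last by move=> k u v; rewrite nmulPr.
transitivity (tlift (fun u v => rB (sC (adCr w v)) u) (l2 a (DCl b (S (S' c))))).
  rewrite tlift_tmap; last exact: lam'_bal.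
  by apply: eq_tlift => u v; rewrite S_lC antiVK left_int_adC.
rewrite DClr tlift_tmap; last exact: lam'_bal.
by apply: eq_tlift => u v; rewrite rB_mul.
Qed.

Lemma S_rho_bal w :
  balanced (rSC H) rC (fun u v => S (rC (sC' (adBr w u)) v)).
Proof.
have [h1 h2 h3] := rho_bal w.
split=> [n k m m'|m k n n'|y m n].
- by rewrite h1 linearP.
- by rewrite h2 linearP.
- by rewrite h3.
Qed.

Lemma S_rho w a b : right_integral w -> S (rho w a b) = rho' w a b.
Proof.
move=> hw; apply: (nondeg_r (qg_nondeg H)) => c; rewrite -{1}(antiVK S c).
rewrite -anti_mul rho'_explicit // /rho.
rewrite (lin_tlift (h := fun z => _ ** z)); last by move=> k u v; rewrite nmulPr.
rewrite (lin_tlift (h := S)); last by move=> k u v; rewrite linearP.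
transitivity (tlift (fun u v => S (rC (sC' (adBr w u)) v)) (l1 a (DCr b (S' c)))).
  rewrite -DClr tlift_tmap; last exact: S_rho_bal.
  by apply: eq_tlift => u v; rewrite rC_mul.
rewrite tlift_tmap; last exact: S_rho_bal.
by apply: eq_tlift => u v; rewrite S_rC antiVK right_int_adB.
Qed.

(** Slicing a ⊗ b directly gives x a with x = S_B^-1(adCl w b), which is an arbitrary element of
    [B]; since T_rho is onto, a ⊗ b is a sum of elements [DBr p q], whose slices are [lam w p q]. *)
Lemma lam_span w (P : A -> Prop) : (forall y, exists a, adCl w a = y) -> P 0 ->
  (forall a b, P a -> P b -> P (a + b)) -> (forall a b, P (lam w a b)) ->
  forall a, P a.
Proof.
move=> su P0 PD Pl; apply: (lB_span (H := H)) => // x a.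
have [b bE] := su (sB x); have [g _ gK] := T_rho_bij H.
have -> : lB x a = LamT w (a ⊗ b).
  by rewrite /LamT tliftE; [rewrite bE antiK|exact: lam_bal].
rewrite -(gK (a ⊗ b)) /T_rho (lin_tlift (h := LamT w)); last exact: LamT_lin.
by rewrite /tlift; elim/big_ind: _ => // p _; exact: Pl.
Qed.

Lemma rho'_span w (P : A -> Prop) : (forall x, exists a, adBl w a = x) -> P 0 ->
  (forall a b, P a -> P b -> P (a + b)) -> (forall a b, P (rho' w a b)) ->
  forall a, P a.
Proof.
move=> su P0 PD Pl; apply: (lC_span (H := H)) => // y b.
have [a aE] := su (sB' y); have [g _ gK] := T_lambda_bij H.
have -> : lC y b = RhoT w (a ⊗ b).
  by rewrite /RhoT tliftE; [rewrite aE antiVK|exact: rho'_bal].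
rewrite -(gK (a ⊗ b)) /T_lambda (lin_tlift (h := RhoT w)); last exact: RhoT_lin.
by rewrite /tlift; elim/big_ind: _ => // p _; exact: Pl.
Qed.

Lemma rho_span w (P : A -> Prop) : (forall x, exists a, adBr w a = x) -> P 0 ->
  (forall a b, P a -> P b -> P (a + b)) -> (forall a b, P (rho w a b)) ->
  forall a, P a.
Proof.
move=> su P0 PD Pl; apply: (rC_span (H := H)) => // y b.
have [a aE] := su (sC y); have [g _ gK] := lambda_T_bij H.
have -> : rC y b = tlift (fun u v => rC (sC' (adBr w u)) v) (a ⊗ b : tens_r H).
  by rewrite tliftE; [rewrite aE antiK|exact: rho_bal].
rewrite -(gK (a ⊗ b)) /lambda_T tlift_tlift; last exact: rho_bal.
by rewrite /tlift; elim/big_ind: _ => // p _; exact: Pl.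
Qed.

Lemma lam'_span w (P : A -> Prop) : (forall y, exists a, adCr w a = y) -> P 0 ->
  (forall a b, P a -> P b -> P (a + b)) -> (forall a b, P (lam' w a b)) ->
  forall a, P a.
Proof.
move=> su P0 PD Pl; apply: (rB_span (H := H)) => // x a.
have [b bE] := su (sC' x); have [g _ gK] := rho_T_bij H.
have -> : rB x a = tlift (fun u v => rB (sC (adCr w v)) u) (a ⊗ b : tens_r H).
  by rewrite tliftE; [rewrite bE antiVK|exact: lam'_bal].
rewrite -(gK (a ⊗ b)) /rho_T tlift_tlift; last exact: lam'_bal.
by rewrite /tlift; elim/big_ind: _ => // p _; exact: Pl.
Qed.

(** * Comultiplication of slices, and reversal of the comultiplications by the antipode *)

Definition flipl (t : tens_l H) : tens_r H := tlift (fun u v => S v ⊗ S u) t.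
Definition flipr (t : tens_r H) : tens_l H := tlift (fun u v => S v ⊗ S u) t.

Lemma flipl_bal :
  balanced lB (lSB H) (fun u v => S v ⊗ S u : tens_r H).
Proof.
split=> [n k m m'|m k n n'|x m n].
- by rewrite linearP /= tpairPr.
- by rewrite linearP /= tpairPl.
- by rewrite /lSB S_lB S_lC -tpairB.
Qed.

Lemma flipr_bal :
  balanced (rSC H) rC (fun u v => S v ⊗ S u : tens_l H).
Proof.
split=> [n k m m'|m k n n'|y m n].
- by rewrite linearP /= tpairPr.
- by rewrite linearP /= tpairPl.
- by rewrite /rSC S_rB S_rC tpairB.
Qed.

Lemma flipl_lin : linear flipl.
Proof. by apply: tlift_linear; exact: flipl_bal. Qed.
Lemma flipr_lin : linear flipr.
Proof. by apply: tlift_linear; exact: flipr_bal. Qed.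

Lemma flipr_flipl t : flipr (flipl t) = tlift (fun u v => S (S u) ⊗ S (S v)) t.
Proof. by rewrite /flipr /flipl tlift_tlift_pair //; exact: flipr_bal. Qed.

(** Coassociativity sliced on its third leg; the factor [c] acts on the first leg and does not meet
    the slice. *)
Lemma DBl_lam w a b c :
  DBl (lam w a b) c = tlift (fun u v => u ⊗ lam w v b) (DBl a c).
Proof.
rewrite {1}/lam (lin_tlift (h := fun z => DBl z c)); last by move=> k u v; rewrite DBlPl.
transitivity (tlift (fun d e => tlift (fun u v => u ⊗ lB (sB' (adCl w e)) v)
  (DBl d c) : tens_l H) (DBr a b)).
  by apply: eq_tlift => d e; rewrite DBl_lB.
rewrite (tens3_apply (th := fun u v e => u ⊗ lB (sB' (adCl w e)) v) _
  (DB_coassoc (mb_left H) c a b)); last first.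
  split=> [p|m n k p p'|x m n p].
  - split=> [n k m m'|m k n n'|x m n].
    + by rewrite tpairPl.
    + by rewrite lBr tpairPr.
    + by rewrite /lSB lB_lC -[lC _ (lB _ _)]/(lSB H x _) tpairB.
  - by rewrite adClP linearP /= lBl tpairPr.
  - by rewrite /lSB adCl_lC anti_inv_mul antiK lBM.
by apply: eq_tlift => u v; rewrite -tlift_pairr.
Qed.

Lemma DBr_rho' w a b c :
  DBr (rho' w a b) c = tlift (fun u v => rho' w u b ⊗ v) (DBr a c).
Proof.
rewrite {1}/rho' (lin_tlift (h := fun z => DBr z c)); last by move=> k u v; rewrite DBrPl.
transitivity (tlift (fun d e => tlift (fun u v => lC (sB (adBl w d)) u ⊗ v)
  (DBr e c) : tens_l H) (DBl a b)).
  by apply: eq_tlift => d e; rewrite DBr_lC.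
rewrite -(tens3_apply (th := fun d u v => lC (sB (adBl w d)) u ⊗ v) _
  (DB_coassoc (mb_left H) b a c)); last first.
  split=> [p|m n k p p'|x m n p].
  - split=> [n k m m'|m k n n'|x m n].
    + by rewrite adBlP linearP /= lCl tpairPl.
    + by rewrite lCr tpairPl.
    + by rewrite /lSB adBl_lB anti_mul lCM.
  - by rewrite tpairPr.
  - by rewrite -lB_lC tpairB.
by apply: eq_tlift => u v; rewrite -tlift_pairl.
Qed.

Lemma DCl_lam' w a b c :
  DCl (lam' w a b) c = tlift (fun u v => u ⊗ lam' w a v) (DCl b c).
Proof.
rewrite {1}/lam' (lin_tlift (h := fun z => DCl z c)); last by move=> k u v; rewrite DClPl.
transitivity (tlift (fun d e => tlift (fun u v => u ⊗ rB (sC (adCr w e)) v)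
  (DCl d c) : tens_r H) (DCr b a)).
  by apply: eq_tlift => d e; rewrite DCl_rB.
rewrite (tens3_apply (th := fun u v e => u ⊗ rB (sC (adCr w e)) v) _
  (DC_coassoc (mb_right H) c b a)); last first.
  split=> [p|m n k p p'|y m n p].
  - split=> [n k m m'|m k n n'|y m n].
    + by rewrite tpairPl.
    + by rewrite rBr tpairPr.
    + by rewrite rB_rC tpairB.
  - by rewrite adCrP linearP /= rBl tpairPr.
  - by rewrite /rSC adCr_rC anti_mul rBM.
by apply: eq_tlift => u v; rewrite -tlift_pairr.
Qed.

Lemma DCr_rho w a b c :
  DCr (rho w a b) c = tlift (fun u v => rho w a u ⊗ v) (DCr b c).
Proof.
rewrite {1}/rho (lin_tlift (h := fun z => DCr z c)); last by move=> k u v; rewrite DCrPl.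
transitivity (tlift (fun d e => tlift (fun u v => rC (sC' (adBr w d)) u ⊗ v)
  (DCr e c) : tens_r H) (DCl b a)).
  by apply: eq_tlift => d e; rewrite DCr_rC.
rewrite -(tens3_apply (th := fun d u v => rC (sC' (adBr w d)) u ⊗ v) _
  (DC_coassoc (mb_right H) a b c)); last first.
  split=> [p|m n k p p'|y m n p].
  - split=> [n k m m'|m k n n'|y m n].
    + by rewrite adBrP linearP /= rCl tpairPl.
    + by rewrite rCr tpairPl.
    + by rewrite /rSC adBr_rB anti_inv_mul antiK rCM.
  - by rewrite tpairPr.
  - by rewrite -tpairB /rSC rB_rC.
by apply: eq_tlift => u v; rewrite -tlift_pairl.
Qed.

(** The factor [d] now multiplies the leg carrying the slice, so coassociativity is not enough.
    [lam_explicit] evaluates that product by left invariance, and after exchanging the two sums the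
    slice reassembles on the first leg. The result keeps [a] fixed and varies only the second
    argument of [lam]. *)
Lemma DBr_lam w a b d : left_integral w ->
  DBr (lam w a b) d = tlift (fun u v => lam w a v ⊗ S' u) (DCl b (S d)).
Proof.
move=> hw; apply: (cancel_r1 (mb_left H)) => c.
rewrite DBlr DBl_lam !(tmap_tlift _ _ (r1_ok H c)) (tmap_tlift _ _ (r2_ok H d)).
transitivity (tlift (fun u v => tlift (fun p q =>
  u ⊗ lC (adCl w (v ** q)) (S' p) : tens_l H) (DCl b (S d))) (DBl a c)).
  apply: eq_tlift => u v.
  by rewrite (tmapE _ _ (r2_ok H d)) lam_explicit // -tlift_pairr.
rewrite tlift_swap; apply: eq_tlift => p q; rewrite (tmapE _ _ (r1_ok H c)).
have hb : balanced lB (lSB H) (fun u v => lB (sB' (adCl w v)) u ⊗ S' p : tens_l H).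
  have [h1 h2 h3] := lam_bal w.
  split=> [n k m m'|m k n n'|x m n].
  - by rewrite h1 tpairPl.
  - by rewrite h2 tpairPl.
  - by rewrite h3.
transitivity (tlift (fun u v => lB (sB' (adCl w v)) u ⊗ S' p : tens_l H)
    (r2 q (DBl a c))).
  rewrite tlift_tmap //; apply: eq_tlift => u v.
  by rewrite tpairB /lSB antiVK.
rewrite -DBlr -tlift_pairl -/(LamT w _) LamT_r1.
by [].
Qed.

Lemma DBl_rho' w a b c : right_integral w ->
  DBl (rho' w a b) c = tlift (fun u v => S v ⊗ rho' w a u) (DCr b (S' c)).
Proof.
move=> hw; apply: (cancel_r2 (mb_left H)) => d.
rewrite -DBlr DBr_rho' !(tmap_tlift _ _ (r2_ok H d)) (tmap_tlift _ _ (r1_ok H c)).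
transitivity (tlift (fun u v => tlift (fun p q =>
  lB (adBl w (u ** p)) (S q) ⊗ v : tens_l H) (DCr b (S' c))) (DBr a d)).
  apply: eq_tlift => u v.
  by rewrite (tmapE _ _ (r1_ok H c)) rho'_explicit // -tlift_pairl.
rewrite tlift_swap; apply: eq_tlift => p q; rewrite (tmapE _ _ (r2_ok H d)).
have hb : balanced lB (lSB H) (fun u v => S q ⊗ lC (sB (adBl w u)) v : tens_l H).
  have [h1 h2 h3] := rho'_bal w.
  split=> [n k m m'|m k n n'|x m n].
  - by rewrite h1 tpairPr.
  - by rewrite h2 tpairPr.
  - by rewrite h3.
transitivity (tlift (fun u v => S q ⊗ lC (sB (adBl w u)) v : tens_l H)
    (r1 p (DBr a d))).
  rewrite tlift_tmap //; apply: eq_tlift => u v.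
  by rewrite tpairB.
rewrite DBlr -tlift_pairr -/(RhoT w _) RhoT_r2.
by [].
Qed.

(** It suffices to take [g] a slice along an integral: strong invariance turns [S (lam w a b)] into
    [lam' w a b], and the formulas for Delta_C of the latter and Delta_B of the former match under
    the flip. *)
Lemma DCl_S w g d : left_integral w -> (forall y, exists a, adCl w a = y) ->
  DCl (S g) (S d) = flipl (DBr g d).
Proof.
move=> hw su; move: g; apply: (lam_span su) => [|a b ha hb|a b].
- rewrite linear0 (lin0 (h := fun z => DCl z (S d))); last by move=> k u v; rewrite DClPl.
  rewrite (lin0 (h := fun z => DBr z d)); last by move=> k u v; rewrite DBrPl.
  by rewrite (lin0 flipl_lin).
- rewrite linearD (linD (h := fun z => DCl z (S d))); last by move=> k u v; rewrite DClPl.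
  rewrite ha hb (linD (h := fun z => DBr z d)); last by move=> k u v; rewrite DBrPl.
  by rewrite (linD flipl_lin).
- rewrite S_lam // DCl_lam' DBr_lam // /flipl tlift_tlift_pair; last exact: flipl_bal.
  by apply: eq_tlift => u v; rewrite antiVK S_lam.
Qed.

Lemma DBl_S w g d : right_integral w -> (forall x, exists a, adBr w a = x) ->
  DBl (S g) (S d) = flipr (DCr g d).
Proof.
move=> hw su; move: g; apply: (rho_span su) => [|a b ha hb|a b].
- rewrite linear0 (lin0 (h := fun z => DBl z (S d))); last by move=> k u v; rewrite DBlPl.
  rewrite (lin0 (h := fun z => DCr z d)); last by move=> k u v; rewrite DCrPl.
  by rewrite (lin0 flipr_lin).
- rewrite linearD (linD (h := fun z => DBl z (S d))); last by move=> k u v; rewrite DBlPl.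
  rewrite ha hb (linD (h := fun z => DCr z d)); last by move=> k u v; rewrite DCrPl.
  by rewrite (linD flipr_lin).
- rewrite S_rho // DBl_rho' // DCr_rho /flipr tlift_tlift_pair; last exact: flipr_bal.
  by rewrite antiK; apply: eq_tlift => u v; rewrite S_rho.
Qed.

(** * Existence of the modular automorphisms *)

Lemma adS_scalar w : scalar (fun a => w (S a)).
Proof. by move=> k u v; rewrite !linearP. Qed.

Lemma adS'_scalar w : scalar (fun a => w (S' a)).
Proof. by move=> k u v; rewrite !linearP. Qed.

Lemma adS_Bl w x a : w (S (lB x a)) = muB (x ** sB' (adCr w (S a))).
Proof. by rewrite (S_lB) ad_rC -(muC_SB mu) anti_mul antiVK. Qed.
Lemma adS_Br w x a : w (S (rB x a)) = muB (sB' (adCl w (S a)) ** x).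
Proof. by rewrite (S_rB) ad_lC -(muC_SB mu) anti_mul antiVK. Qed.
Lemma adS_Cl w y a : w (S (lC y a)) = muC (y ** sC' (adBr w (S a))).
Proof. by rewrite (S_lC) ad_rB -(muB_SC mu) anti_mul antiVK. Qed.
Lemma adS_Cr w y a : w (S (rC y a)) = muC (sC' (adBl w (S a)) ** y).
Proof. by rewrite (S_rC) ad_lB -(muB_SC mu) anti_mul antiVK. Qed.

Lemma adS'_Bl w x a : w (S' (lB x a)) = muB (x ** sC (adCr w (S' a))).
Proof. by rewrite (S'_lB) ad_rC -(muC_sC' (_ ** _)) anti_inv_mul antiK. Qed.
Lemma adS'_Br w x a : w (S' (rB x a)) = muB (sC (adCl w (S' a)) ** x).
Proof. by rewrite (S'_rB) ad_lC -(muC_sC' (_ ** _)) anti_inv_mul antiK. Qed.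
Lemma adS'_Cl w y a : w (S' (lC y a)) = muC (y ** sB (adBr w (S' a))).
Proof. by rewrite (S'_lC) ad_rB -(muB_sB' (_ ** _)) anti_inv_mul antiK. Qed.
Lemma adS'_Cr w y a : w (S' (rC y a)) = muC (sB (adBl w (S' a)) ** y).
Proof. by rewrite (S'_rC) ad_lB -(muB_sB' (_ ** _)) anti_inv_mul antiK. Qed.

(** Slices exist for adapted functionals only, so the composites with [S] and its inverse need
    module maps. These come from the maps of [w] with [B] and [C], and left and right, exchanged. *)
Definition adS w : adapted mu :=
  @Adapted K A B C H eB eC mu (mk_scalar (adS_scalar w)) _ _ _ _
    (adS_Bl w) (adS_Br w) (adS_Cl w) (adS_Cr w).

Definition adS' w : adapted mu :=
  @Adapted K A B C H eB eC mu (mk_scalar (adS'_scalar w)) _ _ _ _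
    (adS'_Bl w) (adS'_Br w) (adS'_Cl w) (adS'_Cr w).

Lemma adSE w a : adS w a = w (S a). Proof. by []. Qed.
Lemma adS'E w a : adS' w a = w (S' a). Proof. by []. Qed.

Lemma faithful_inj_r w a b : faithful w ->
  (forall c, w (c ** a) = w (c ** b)) -> a = b.
Proof.
move=> fw e; apply/eqP; rewrite -subr_eq0; apply/eqP; apply: contrapT => n0.
have [_ [c]] := fw _ n0; apply.
by rewrite nmulBr linearB /= e subrr.
Qed.

Lemma faithful_inj_l w a b : faithful w ->
  (forall c, w (a ** c) = w (b ** c)) -> a = b.
Proof.
move=> fw e; apply/eqP; rewrite -subr_eq0; apply/eqP; apply: contrapT => n0.
have [[c nc] _] := fw _ n0; apply: nc.
by rewrite nmulBl linearB /= e subrr.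
Qed.

(** Solving the equation pointwise in both directions is enough: faithfulness makes solutions
    unique, and uniqueness gives linearity, multiplicativity and mutual inverses. *)
Lemma modular_aut_ex w : faithful w ->
  (forall a, exists a', forall b, w (a ** b) = w (b ** a')) ->
  (forall a', exists a, forall b, w (a ** b) = w (b ** a')) ->
  exists s : nu_iso A A, is_modular_aut w s.
Proof.
move=> fw /choice[f fP] /choice[g gP].
have fl : linear f.
  move=> k a b; apply: (faithful_inj_r fw) => c.
  rewrite -(fP (k *: a + b) c) nmulPl nmulPr; have h := linearP w k.
  by rewrite !h (fP a c) (fP b c).
have fM a b : f (a ** b) = f a ** f b.
  apply: (faithful_inj_r fw) => c.
  by rewrite -(fP (a ** b) c) -nmulA (fP a) -nmulA (fP b) nmulA.
have fK : cancel f g.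
  by move=> a; apply: (faithful_inj_l fw) => c; rewrite (gP (f a) c) (fP a c).
have gK : cancel g f.
  by move=> a; apply: (faithful_inj_r fw) => c; rewrite -(fP (g a) c) (gP a c).
by exists (@NuIso _ _ _ (mk_linear fl) fM g fK gK) => a b; exact: fP.
Qed.

Section Modular.
Variables phi psi : adapted mu.
Hypotheses (phi_left : left_integral phi) (psi_right : right_integral psi).
Hypotheses (phi_faithful : faithful phi) (psi_faithful : faithful psi).
Hypotheses (phi_Bl : forall x, exists a, adBl phi a = x)
  (phi_Br : forall x, exists a, adBr phi a = x)
  (psi_Cl : forall y, exists a, adCl psi a = y)
  (psi_Cr : forall y, exists a, adCr psi a = y).

(* Both sides are [phi (rho psi b c ** a)]; the antipode turns one kind of
   convolution into another by strong invariance. *)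
Lemma switch_phi_psi a b c :
  phi (c ** rho' (adS' psi) a (S b)) = psi (lam' (adS' phi) (S a) b ** c).
Proof.
rewrite -(ad_rho'_lam' (adS' psi) phi) (ad_rho'_lam' psi (adS' phi)).
rewrite -(S_lam c a phi_left) -anti_mul -(S_rho b c psi_right) -anti_mul.
by rewrite !adS'E !antiK ad_rho_lam.
Qed.

(** Both sides are [phi (a ** rho' psi c b)]. *)
Lemma switch_psi_phi a b c :
  psi (c ** lam (adS phi) b (S' a)) = phi (rho (adS psi) (S' b) a ** c).
Proof.
rewrite (ad_rho_lam psi (adS phi)) -(ad_rho_lam (adS psi) phi).
rewrite !adSE !anti_mul !antiVK (S_lam a c phi_left) (S_rho c b psi_right).
by rewrite ad_rho'_lam'.
Qed.

Definition left_right w w' a a' : Prop := forall b, w (b ** a) = w' (a' ** b).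

Lemma left_right0 w w' : left_right w w' 0 0.
Proof. by move=> b; rewrite nmul0r nmul0l !linear0. Qed.

Lemma left_rightD w w' a a' b b' : left_right w w' a a' ->
  left_right w w' b b' -> left_right w w' (a + b) (a' + b').
Proof. by move=> h h' c; rewrite nmulDr nmulDl !linearD h h'. Qed.

(** Slices along [adS' psi] span [A] because the inverse antipode turns surjectivity of [adCr psi]
    into that of [adBl (adS' psi)]. Each of the four lemmas of this kind draws in this way on one of
    the four fullness conditions. *)
Lemma left_right_phi a : exists a', left_right phi psi a a'.
Proof.
move: a; apply: (rho'_span (w := adS' psi)) => [x||a b [a' h] [b' h']|a b].
- by have [a aE] := psi_Cr (sC' x); exists (S a); rewrite /= antiK aE antiVK.
- by exists 0; exact: left_right0.
- by exists (a' + b'); exact: left_rightD.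
- exists (lam' (adS' phi) (S a) (S' b)) => c.
  by rewrite -switch_phi_psi antiVK.
Qed.

Lemma left_right_psi a' : exists a, left_right phi psi a a'.
Proof.
move: a'; apply: (lam'_span (w := adS' phi)) => [y||a b [a' h] [b' h']|a b].
- by have [a aE] := phi_Bl (sB' y); exists (S a); rewrite /= antiK aE antiVK.
- by exists 0; exact: left_right0.
- by exists (a' + b'); exact: left_rightD.
- exists (rho' (adS' psi) (S' a) (S b)) => c.
  by rewrite switch_phi_psi antiVK.
Qed.

Lemma right_left_psi a : exists a', left_right psi phi a a'.
Proof.
move: a; apply: (lam_span (w := adS phi)) => [y||a b [a' h] [b' h']|a b].
- by have [a aE] := phi_Br (sC y); exists (S' a); rewrite /= antiVK aE antiK.
- by exists 0; exact: left_right0.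
- by exists (a' + b'); exact: left_rightD.
- exists (rho (adS psi) (S' a) (S b)) => c.
  by rewrite -switch_psi_phi antiK.
Qed.

Lemma right_left_phi a' : exists a, left_right psi phi a a'.
Proof.
move: a'; apply: (rho_span (w := adS psi)) => [x||a b [a' h] [b' h']|a b].
- by have [a aE] := psi_Cl (sB x); exists (S' a); rewrite /= antiVK aE antiK.
- by exists 0; exact: left_right0.
- by exists (a' + b'); exact: left_rightD.
- exists (lam (adS phi) (S a) (S' b)) => c.
  by rewrite switch_psi_phi antiK.
Qed.

(** The image of [a] is found through phi(a b) = psi(b p) = phi(b a'), and its preimage by running
    the same chain backwards. *)
Lemma phi_modular : exists s : nu_iso A A, is_modular_aut phi s.
Proof.
apply: modular_aut_ex => // a.
- have [p hp] := right_left_phi a.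
  have [a' ha'] := right_related_ex phi_left psi_right phi_Bl p.
  by exists a' => b; rewrite -hp ha'.
- have [p hp] := right_related_ex' phi_left psi_right psi_Cl a.
  have [a' ha'] := right_left_psi p.
  by exists a' => b; rewrite -ha' hp.
Qed.

Lemma psi_modular : exists s : nu_iso A A, is_modular_aut psi s.
Proof.
apply: modular_aut_ex => // a.
- have [p hp] := left_right_psi a.
  have [a' ha'] := right_related_ex' phi_left psi_right psi_Cl p.
  by exists a' => b; rewrite -hp ha'.
- have [p hp] := right_related_ex phi_left psi_right phi_Bl a.
  have [a' ha'] := left_right_phi p.
  by exists a' => b; rewrite -ha' hp.
Qed.

End Modular.

(** * Module relations in the free argument of a slice *)

Lemma DBr_rC_arg y a b :
  DBr a (rC y b) = tlm idfun (rC y) (DBr a b).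
Proof.
have ok : tcompat lB (lSB H) idfun (rC y) by tcomp.
apply: (cancel_r1 (mb_left H)) => c; rewrite -(tlm_r1 _ ok) // -!DBpairr !DBpairl.
rewrite (tmap_comp _ _ _ ok); apply: eq_tmap => // v /=.
by rewrite rC_mul.
Qed.

Lemma DBl_lB_arg x a b :
  DBl a (lB x b) = tlm idfun (rC (sB x)) (DBl a b).
Proof.
apply: (cancel_r2 (mb_left H)) => c; rewrite -DBpairl tpairB DBpairl.
rewrite (tmap_comp _ _ _ (r2_ok H c)); apply: eq_tmap => // v /=.
by rewrite rC_lC.
Qed.

Lemma DBl_rB_arg x a b :
  DBl a (rB x b) = tlm (rB x) idfun (DBl a b).
Proof.
have ok : tcompat lB (lSB H) (rB x) idfun by tcomp.
apply: (cancel_r2 (mb_left H)) => c; rewrite -(tlm_r2 _ ok) // -!DBpairl !DBpairr.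
rewrite (tmap_comp _ _ _ ok); apply: eq_tmap => // v /=.
by rewrite rB_mul.
Qed.

Lemma DCr_lC_arg y a b :
  DCr a (lC y b) = trm idfun (lC y) (DCr a b).
Proof.
have ok : tcompat (rSC H) rC idfun (lC y) by tcomp.
apply: (cancel_l1 (mb_right H)) => c; rewrite -(trm_l1 _ ok) // -!DCpairr !DCpairl.
rewrite (tmap_comp _ _ _ ok); apply: eq_tmap => // v /=.
by rewrite lC_mul.
Qed.

Lemma DCl_lB_arg x a b :
  DCl a (lB x b) = trm (lB x) idfun (DCl a b).
Proof.
have ok : tcompat (rSC H) rC (lB x) idfun by tcomp.
apply: (cancel_l2 (mb_right H)) => c; rewrite -(trm_l2 _ ok) // -!DCpairl !DCpairr.
rewrite (tmap_comp _ _ _ ok); apply: eq_tmap => // v /=.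
by rewrite lB_mul.
Qed.

Lemma DCl_rB_arg x a b :
  DCl a (rB x b) = trm idfun (lC (sC' x)) (DCl a b).
Proof.
apply: (cancel_l2 (mb_right H)) => c; rewrite -{1}(antiVK sC x) -DCpairl.
rewrite -[rB _ b]/(rSC H (sC' x) b) tpairB DCpairl.
rewrite (tmap_comp _ _ _ (l2_ok H c)); apply: eq_tmap => // v /=.
by rewrite rC_lC.
Qed.

(** A factor [y] on the right of the sliced leg can be extracted because [adCl] and [adCr] agree for
    an integral. *)
Lemma lam_rC_arg w y a b : left_integral w ->
  lam w a (rC y b) = lB (sB' y) (lam w a b).
Proof.
move=> hw; rewrite /lam DBr_rC_arg tlift_tmap; last exact: lam_bal.
rewrite (lin_tlift (h := lB (sB' y))); last by move=> k u v; rewrite lBr.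
apply: eq_tlift => u v.
by rewrite !left_int_adC // adCr_rC anti_inv_mul lBM.
Qed.

Lemma lam_lC_arg w y a b :
  lam w a (lC y b) = rB (sB' y) (lam w a b).
Proof.
rewrite -{1}(antiVK sB y) /lam DBr_lSB tlift_tmap; last exact: lam_bal.
rewrite (lin_tlift (h := rB (sB' y))); last by move=> k u v; rewrite rBr.
by apply: eq_tlift => u v; rewrite lB_rB.
Qed.

Lemma lam'_rC_arg w y a b :
  lam' w (rC y a) b = lB (sC y) (lam' w a b).
Proof.
rewrite /lam' DCr_rC_arg tlift_tmap; last exact: lam'_bal.
rewrite (lin_tlift (h := lB (sC y))); last by move=> k u v; rewrite lBr.
by apply: eq_tlift => u v; rewrite lB_rB.
Qed.

Lemma lam'_lC_arg w y a b : left_integral w ->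
  lam' w (lC y a) b = rB (sC y) (lam' w a b).
Proof.
move=> hw; rewrite /lam' DCr_lC_arg tlift_tmap; last exact: lam'_bal.
rewrite (lin_tlift (h := rB (sC y))); last by move=> k u v; rewrite rBr.
apply: eq_tlift => u v.
by rewrite -!left_int_adC // adCl_lC anti_mul rBM.
Qed.

Lemma rho_lB_arg w x a b : right_integral w ->
  rho w (lB x a) b = rC (sC' x) (rho w a b).
Proof.
move=> hw; rewrite /rho DCl_lB_arg tlift_tmap; last exact: rho_bal.
rewrite (lin_tlift (h := rC (sC' x))); last by move=> k u v; rewrite rCr.
apply: eq_tlift => u v.
by rewrite -!right_int_adB // adBl_lB anti_inv_mul rCM.
Qed.

Lemma rho_rB_arg w x a b :
  rho w (rB x a) b = lC (sC' x) (rho w a b).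
Proof.
rewrite /rho DCl_rB_arg tlift_tmap; last exact: rho_bal.
rewrite (lin_tlift (h := lC (sC' x))); last by move=> k u v; rewrite lCr.
by apply: eq_tlift => u v; rewrite lC_rC.
Qed.

Lemma rho'_lB_arg w x a b :
  rho' w a (lB x b) = rC (sB x) (rho' w a b).
Proof.
rewrite /rho' DBl_lB_arg tlift_tmap; last exact: rho'_bal.
rewrite (lin_tlift (h := rC (sB x))); last by move=> k u v; rewrite rCr.
by apply: eq_tlift => u v; rewrite lC_rC.
Qed.

Lemma rho'_rB_arg w x a b : right_integral w ->
  rho' w a (rB x b) = lC (sB x) (rho' w a b).
Proof.
move=> hw; rewrite /rho' DBl_rB_arg tlift_tmap; last exact: rho'_bal.
rewrite (lin_tlift (h := lC (sB x))); last by move=> k u v; rewrite lCr.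
apply: eq_tlift => u v.
by rewrite !right_int_adB // adBr_rB anti_mul lCM.
Qed.

Lemma flipl_r1 t b : flipl (r1 b t) = l2 (S b) (flipl t).
Proof.
rewrite /flipl tlift_tmap; last exact: flipl_bal.
rewrite (tmap_tlift _ _ (l2_ok H _)); apply: eq_tlift => u v.
by rewrite (tmapE _ _ (l2_ok H _)) anti_mul.
Qed.

Lemma flipl_r2 t b : flipl (r2 b t) = l1 (S b) (flipl t).
Proof.
rewrite /flipl tlift_tmap; last exact: flipl_bal.
rewrite (tmap_tlift _ _ (l1_ok H _)); apply: eq_tlift => u v.
by rewrite (tmapE _ _ (l1_ok H _)) anti_mul.
Qed.

Lemma flipr_l1 t b : flipr (l1 b t) = r2 (S b) (flipr t).
Proof.
rewrite /flipr tlift_tmap; last exact: flipr_bal.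
rewrite (tmap_tlift _ _ (r2_ok H _)); apply: eq_tlift => u v.
by rewrite (tmapE _ _ (r2_ok H _)) anti_mul.
Qed.

Lemma flipr_l2 t b : flipr (l2 b t) = r1 (S b) (flipr t).
Proof.
rewrite /flipr tlift_tmap; last exact: flipr_bal.
rewrite (tmap_tlift _ _ (r1_ok H _)); apply: eq_tlift => u v.
by rewrite (tmapE _ _ (r1_ok H _)) anti_mul.
Qed.

Lemma S2_lB x a : S (S (lB x a)) = lB (sC (sB x)) (S (S a)).
Proof. by rewrite S_lB S_rC. Qed.
Lemma S2_lC y a : S (S (lC y a)) = lC (sB (sC y)) (S (S a)).
Proof. by rewrite S_lC S_rB. Qed.
Lemma S2_rB x a : S (S (rB x a)) = rB (sC (sB x)) (S (S a)).
Proof. by rewrite S_rB S_lC. Qed.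
Lemma S2_rC y a : S (S (rC y a)) = rC (sB (sC y)) (S (S a)).
Proof. by rewrite S_rC S_lB. Qed.
Lemma S2'_lB x a : S' (S' (lB x a)) = lB (sB' (sC' x)) (S' (S' a)).
Proof. by rewrite S'_lB S'_rC. Qed.
Lemma S2'_lC y a : S' (S' (lC y a)) = lC (sC' (sB' y)) (S' (S' a)).
Proof. by rewrite S'_lC S'_rB. Qed.
Lemma S2'_rC y a : S' (S' (rC y a)) = rC (sC' (sB' y)) (S' (S' a)).
Proof. by rewrite S'_rC S'_lB. Qed.

(** * M(B) and M(C) as the multipliers concentrated on one leg *)

Section MultiplierLegs.
Local Notation tmL m := (tlm idfun (mL m)).
Local Notation tmR m := (tlm idfun (mR m)).
Local Notation mtL m := (tlm (mL m) idfun).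
Local Notation mtR m := (tlm (mR m) idfun).
Implicit Types (m n : mult A).

(** The clause on [lC] makes left multiplication by [m] on the second leg descend to [tens_l]; right
    multiplication descends for every multiplier. *)
Definition second_leg m : Prop :=
  [/\ forall y a, m *> lC y a = lC y (m *> a),
      forall a b, DBl (m *> a) b = tmL m (DBl a b)
    & forall a b, DBl (a <* m) b = tmR m (DBl a b)].

Definition first_leg m : Prop :=
  [/\ forall x a, m *> lB x a = lB x (m *> a),
      forall a b, DBr (m *> a) b = mtL m (DBr a b)
    & forall a b, DBr (a <* m) b = mtR m (DBr a b)].

Lemma tmL_ok m : (forall y a, m *> lC y a = lC y (m *> a)) ->
  tcompat lB (lSB H) idfun (mL m).
Proof.
by move=> h; split; [|move=> k u v; rewrite linearP| |move=> x a; exact: h].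
Qed.

Lemma tmR_ok m : tcompat lB (lSB H) idfun (mR m).
Proof.
split; [by []|by move=> k u v; rewrite linearP|by []|move=> x a].
by rewrite /lSB /Defs.lC (mL_mR (qg_nondeg H)).
Qed.

Lemma mtL_ok m : (forall x a, m *> lB x a = lB x (m *> a)) ->
  tcompat lB (lSB H) (mL m) idfun.
Proof.
by move=> h; split; [move=> k u v; rewrite linearP| |move=> x a; exact: h|].
Qed.

Lemma mtR_ok m : tcompat lB (lSB H) (mR m) idfun.
Proof.
split; [by move=> k u v; rewrite linearP|by []|move=> x a|by []].
by rewrite /Defs.lB (mL_mR (qg_nondeg H)).
Qed.

(** Elements of [B] act through the second leg by [DBl_lB] and [DBl_rB]. As [m] multiplies [B] into
    [B], this extends to [m] on BA = A and AB = A. *)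
Lemma second_leg_of_sub m : mult_of_sub (iB H) m -> second_leg m.
Proof.
case=> T TP.
have mL_lB x a : m *> lB x a = lB (T *> x) a.
  by have [h _] := TP x; exact: (congr1 (fun n => n *> a) h).
have mR_rB x a : (rB x a) <* m = rB (x <* T) a.
  by have [_ h] := TP x; exact: (congr1 (fun n => a <* n) h).
have cm y a : m *> lC y a = lC y (m *> a).
  move: a; apply: (lB_span (H := H)) => [|a b ha hb|x a].
  - by rewrite (lin0 (h := lC y)) ?linear0 ?(lin0 (h := lC y)) // => k u v; rewrite lCr.
  - have D := linD (h := lC y) (fun k u v => lCr H k y u v).
    by rewrite D !linearD /= D ha hb.
  - by rewrite -lB_lC !mL_lB lB_lC.
have okL := tmL_ok cm; have okR := tmR_ok m.
split=> // a b; move: a.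
- have l1 : linear (fun z => DBl (m *> z) b) by move=> k u v; rewrite linearP DBlPl.
  have l2 : linear (fun z => tmL m (DBl z b)).
    by move=> k u v; rewrite DBlPl (tmap_linear okL).
  apply: (lB_span (H := H)) => [|a a' ha hb|x a].
  + by rewrite (lin0 l1) (lin0 l2).
  + by rewrite (linD l1) (linD l2) ha hb.
  + rewrite mL_lB !DBl_lB (tmap_comp _ _ _ okL); apply: eq_tmap => // v /=.
    by rewrite mL_lB.
- have l1 : linear (fun z => DBl (z <* m) b) by move=> k u v; rewrite linearP DBlPl.
  have l2 : linear (fun z => tmR m (DBl z b)).
    by move=> k u v; rewrite DBlPl (tmap_linear okR).
  apply: (rB_span (H := H)) => [|a a' ha hb|x a].
  + by rewrite (lin0 l1) (lin0 l2).
  + by rewrite (linD l1) (linD l2) ha hb.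
  + rewrite mR_rB !DBl_rB (tmap_comp _ _ _ okR); apply: eq_tmap => // v /=.
    by rewrite mR_rB.
Qed.

Lemma first_leg_of_sub m : mult_of_sub (iC H) m -> first_leg m.
Proof.
case=> T TP.
have mL_lC y a : m *> lC y a = lC (T *> y) a.
  by have [h _] := TP y; exact: (congr1 (fun n => n *> a) h).
have mR_rC y a : (rC y a) <* m = rC (y <* T) a.
  by have [_ h] := TP y; exact: (congr1 (fun n => a <* n) h).
have cm x a : m *> lB x a = lB x (m *> a).
  move: a; apply: (lC_span (H := H)) => [|a b ha hb|y a].
  - by rewrite (lin0 (h := lB x)) ?linear0 ?(lin0 (h := lB x)) // => k u v; rewrite lBr.
  - have D := linD (h := lB x) (fun k u v => lBr H k x u v).
    by rewrite D !linearD /= D ha hb.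
  - by rewrite lB_lC !mL_lC lB_lC.
have okL := mtL_ok cm; have okR := mtR_ok m.
split=> // a b; move: a.
- have l1 : linear (fun z => DBr (m *> z) b) by move=> k u v; rewrite linearP DBrPl.
  have l2 : linear (fun z => mtL m (DBr z b)).
    by move=> k u v; rewrite DBrPl (tmap_linear okL).
  apply: (lC_span (H := H)) => [|a a' ha hb|y a].
  + by rewrite (lin0 l1) (lin0 l2).
  + by rewrite (linD l1) (linD l2) ha hb.
  + rewrite mL_lC !DBr_lC (tmap_comp _ _ _ okL); apply: eq_tmap => // v /=.
    by rewrite mL_lC.
- have l1 : linear (fun z => DBr (z <* m) b) by move=> k u v; rewrite linearP DBrPl.
  have l2 : linear (fun z => mtR m (DBr z b)).
    by move=> k u v; rewrite DBrPl (tmap_linear okR).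
  apply: (rC_span (H := H)) => [|a a' ha hb|y a].
  + by rewrite (lin0 l1) (lin0 l2).
  + by rewrite (linD l1) (linD l2) ha hb.
  + rewrite mR_rC !DBr_rC (tmap_comp _ _ _ okR); apply: eq_tmap => // v /=.
    by rewrite mR_rC.
Qed.

(* Right invariance gives [n * psi_B(a) = psi_B(n a)] and
   [psi_B(a) * n = psi_B(a n)] for multipliers [n] acting on the second leg. *)
Lemma sub_of_second_leg w n : right_integral w ->
  (forall x, exists a, adBl w a = x) -> second_leg n -> mult_of_sub (iB H) n.
Proof.
move=> hw su [cn nL nR]; have okL := tmL_ok cn; have okR := tmR_ok n.
apply: mult_of_subP => [|x|x]; first exact: iB_inj.
- have [a <-] := su x; exists (adBl w (n *> a)).
  apply: (mL_inj (qg_nondeg H)) => b; rewrite -[RHS]/(lB _ b) -right_int //.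
  rewrite -[LHS]/(n *> lB _ b) -right_int //.
  have -> : DBr (n *> a) b = tmL n (DBr a b).
    apply: (cancel_r1 (mb_left H)) => c.
    rewrite -(tlm_r1 _ okL) // !DBlr nL (tlm_r2 _ okL) // => v.
    by rewrite (mL_mul (qg_nondeg H)).
  rewrite /RhoT tlift_tmap; last exact: rho'_bal.
  rewrite (lin_tlift (h := mL n)); last by move=> k u v; rewrite linearP.
  by apply: eq_tlift => u v; rewrite cn.
- have [a <-] := su x; exists (adBl w (a <* n)).
  apply: (mL_inj (qg_nondeg H)) => b; rewrite -[RHS]/(lB _ b) -right_int //.
  rewrite -[LHS]/(lB _ (n *> b)) -right_int //; congr (RhoT w _).
  apply: (cancel_r1 (mb_left H)) => c; rewrite !DBlr nR.
  rewrite (tmap_comp _ _ _ (r2_ok H b)); apply: eq_tmap => // v /=.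
  by rewrite mult_compat.
Qed.

Lemma sub_of_first_leg w n : left_integral w ->
  (forall y, exists a, adCl w a = y) -> first_leg n -> mult_of_sub (iC H) n.
Proof.
move=> hw su [cn nL nR]; have okL := mtL_ok cn; have okR := mtR_ok n.
apply: mult_of_subP => [|y|y]; first exact: iC_inj.
- have [a <-] := su y; exists (adCl w (n *> a)).
  apply: (mL_inj (qg_nondeg H)) => b; rewrite -[RHS]/(lC _ b) -left_int //.
  rewrite -[LHS]/(n *> lC _ b) -left_int //.
  have -> : DBl (n *> a) b = mtL n (DBl a b).
    apply: (cancel_r2 (mb_left H)) => c.
    rewrite -(tlm_r2 _ okL) // -!DBlr nL (tlm_r1 _ okL) // => v.
    by rewrite (mL_mul (qg_nondeg H)).
  rewrite /LamT tlift_tmap; last exact: lam_bal.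
  rewrite (lin_tlift (h := mL n)); last by move=> k u v; rewrite linearP.
  by apply: eq_tlift => u v; rewrite cn.
- have [a <-] := su y; exists (adCl w (a <* n)).
  apply: (mL_inj (qg_nondeg H)) => b; rewrite -[RHS]/(lC _ b) -left_int //.
  rewrite -[LHS]/(lC _ (n *> b)) -left_int //; congr (LamT w _).
  apply: (cancel_r2 (mb_left H)) => c; rewrite -!DBlr nR.
  rewrite (tmap_comp _ _ _ (r1_ok H b)); apply: eq_tmap => // v /=.
  by rewrite mult_compat.
Qed.

Section Transport.
Variables (s : nu_iso A A) (q : A -> A).
Hypothesis q_surj : forall a, exists a', q a' = a.

(** When Delta_B(s(a)) is (q ⊗ s)Delta_B(a), conjugation by [s] affects the second leg alone. The
    map [k] is the twist of [s] on [C]; it need not be trivial, and surjectivity of [k] and [q] lets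
    every test element be written in twisted form. *)
Lemma second_leg_ext (k : C -> C) m : (forall y, exists y', k y' = y) ->
  (forall y a, s (lC y a) = lC (k y) (s a)) ->
  balanced lB (lSB H) (fun u v => q u ⊗ s v : tens_l H) ->
  (forall a b, DBl (s a) (q b) = tlift (fun u v => q u ⊗ s v) (DBl a b)) ->
  second_leg m -> second_leg (mult_ext s m).
Proof.
move=> k_surj sC bal sD [cm mL_ mR_].
have cn y a : mult_ext s m *> lC y a = lC y (mult_ext s m *> a).
  have [y' <-] := k_surj y; rewrite -(isoVK s a) -sC /= !isoK.
  by rewrite cm sC.
have okL := tmL_ok cn; have okR := tmR_ok (mult_ext s m).
split=> // a b; have [b' <-] := q_surj b; rewrite -(isoVK s a).
- rewrite [mult_ext s m *> _]/= isoK !sD mL_ (tmap_tlift _ _ okL).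
  rewrite tlift_tmap //; apply: eq_tlift => u v.
  by rewrite (tmapE _ _ okL) /= isoK.
- rewrite [_ <* mult_ext s m]/= isoK !sD mR_ (tmap_tlift _ _ okR).
  rewrite tlift_tmap //; apply: eq_tlift => u v.
  by rewrite (tmapE _ _ okR) /= isoK.
Qed.

Lemma first_leg_ext (k : B -> B) m : (forall x, exists x', k x' = x) ->
  (forall x a, s (lB x a) = lB (k x) (s a)) ->
  balanced lB (lSB H) (fun u v => s u ⊗ q v : tens_l H) ->
  (forall a b, DBr (s a) (q b) = tlift (fun u v => s u ⊗ q v) (DBr a b)) ->
  first_leg m -> first_leg (mult_ext s m).
Proof.
move=> k_surj sB bal sD [cm mL_ mR_].
have cn x a : mult_ext s m *> lB x a = lB x (mult_ext s m *> a).
  have [x' <-] := k_surj x; rewrite -(isoVK s a) -sB /= !isoK.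
  by rewrite cm sB.
have okL := mtL_ok cn; have okR := mtR_ok (mult_ext s m).
split=> // a b; have [b' <-] := q_surj b; rewrite -(isoVK s a).
- rewrite [mult_ext s m *> _]/= isoK !sD mL_ (tmap_tlift _ _ okL).
  rewrite tlift_tmap //; apply: eq_tlift => u v.
  by rewrite (tmapE _ _ okL) /= isoK.
- rewrite [_ <* mult_ext s m]/= isoK !sD mR_ (tmap_tlift _ _ okR).
  rewrite tlift_tmap //; apply: eq_tlift => u v.
  by rewrite (tmapE _ _ okR) /= isoK.
Qed.

End Transport.

End MultiplierLegs.

(** * Properties of the modular automorphisms *)

Section ModularAutomorphisms.
Variables phi psi : adapted mu.
Hypotheses (phi_left : left_integral phi) (psi_right : right_integral psi).
Hypotheses (phi_faithful : faithful phi) (psi_faithful : faithful psi).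
Hypotheses (phi_Cl : forall y, exists a, adCl phi a = y)
  (psi_Bl : forall x, exists a, adBl psi a = x).
Variables sphi spsi : nu_iso A A.
Hypotheses (sphiP : is_modular_aut phi sphi) (spsiP : is_modular_aut psi spsi).

Lemma psi_Br x : exists a, adBr psi a = x.
Proof. by have [a aE] := psi_Bl x; exists a; rewrite -right_int_adB. Qed.

Lemma DCr_S g d : DCr (S g) (S d) = flipl (DBl g d).
Proof.
apply: (cancel_l1 (mb_right H)) => c; rewrite -(antiVK S c).
rewrite -DClr (DCl_S _ _ phi_left phi_Cl) -flipl_r1 DBlr flipl_r2.
by [].
Qed.

Lemma DBr_S g d : DBr (S g) (S d) = flipr (DCl g d).
Proof.
apply: (cancel_r1 (mb_left H)) => c; rewrite -(antiVK S c).
by rewrite DBlr (DBl_S _ _ psi_right psi_Br) -flipr_l1 -DClr flipr_l2.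
Qed.

Lemma DBl_S2 g d :
  DBl (S (S g)) (S (S d)) = tlift (fun u v => S (S u) ⊗ S (S v)) (DBl g d).
Proof. by rewrite (DBl_S _ _ psi_right psi_Br) DCr_S flipr_flipl. Qed.

Lemma DBr_S2 g d :
  DBr (S (S g)) (S (S d)) = tlift (fun u v => S (S u) ⊗ S (S v)) (DBr g d).
Proof. by rewrite DBr_S (DCl_S _ _ phi_left phi_Cl) flipr_flipl. Qed.

Lemma S2_bal :
  balanced lB (lSB H) (fun u v => S (S u) ⊗ S (S v) : tens_l H).
Proof.
split=> [n k m m'|m k n n'|x m n].
- by rewrite !linearP /= tpairPl.
- by rewrite !linearP /= tpairPr.
- by rewrite /lSB S2_lC S2_lB tpairB.
Qed.

Lemma S2'_bal :
  balanced lB (lSB H) (fun u v => S' (S' u) ⊗ S' (S' v) : tens_l H).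
Proof.
split=> [n k m m'|m k n n'|x m n].
- by rewrite !linearP /= tpairPl.
- by rewrite !linearP /= tpairPr.
- by rewrite /lSB S2'_lC S2'_lB tpairB /lSB antiK antiVK.
Qed.

Lemma DBr_S2' g d :
  DBr (S' (S' g)) (S' (S' d)) = tlift (fun u v => S' (S' u) ⊗ S' (S' v)) (DBr g d).
Proof.
rewrite -{2}(antiVK S g) -{2}(antiVK S (S' g)) -{2}(antiVK S d) -{2}(antiVK S (S' d)).
rewrite DBr_S2 tlift_tlift_pair; last exact: S2'_bal.
rewrite -[LHS]tliftK; apply: eq_tlift => u v.
by rewrite !antiK.
Qed.

(** S^2 respects Delta_B, so it carries slices along [psi] to slices along the composite of [psi]
    with S^-2. *)
Lemma rho'_S2 a b :
  S (S (rho' psi a b)) = rho' (adS' (adS' psi)) (S (S a)) (S (S b)).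
Proof.
rewrite /rho' DBl_S2 tlift_tlift_pair; last exact: rho'_bal.
rewrite (lin_tlift (h := fun z => S (S z))); last by move=> k u v; rewrite !linearP.
by apply: eq_tlift => u v; rewrite S2_lC /= !antiK.
Qed.

Lemma lam_S2' a b :
  S' (S' (lam phi a b)) = lam (adS (adS phi)) (S' (S' a)) (S' (S' b)).
Proof.
rewrite /lam DBr_S2' tlift_tlift_pair; last exact: lam_bal.
rewrite (lin_tlift (h := fun z => S' (S' z))); last by move=> k u v; rewrite !linearP.
by apply: eq_tlift => u v; rewrite S2'_lB /= !antiVK.
Qed.

(** Tested by psi(c -), both sides become [phi (b ** rho psi c a)], on the left through the modular
    property of [phi]. *)
Lemma lam_sphi a b : lam phi a (sphi b) = lam' phi b a.
Proof.
apply: (faithful_inj_r psi_faithful) => c.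
by rewrite ad_rho_lam -sphiP ad_rho_lam'_r.
Qed.

Lemma rho_spsi a b : rho psi b a = rho' psi a (spsi b).
Proof.
apply: (faithful_inj_l phi_faithful) => c.
by rewrite -ad_rho_lam spsiP ad_lam_rho'.
Qed.

(** The counit functional recovers phi(c sphi(a)) from [lam phi c (sphi a)], which is
    [lam' phi a c]. A right factor y of [a] leaves [lam'] as left multiplication by S_C(y), while a
    right factor z leaves [lam] as S_B^-1(z); matching them gives z = S_B(S_C(y)). *)
Lemma sphi_rC y a : sphi (rC y a) = rC (sB (sC y)) (sphi a).
Proof.
apply: (faithful_inj_r phi_faithful) => c; rewrite -!chi_lam.
by rewrite lam_sphi lam'_rC_arg lam_rC_arg // lam_sphi antiK.
Qed.

Lemma sphi_lC y a : sphi (lC y a) = lC (sB (sC y)) (sphi a).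
Proof.
apply: (faithful_inj_r phi_faithful) => c; rewrite -!chi_lam.
by rewrite lam_sphi lam'_lC_arg // lam_lC_arg lam_sphi antiK.
Qed.

Lemma spsi_lB x a : spsi (lB x a) = lB (sB' (sC' x)) (spsi a).
Proof.
apply: (faithful_inj_r psi_faithful) => c; rewrite -!chi_rho'.
by rewrite -rho_spsi rho_lB_arg // rho'_lB_arg -rho_spsi antiVK.
Qed.

Lemma spsi_rB x a : spsi (rB x a) = rB (sB' (sC' x)) (spsi a).
Proof.
apply: (faithful_inj_r psi_faithful) => c; rewrite -!chi_rho'.
by rewrite -rho_spsi rho_rB_arg rho'_rB_arg // -rho_spsi antiVK.
Qed.

(** Strong invariance before and after [lam_sphi] turns [lam' phi c (sphi a)] into
    [S (S (lam phi a c))]. This square is cancelled by the composite of [psi] with S^-2 along which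
    [rho'_S2] slices, and [ad_lam_rho'] returns to [phi]. *)
Lemma sphi_rho' a b :
  sphi (rho' psi a b) = S (S (rho' psi (S' (S' (sphi a))) b)).
Proof.
apply: (faithful_inj_r phi_faithful) => c; rewrite -sphiP rho'_S2 !antiVK.
rewrite -(ad_rho'_lam' (adS' (adS' psi)) phi) -(S_lam _ _ phi_left).
rewrite lam_sphi -(S_lam _ _ phi_left) !adS'E !anti_inv_mul !antiK.
by rewrite ad_lam_rho'.
Qed.

Lemma spsi_lam a b :
  spsi (lam phi a b) = S' (S' (lam phi (S (S (spsi a))) b)).
Proof.
apply: (faithful_inj_r psi_faithful) => c; rewrite -spsiP lam_S2' !antiK.
rewrite (ad_rho_lam psi (adS (adS phi))) -[rho psi c _](antiK S) S_rho //.
rewrite -rho_spsi -[rho psi a c](antiK S) S_rho // !adSE !anti_mul !antiVK.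
by rewrite ad_lam_rho'.
Qed.

Lemma S2_sphi_bal :
  balanced lB (lSB H) (fun u v => S (S u) ⊗ sphi v : tens_l H).
Proof.
split=> [n k m m'|m k n n'|x m n].
- by rewrite !linearP /= tpairPl.
- by rewrite !linearP /= tpairPr.
- by rewrite /lSB sphi_lC S2_lB tpairB.
Qed.

Lemma S2_sphi_bal_r :
  balanced (rSC H) rC (fun u v => S (S u) ⊗ sphi v : tens_r H).
Proof.
split=> [n k m m'|m k n n'|y m n].
- by rewrite !linearP /= tpairPl.
- by rewrite !linearP /= tpairPr.
- by rewrite /rSC sphi_rC S2_rB -tpairB.
Qed.

Lemma spsi_S2'_bal :
  balanced lB (lSB H) (fun u v => spsi u ⊗ S' (S' v) : tens_l H).
Proof.
split=> [n k m m'|m k n n'|x m n].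
- by rewrite !linearP /= tpairPl.
- by rewrite !linearP /= tpairPr.
- by rewrite /lSB spsi_lB S2'_lC tpairB /lSB antiVK antiK.
Qed.

Lemma spsi_S2'_bal_r :
  balanced (rSC H) rC (fun u v => spsi u ⊗ S' (S' v) : tens_r H).
Proof.
split=> [n k m m'|m k n n'|y m n].
- by rewrite !linearP /= tpairPl.
- by rewrite !linearP /= tpairPr.
- by rewrite /rSC spsi_rB S2'_rC -tpairB /rSC antiVK antiK.
Qed.

(** The two formulas for slices do not interfere: [DBl_rho'] varies the second argument of [rho'],
    whereas [sphi_rho'] changes the first. *)
Lemma DBl_sphi a b :
  DBl (sphi a) (S (S b)) = tlift (fun u v => S (S u) ⊗ sphi v) (DBl a b).
Proof.
have l1 : linear (fun z => DBl (sphi z) (S (S b))).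
  by move=> k u v; rewrite linearP DBlPl.
have l2 : linear (fun z => tlift (fun u v => S (S u) ⊗ sphi v) (DBl z b) : tens_l H).
  by move=> k u v; rewrite DBlPl (tlift_linear S2_sphi_bal).
move: a; apply: (rho'_span psi_Bl) => [|a a' h h'|a c].
- by rewrite (lin0 l1) (lin0 l2).
- by rewrite (linD l1) (linD l2) h h'.
- rewrite sphi_rho' DBl_S2 !(DBl_rho' _ _ _ psi_right).
  rewrite (tlift_tlift_pair _ _ _ S2_bal) (tlift_tlift_pair _ _ _ S2_sphi_bal).
  by apply: eq_tlift => u v; rewrite sphi_rho'.
Qed.

Lemma DBr_spsi a b :
  DBr (spsi a) (S' (S' b)) = tlift (fun u v => spsi u ⊗ S' (S' v)) (DBr a b).
Proof.
have l1 : linear (fun z => DBr (spsi z) (S' (S' b))).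
  by move=> k u v; rewrite linearP DBrPl.
have l2 : linear (fun z => tlift (fun u v => spsi u ⊗ S' (S' v)) (DBr z b) : tens_l H).
  by move=> k u v; rewrite DBrPl (tlift_linear spsi_S2'_bal).
move: a; apply: (lam_span phi_Cl) => [|a a' h h'|a c].
- by rewrite (lin0 l1) (lin0 l2).
- by rewrite (linD l1) (linD l2) h h'.
- rewrite spsi_lam DBr_S2' !(DBr_lam _ _ _ phi_left).
  rewrite (tlift_tlift_pair _ _ _ S2'_bal) (tlift_tlift_pair _ _ _ spsi_S2'_bal).
  by apply: eq_tlift => u v; rewrite spsi_lam.
Qed.

Lemma sphi_DB : DB_intertwines H sphi (fun a => S (S a)) sphi.
Proof.
exists (mk_linear (tlift_linear S2_sphi_bal)) => [u v|p u v] /=.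
  by rewrite tliftE //; exact: S2_sphi_bal.
rewrite !DBpairl DBl_sphi (tmap_tlift _ _ (r2_ok H _)).
rewrite tlift_tmap; last exact: S2_sphi_bal.
apply: eq_tlift => m n.
by rewrite (tmapE _ _ (r2_ok H _)) iso_mul.
Qed.

Lemma spsi_DB : DB_intertwines H spsi spsi (fun a => S' (S' a)).
Proof.
exists (mk_linear (tlift_linear spsi_S2'_bal)) => [u v|p u v] /=.
  by rewrite tliftE //; exact: spsi_S2'_bal.
rewrite !DBpairr DBr_spsi (tmap_tlift _ _ (r1_ok H _)).
rewrite tlift_tmap; last exact: spsi_S2'_bal.
apply: eq_tlift => m n.
by rewrite (tmapE _ _ (r1_ok H _)) iso_mul.
Qed.

(* [T_lambda] and its inverse [T_lambda_inv] express [Delta_C] through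
   [Delta_B], so the intertwining relation carries over. *)
Lemma DCl_sphi a b :
  DCl (sphi a) (S (S b)) = tlift (fun u v => S (S u) ⊗ sphi v) (DCl a b).
Proof.
have b1 : balanced (rSC H) rC (fun u v => S' u ⊗ v : tens_upC H).
  split=> [n k m m'|m k n n'|y m n].
  - by rewrite linearP /= tpairPl.
  - by rewrite tpairPr.
  - by rewrite /rSC S'_rB antiK tpairB.
have b2 : balanced lC rC (fun u v => S u ⊗ v : tens_r H).
  split=> [n k m m'|m k n n'|y m n].
  - by rewrite linearP /= tpairPl.
  - by rewrite tpairPr.
  - by rewrite S_lC -tpairB.
have b3 : balanced lC rC (fun u v => DBl v u).
  split=> [n k m m'|m k n n'|y m n].
  - by rewrite DBlPr.
  - by rewrite DBlPl.
  - by rewrite DBl_rC.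
(* S ⊗ id identifies [tens_upC] with [tens_r], so an equality in [tens_r] may be tested after S^-1 ⊗
   id followed by the injective T_lambda. *)
have inv t : tlift (fun u v => S u ⊗ v : tens_r H)
    (tlift (fun u v => S' u ⊗ v : tens_upC H) t) = t.
  rewrite (tlift_tlift_pair _ _ _ b2) -[RHS]tliftK.
  by apply: eq_tlift => u v; rewrite antiVK.
rewrite -[LHS]inv -[RHS]inv; congr (tlift _ _).
apply: (bij_inj (T_lambda_bij H)); rewrite /T_lambda !(tlift_tlift_pair _ _ _ b3).
have b4 : balanced (rSC H) rC (fun u v => DBl v (S' u)).
  split=> [n k m m'|m k n n'|y m n].
  - by rewrite linearP /= DBlPr.
  - by rewrite DBlPl.
  - by rewrite /rSC S'_rB antiK DBl_rC.
rewrite (tlift_tlift_pair _ _ _ b4) -(antiVK S b) T_lambda_inv.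
(* Both sides are the image of [S' b ⊗ a] under S^2 ⊗ [sphi]: on the left [T_lambda_inv] has
   produced it directly, on the right it is expanded by [T_lambda_inv] and each term is computed by
   [DBl_sphi]. *)
transitivity (tlift (fun u v => tlift (fun m n => S (S m) ⊗ sphi n : tens_l H)
    (DBl v (S' u))) (DCl a (S (S' b)))).
  rewrite -(tlift_tlift _ _ S2_sphi_bal) T_lambda_inv tliftE //.
  exact: S2_sphi_bal.
by apply: eq_tlift => u v; rewrite antiK -{2}(antiVK S u) DBl_sphi.
Qed.

Lemma DCr_spsi a b :
  DCr (spsi a) (S' (S' b)) = tlift (fun u v => spsi u ⊗ S' (S' v)) (DCr a b).
Proof.
have b1 : balanced (rSC H) rC (fun u v => u ⊗ S v : tensB H).
  split=> [n k m m'|m k n n'|y m n].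
  - by rewrite tpairPl.
  - by rewrite linearP /= tpairPr.
  - by rewrite /rSC S_rC tpairB.
have b2 : balanced rB lB (fun u v => u ⊗ S' v : tens_r H).
  split=> [n k m m'|m k n n'|x m n].
  - by rewrite tpairPl.
  - by rewrite linearP /= tpairPr.
  - by rewrite S'_lB -tpairB /rSC antiVK.
have b3 : balanced rB lB (fun u v => DBr u v).
  split=> [n k m m'|m k n n'|x m n].
  - by rewrite DBrPl.
  - by rewrite DBrPr.
  - by rewrite DBr_rB.
have inv t : tlift (fun u v => u ⊗ S' v : tens_r H)
    (tlift (fun u v => u ⊗ S v : tensB H) t) = t.
  rewrite (tlift_tlift_pair _ _ _ b2) -[RHS]tliftK.
  by apply: eq_tlift => u v; rewrite antiK.
rewrite -[LHS]inv -[RHS]inv; congr (tlift _ _).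
apply: (bij_inj (T_rho_bij H)); rewrite /T_rho !(tlift_tlift_pair _ _ _ b3).
have b4 : balanced (rSC H) rC (fun u v => DBr u (S v)).
  split=> [n k m m'|m k n n'|y m n].
  - by rewrite DBrPl.
  - by rewrite linearP /= DBrPr.
  - by rewrite /rSC S_rC DBr_rB.
rewrite (tlift_tlift_pair _ _ _ b4) T_rho_inv -(antiK S b).
transitivity (tlift (fun u v => tlift (fun m n => spsi m ⊗ S' (S' n) : tens_l H)
    (DBr u (S v))) (DCr a (S' (S b)))).
  rewrite -(tlift_tlift _ _ spsi_S2'_bal) T_rho_inv tliftE ?antiK //.
  exact: spsi_S2'_bal.
by apply: eq_tlift => u v; rewrite antiVK -{2}(antiK S v) DBr_spsi.
Qed.

Lemma sphi_DC : DC_intertwines H sphi (fun a => S (S a)) sphi.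
Proof.
exists (mk_linear (tlift_linear S2_sphi_bal_r)) => [u v|p u v] /=.
  by rewrite tliftE //; exact: S2_sphi_bal_r.
rewrite !DCpairl DCl_sphi (tmap_tlift _ _ (l2_ok H _)).
rewrite tlift_tmap; last exact: S2_sphi_bal_r.
apply: eq_tlift => m n.
by rewrite (tmapE _ _ (l2_ok H _)) iso_mul.
Qed.

Lemma spsi_DC : DC_intertwines H spsi spsi (fun a => S' (S' a)).
Proof.
exists (mk_linear (tlift_linear spsi_S2'_bal_r)) => [u v|p u v] /=.
  by rewrite tliftE //; exact: spsi_S2'_bal_r.
rewrite !DCpairr DCr_spsi (tmap_tlift _ _ (l1_ok H _)).
rewrite tlift_tmap; last exact: spsi_S2'_bal_r.
apply: eq_tlift => m n.
by rewrite (tmapE _ _ (l1_ok H _)) iso_mul.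
Qed.

(** * Stability of M(B) and M(C) under the modular automorphisms *)

Let sphi' := inverse_iso sphi.
Let spsi' := inverse_iso spsi.

Lemma sphi'_lC y a : sphi' (lC y a) = lC (sC' (sB' y)) (sphi' a).
Proof.
apply: (can_inj (isoK sphi)).
rewrite sphi_lC.
by rewrite /= !isoVK !antiVK.
Qed.

Lemma spsi'_lB x a : spsi' (lB x a) = lB (sC (sB x)) (spsi' a).
Proof.
apply: (can_inj (isoK spsi)).
rewrite spsi_lB.
by rewrite /= !isoVK !antiK.
Qed.

Lemma S2'_sphi'_bal :
  balanced lB (lSB H) (fun u v => S' (S' u) ⊗ sphi' v : tens_l H).
Proof.
split=> [n k m m'|m k n n'|x m n].
- by rewrite !linearP /= tpairPl.
- by rewrite linearP tpairPr.
- by rewrite /lSB sphi'_lC S2'_lB tpairB /lSB antiK antiVK.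
Qed.

Lemma spsi'_S2_bal :
  balanced lB (lSB H) (fun u v => spsi' u ⊗ S (S v) : tens_l H).
Proof.
split=> [n k m m'|m k n n'|x m n].
- by rewrite linearP tpairPl.
- by rewrite !linearP /= tpairPr.
- by rewrite /lSB spsi'_lB S2_lC tpairB.
Qed.

Lemma DBl_sphi' a b :
  DBl (sphi' a) (S' (S' b)) = tlift (fun u v => S' (S' u) ⊗ sphi' v) (DBl a b).
Proof.
rewrite -{2}(isoVK sphi a) -{2}(antiVK S b) -{2}(antiVK S (S' b)).
rewrite DBl_sphi.
rewrite (tlift_tlift_pair _ _ _ S2'_sphi'_bal) -[LHS]tliftK.
by apply: eq_tlift => u v; rewrite !antiK /= isoK.
Qed.

Lemma DBr_spsi' a b :
  DBr (spsi' a) (S (S b)) = tlift (fun u v => spsi' u ⊗ S (S v)) (DBr a b).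
Proof.
rewrite -{2}(isoVK spsi a) -{2}(antiK S b) -{2}(antiK S (S b)).
rewrite DBr_spsi.
rewrite (tlift_tlift_pair _ _ _ spsi'_S2_bal) -[LHS]tliftK.
by apply: eq_tlift => u v; rewrite !antiVK /= isoK.
Qed.

(** Membership in M(B) is expressed by [second_leg], a condition on Delta_B that both [sphi] and its
    inverse preserve; the two inclusions come from these two maps. *)
Lemma sphi_mult_B : (mult_ext sphi @` mult_of_sub (iB H))%classic = mult_of_sub (iB H).
Proof.
apply/seteqP; split=> [_ [m /second_leg_of_sub hm <-]|m /second_leg_of_sub hm].
- apply: (sub_of_second_leg psi_right psi_Bl).
  refine (second_leg_ext (q := fun a => S (S a)) _
    (k := fun y => sB (sC y)) _ _ _ _ hm).
  + by move=> a; exists (S' (S' a)); rewrite !antiVK.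
  + by move=> y; exists (sC' (sB' y)); rewrite !antiVK.
  + exact: sphi_lC.
  + exact: S2_sphi_bal.
  + exact: DBl_sphi.
- exists (mult_ext sphi' m); last exact: mult_extK.
  apply: (sub_of_second_leg psi_right psi_Bl).
  refine (second_leg_ext (q := fun a => S' (S' a)) _
    (k := fun y => sC' (sB' y)) _ _ _ _ hm).
  + by move=> a; exists (S (S a)); rewrite !antiK.
  + by move=> y; exists (sB (sC y)); rewrite !antiK.
  + exact: sphi'_lC.
  + exact: S2'_sphi'_bal.
  + exact: DBl_sphi'.
Qed.

Lemma spsi_mult_C : (mult_ext spsi @` mult_of_sub (iC H))%classic = mult_of_sub (iC H).
Proof.
apply/seteqP; split=> [_ [m /first_leg_of_sub hm <-]|m /first_leg_of_sub hm].
- apply: (sub_of_first_leg phi_left phi_Cl).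
  refine (first_leg_ext (q := fun a => S' (S' a)) _
    (k := fun x => sB' (sC' x)) _ _ _ _ hm).
  + by move=> a; exists (S (S a)); rewrite !antiK.
  + by move=> x; exists (sC (sB x)); rewrite !antiK.
  + exact: spsi_lB.
  + exact: spsi_S2'_bal.
  + exact: DBr_spsi.
- exists (mult_ext spsi' m); last exact: mult_extK.
  apply: (sub_of_first_leg phi_left phi_Cl).
  refine (first_leg_ext (q := fun a => S (S a)) _
    (k := fun x => sC (sB x)) _ _ _ _ hm).
  + by move=> a; exists (S' (S' a)); rewrite !antiVK.
  + by move=> x; exists (sB' (sC' x)); rewrite !antiVK.
  + exact: spsi'_lB.
  + exact: spsi'_S2_bal.
  + exact: DBr_spsi'.
Qed.

Lemma sphi_mult_C y :
  mult_ext sphi (iC H y) = iC H (sigma_muC H y) /\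
  iC H (sigma_muC H y) = mult_anti_ext S (mult_anti_ext S (iC H y)).
Proof.
have e1 := sphi_lC.
have e2 := sphi_rC.
split; apply: mult_eq => a.
- by rewrite -[LHS]/(sphi (lC y (iso_inv sphi a))) e1 isoVK.
- by rewrite -[LHS]/(sphi (rC y (iso_inv sphi a))) e2 isoVK.
- by rewrite -[RHS]/(S (S (lC y (S' (S' a))))) S2_lC !antiVK.
- by rewrite -[RHS]/(S (S (rC y (S' (S' a))))) S2_rC !antiVK.
Qed.

Lemma spsi_mult_B x :
  mult_ext spsi (iB H x) = iB H (sigma_muB H x) /\
  iB H (sigma_muB H x) =
    mult_anti_ext (inverse_anti_iso S) (mult_anti_ext (inverse_anti_iso S) (iB H x)).
Proof.
have e1 := spsi_lB.
have e2 := spsi_rB.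
split; apply: mult_eq => a.
- by rewrite -[LHS]/(spsi (lB x (iso_inv spsi a))) e1 isoVK.
- by rewrite -[LHS]/(spsi (rB x (iso_inv spsi a))) e2 isoVK.
- by rewrite -[RHS]/(S' (S' (lB x (S (S a))))) S2'_lB !antiK.
- by rewrite -[RHS]/(S' (S' (rB x (S (S a))))) S'_rB S'_lC !antiK.
Qed.

End ModularAutomorphisms.

End Hopf.

Theorem theorem3p4p4 (R : realType) (A B C : nualgType R[i])
    (H : regular_mha A B C)
    (eB : left_counit H) (eC : right_counit H) (S : antipode eB eC)
    (mu : base_weight eB eC) (phi psi : adapted mu)
    (phi_full : full_left_integral phi) (phi_faithful : faithful phi)
    (psi_full : full_right_integral psi) (psi_faithful : faithful psi) :
  exists sphi spsi : nu_iso A A,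
    [/\ is_modular_aut phi sphi /\ is_modular_aut psi spsi,
        (forall y : C,
           mult_ext sphi (iC H y) = iC H (sigma_muC H y) /\
           iC H (sigma_muC H y) = mult_anti_ext S (mult_anti_ext S (iC H y))),
        (forall x : B,
           mult_ext spsi (iB H x) = iB H (sigma_muB H x) /\
           iB H (sigma_muB H x) =
             mult_anti_ext (inverse_anti_iso S)
               (mult_anti_ext (inverse_anti_iso S) (iB H x))),
        [/\ DB_intertwines H sphi (fun a => S (S a)) sphi,
            DC_intertwines H sphi (fun a => S (S a)) sphi,
            DB_intertwines H spsi spsi
              (fun a => anti_inv S (anti_inv S a)) &
            DC_intertwines H spsi spsi
              (fun a => anti_inv S (anti_inv S a))] &
        flat_mha H ->
          mult_ext sphi @` mult_of_sub (iB H) = mult_of_sub (iB H) /\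
          mult_ext spsi @` mult_of_sub (iC H) = mult_of_sub (iC H)].
Proof.
have [phi_left phi_Bl phi_Br] := phi_full.
have [psi_right psi_Cl psi_Cr] := psi_full.
(* The [C]-side of [phi] and the [B]-side of [psi], on which [full_left_integral] and
   [full_right_integral] are silent, are needed for the slices [lam phi] and [rho' psi] to span
   [A]. *)
have phi_Cl := adCl_surj phi_left psi_right phi_faithful psi_faithful phi_Bl psi_Cl.
have psi_Bl := adBl_surj phi_left psi_right phi_faithful psi_faithful phi_Bl psi_Cl.
have [sphi sphiP] := phi_modular S phi_left psi_right phi_faithful phi_Bl phi_Br psi_Cl.
have [spsi spsiP] := psi_modular S phi_left psi_right psi_faithful phi_Bl psi_Cl psi_Cr.
exists sphi, spsi; split.
- by split.
- exact: (sphi_mult_C S phi_left phi_faithful psi_faithful sphiP).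
- exact: (spsi_mult_B S psi_right phi_faithful psi_faithful spsiP).
- split.
  + exact: (sphi_DB S phi_left psi_right phi_faithful psi_faithful phi_Cl psi_Bl sphiP).
  + exact: (sphi_DC S phi_left psi_right phi_faithful psi_faithful phi_Cl psi_Bl sphiP).
  + exact: (spsi_DB S phi_left psi_right phi_faithful psi_faithful phi_Cl psi_Bl spsiP).
  + exact: (spsi_DC S phi_left psi_right phi_faithful psi_faithful phi_Cl psi_Bl spsiP).
- move=> _; split.
  + exact: (sphi_mult_B S phi_left psi_right phi_faithful psi_faithful phi_Cl psi_Bl
      sphiP).
  + exact: (spsi_mult_C S phi_left psi_right phi_faithful psi_faithful phi_Cl psi_Bl
      spsiP).
Qed.
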